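(* Let $r\ge 1$, let $(A;M_1,\dots,M_r)$ be an admissible system (as defined in the context) and let $(D,\delta)$ be a decoration of $A$. Then the associated $C^*$-algebra $\mathcal{A}=\mathcal{A}_D$ is purely infinite; that is, for every nonzero positive $h\in\mathcal{A}$ the hereditary $C^*$-subalgebra $\overline{h\mathcal{A}h}$ contains an infinite projection.
   Context: Notation. $\mathbb{Z}_+$ is the set of nonnegative integers, $e_1,\dots,e_r$ is the standard basis of $\mathbb{Z}^r$; for $m,n\in\mathbb{Z}^r$, $m\le n$ is meant coordinatewise and $[m,n]=\{k\in\mathbb{Z}^r: m\le k\le n\}$. Words. Let $A$ be a finite nonempty set (the alphabet) and $M_1,\dots,M_r$ matrices with entries $M_j(b,a)$, $a,b\in A$. For $m\in\mathbb{Z}_+^r$ let $W_m$ be the set of maps $w:[0,m]\to A$ with $M_j(w(l+e_j),w(l))=1$ whenever $l,l+e_j\in[0,m]$ (words of shape $m$). For $w\in W_m$ put $\sigma(w)=m$, $o(w)=w(0)$, $t(w)=w(m)$. Let $W=\bigcup_m W_m$ and identify $A$ with $W_0$. For $0\le k\le l\le m$ and $w\in W_m$, $w|_{[k,l]}\in W_{l-k}$ is $i\mapsto w(i+k)$. For $0\ne p\in\mathbb{Z}^r$, a word $w\in W_l$ is $p$-periodic if $w(j)=w(j-p)$ for all $j\in[0,l]\cap[p,p+l]$. Admissible system. $(A;M_1,\dots,M_r)$ is called admissible if: (H0) each $M_i$ is a nonzero $\{0,1\}$-matrix; (H1) whenever $u\in W_m$, $v\in W_n$ and $t(u)=o(v)$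 there is a unique $w\in W_{m+n}$ with $w|_{[0,m]}=u$ and $w|_{[m,m+n]}=v$ (this $w$ is written $uv$); (H2) the directed graph with vertex set $A$ and a directed edge from $a$ to $b$ for each $i$ with $M_i(b,a)=1$ is irreducible (there is a directed path from any vertex to any vertex); (H3) for each $p\in\mathbb{Z}^r$, $p\ne0$, there is some $w\in W$ which is not $p$-periodic. Decorations. A decoration is a nonempty finite or countable set $D$ with a map $\delta:D\to A$. Put $\overline W_m=\{(d,w)\in D\times W_m: o(w)=\delta(d)\}$, $\overline W=\bigcup_m\overline W_m$, with $o(d,w)=d$, $t(d,w)=t(w)$, $\sigma(d,w)=\sigma(w)$; identify $D$ with $\overline W_0$. For $\overline u=(d,u)\in\overline W$ and $v\in W$ with $t(u)=o(v)$ put $\overline u v=(d,uv)$. The algebra. $\mathcal{A}=\mathcal{A}_D$ is the universal $C^*$-algebra generated by partial isometries $s_{u,v}$, for $u,v\in\overline W$ with $t(u)=t(v)$, subject to the relations $s_{u,v}^*=s_{v,u}$; $s_{u,v}s_{v,w}=s_{u,w}$; $s_{u,v}=\sum s_{uw,vw}$ for each $1\le j\le r$, the sum being over all $w\in W$ with $\sigma(w)=e_j$ and $o(w)=t(u)=t(v)$; $s_{u,u}s_{v,v}=0$ for $u,v\in\overline W_0$, $u\ne v$. A projection is infinite if it is Murray-von Neumann equivalent to a proper subprojection of itself. *)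

(* Defs.v *)
From HB Require Import structures.
From mathcomp Require Import all_boot all_order all_algebra.
From mathcomp Require Import all_classical all_reals all_analysis.
From mathcomp Require Import complex.

Set Implicit Arguments.
Unset Strict Implicit.
Unset Printing Implicit Defensive.

Import Order.TTheory GRing.Theory Num.Theory.
Import numFieldNormedType.Exports.

Local Open Scope classical_set_scope.
Local Open Scope ring_scope.

(* MathComp rings have a unit, so the product is part of the mixin.  The scalars
   are R[i], so the norm takes values in R[i]; they are nonnegative reals. *)
HB.mixin Record CompleteNormedModule_isCstarAlgebra (R : realType) A
    of CompleteNormedModule R[i] A := {
  cmul : A -> A -> A;
  cstar : A -> A;
  cmulA : associative cmul;
  cmulDl : left_distributive cmul +%R;
  cmulDr : right_distributive cmul +%R;
  cmulZl : forall (a : R[i]) x y, cmul (a *: x) y = a *: cmul x y;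
  cmulZr : forall (a : R[i]) x y, cmul x (a *: y) = a *: cmul x y;
  cstarK : involutive cstar;
  cstarD : {morph cstar : x y / x + y};
  cstarZ : forall (a : R[i]) x, cstar (a *: x) = conjc a *: cstar x;
  cstarM : forall x y, cstar (cmul x y) = cmul (cstar y) (cstar x);
  cnorm_mul_le : forall x y, `|cmul x y| <= `|x| * `|y|;
  cnorm_starM : forall x, `|cmul (cstar x) x| = `|x| ^+ 2
}.

#[short(type="cstarAlgType")]
HB.structure Definition CstarAlgebra (R : realType) :=
  {A of CompleteNormedModule_isCstarAlgebra R A & CompleteNormedModule R[i] A}.

Declare Scope cstar_scope.
Delimit Scope cstar_scope with cstar.
Notation "x '** y" := (cmul x y)
  (at level 40, left associativity, format "x  ''**'  y") : cstar_scope.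
Notation "x '^*" := (cstar x) (at level 2, format "x ''^*'") : cstar_scope.
Local Open Scope cstar_scope.

Definition star_morphism (R : realType) (A B : cstarAlgType R) (f : A -> B) :=
  [/\ forall (a : R[i]) x y, f (a *: x + y) = a *: f x + f y,
      forall x y, f (x '** y) = f x '** f y
    & forall x, f (x '^*) = (f x) '^*].

Section CstarNotions.
Variables (R : realType) (A : cstarAlgType R).
Implicit Types h p q v x : A.

Definition projection p := p '^* = p /\ p '** p = p.

Definition partial_isometry v := v '** v '^* '** v = v.

Definition positive h := exists x, h = x '^* '** x.

Definition mvn_equiv p q := exists v, v '^* '** v = p /\ v '** v '^* = q.

Definition proper_subprojection q p :=
  [/\ projection q, p '** q = q & q <> p].

Definition infinite_projection p :=
  projection p /\ exists q, proper_subprojection q p /\ mvn_equiv p q.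

Definition hereditary h : set A := closure [set h '** x '** h | x in setT].

Definition purely_infinite := forall h, positive h -> h <> 0 ->
  exists p, hereditary h p /\ infinite_projection p.

End CstarNotions.

Definition mshape (r : nat) := {ffun 'I_r -> nat}.

(* [box m] is the interval [0, m]. *)
Definition box (r : nat) (m : mshape r) := {dffun forall i : 'I_r, 'I_(m i).+1}.

Definition unit_shape (r : nat) (j : 'I_r) : mshape r := [ffun i => (i == j : nat)].

Definition in_box (r : nat) (m l : mshape r) := [forall i, (l i <= m i)%N].

Definition coords (r : nat) (m : mshape r) (l : box m) : mshape r :=
  [ffun i => (l i : nat)].

(* Meaningful only if [in_box m l]. *)
Definition to_box (r : nat) (m l : mshape r) : box m :=
  [ffun i : 'I_r => (inord (l i) : 'I_(m i).+1)].

Lemma in_box_coords (r : nat) (m : mshape r) (l : box m) : in_box m (coords l).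
Proof. by apply/forallP => i; rewrite ffunE -ltnS. Qed.

Lemma coordsK (r : nat) (m l : mshape r) :
  in_box m l -> coords (to_box m l) = l.
Proof.
by move=> /forallP lm; apply/ffunP => i; rewrite !ffunE inordK // ltnS.
Qed.

Lemma to_boxK (r : nat) (m : mshape r) (l : box m) : to_box m (coords l) = l.
Proof. by apply/ffunP => i; rewrite !ffunE inord_val. Qed.

Section Words.
Variables (r : nat) (A : finType) (M : 'I_r -> A -> A -> nat).

Definition is_word (m : mshape r) (w : {ffun box m -> A}) :=
  [forall j : 'I_r, forall l : box m,
     in_box m (coords l + unit_shape j) ==>
     (M j (w (to_box m (coords l + unit_shape j))) (w l) == 1%N)].

Definition word_of (m : mshape r) := {w : {ffun box m -> A} | is_word w}.

(* The restriction of [w] to [k, k + n], translated to [0, n]; meaningful only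
   if [in_box m (k + n)]. *)
Definition window (m : mshape r) (w : word_of m) (k n : mshape r) :
    {ffun box n -> A} :=
  [ffun l => val w (to_box m (coords l + k))].

Definition word := {m : mshape r & word_of m}.
Definition mkword (m : mshape r) (w : word_of m) : word := Tagged word_of w.

Definition wshape (w : word) : mshape r := tag w.
Definition worigin (w : word) : A := val (tagged w) (to_box (tag w) 0).
Definition wterm (w : word) : A := val (tagged w) (to_box (tag w) (tag w)).

Definition is_product (m n : mshape r) (u : word_of m) (v : word_of n)
    (w : word_of (m + n)) :=
  (window w 0 m == val u) && (window w m n == val v).

(* The word uv; the value is irrelevant if there is no such word. *)
Definition wprod (u v : word) : word :=
  if [pick w | is_product (tagged u) (tagged v) w] is Some w then mkword w else u.

Definition periodic (p : {ffun 'I_r -> int}) (m : mshape r) (w : word_of m) :=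
  forall j k : box m,
    (forall i, (k i : nat)%:Z = (j i : nat)%:Z - p i) -> val w j = val w k.

Definition edge : rel A := [rel a b | [exists i, M i b a == 1%N]].

Record admissible : Prop := Admissible {
  adm_01 : forall i a b, M i b a = 0%N \/ M i b a = 1%N;
  adm_neq0 : forall i, exists a b, M i b a <> 0%N;
  adm_product : forall (m n : mshape r) (u : word_of m) (v : word_of n),
    wterm (mkword u) = worigin (mkword v) ->
    exists! w : word_of (m + n), is_product u v w;
  adm_irreducible : forall a b, connect edge a b;
  adm_aperiodic : forall p : {ffun 'I_r -> int}, p <> 0 ->
    exists (m : mshape r) (w : word_of m), ~ periodic p w
}.

Lemma worigin_prod (u v : word) : worigin (wprod u v) = worigin u.
Proof.
rewrite /wprod; case: pickP => // w /andP[/eqP uw _].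
rewrite /worigin /= -uw ffunE coordsK; first by rewrite addr0.
by apply/forallP => i; rewrite ffunE.
Qed.

Section Decoration.
Variables (D : countType) (delta : D -> A).

Definition decorated := {x : D * word | worigin x.2 == delta x.1}.

Definition dshape (x : decorated) : mshape r := wshape (val x).2.
Definition dterm (x : decorated) : A := wterm (val x).2.

Lemma dprod_subproof (x : decorated) (v : word) :
  worigin (wprod (val x).2 v) == delta (val x).1.
Proof. by rewrite worigin_prod; exact: (valP x). Qed.

Definition dprod (x : decorated) (v : word) : decorated :=
  Sub ((val x).1, wprod (val x).2 v) (dprod_subproof x v).

(* Only the values s u v with dterm u = dterm v are relevant. *)
Record relations (R : realType) (B : cstarAlgType R)
    (s : decorated -> decorated -> B) : Prop := Relations {
  rel_isometry : forall u v, dterm u = dterm v -> partial_isometry (s u v);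
  rel_star : forall u v, dterm u = dterm v -> (s u v) '^* = s v u;
  rel_mul : forall u v w, dterm u = dterm v -> dterm v = dterm w ->
    s u v '** s v w = s u w;
  rel_sum : forall u v, dterm u = dterm v -> forall j : 'I_r,
    s u v = \sum_(w : word_of (unit_shape j) | worigin (mkword w) == dterm u)
              s (dprod u (mkword w)) (dprod v (mkword w));
  rel_orth : forall u v, dshape u = 0 -> dshape v = 0 -> u <> v ->
    s u u '** s v v = 0
}.

Definition is_universal_algebra (R : realType) (B : cstarAlgType R)
    (s : decorated -> decorated -> B) :=
  relations s /\
  forall (E : cstarAlgType R) (t : decorated -> decorated -> E), relations t ->
    exists! f : B -> E, star_morphism f /\
      forall u v, dterm u = dterm v -> f (s u v) = t u v.

End Decoration.
End Words.

(* Main.v *)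
Require Import Defs.
From HB Require Import structures.
From mathcomp Require Import all_boot all_order all_algebra.
From mathcomp Require Import all_classical all_reals all_analysis.
From mathcomp Require Import complex zify ring lra.

(** Why the theorem holds.  Let h be positive and nonzero.  It suffices to find
    w and a generator projection Q = s u u with w^* h^2 w close to Q and w Q = w:
    then w^* h^2 w has an inverse square root c in the corner of Q, and
    v = h w c satisfies v^* v = Q while v v^* lies in h B h, so the infiniteness
    of Q is carried over to v v^* ([cutdown]).  Every s u u is infinite, since
    two different words of the same shape leave each letter and one of them can
    be completed to a loop ([two_words], [s_infinite]).

    To find w, approximate h^2 by k = y^* y with y in the linear span of the
    generators, which is dense by the universal property ([span_dense]).  For
    a point z of the torus the universal property also gives a gauge
    automorphism, multiplying s u v by z to the power shape u - shape v.
    Averaging k over the z whose coordinates are n-th roots of unity, n large,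
    removes exactly the terms with shape u <> shape v and leaves an element X of
    the core, the span of the s u v with u and v of one common shape
    ([average_lsum]).  The norm of X does not degenerate as the approximation
    improves: a fixed fraction of the z is so close to 1 that their automorphisms
    hardly move h, and the other terms of the average are positive, so they
    cannot cancel ([average_lower]).  As X is positive, some column vector of the
    core, a combination of s u v with v fixed, almost realizes its norm
    ([core_vector]).  Finally some word g leaving the end of v is not
    p-periodic for any of the finitely many degrees p <> 0 occurring in k
    ([nonper_seq]); compression by g annihilates the remaining terms of
    nonzero degree ([nonper_compress]).  So the column vector, compressed by g
    and rescaled, is the required w.

    The order on self-adjoint elements enters only through norm estimates
    valid up to constants.  The inequality - M <= a is encoded by
    | 1 - t a | <= 1 + t M for all small t > 0 ([lbounded]), in the unitization
    acting on the algebra by left multiplication.  Squares of self-adjoint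
    elements are nonnegative because 1 - t a^2 is the square of the real part of
    a unitary ([lbounded_sqr]); x^* x is nonnegative by the argument of Kelley
    and Vaught ([opbd_1sub_star]); and - M <= x <= M bounds the norm of x by
    8 M ([two_sided]).  It follows that 0 <= a <= b implies | a | <= 8 | b |
    ([nm_sum_star_le]) and that star morphisms are bounded ([mor_bounded]). *)

Set Implicit Arguments.
Unset Strict Implicit.
Unset Printing Implicit Defensive.

Import Order.TTheory GRing.Theory Num.Theory.
Import numFieldNormedType.Exports.

Local Open Scope classical_set_scope.
Local Open Scope ring_scope.
Local Open Scope complex_scope.
Local Open Scope cstar_scope.

(** * Real-valued norms and rules of calculation in a C*-algebra *)

Section RealNorm.
Variables (R : realType) (B : cstarAlgType R).
Implicit Types (x y : B) (a : R[i]).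

Definition nm x : R := complex.Re `|x|.

Lemma nmE x : `|x| = (nm x)%:C.
Proof. by rewrite /nm RRe_real // ger0_real. Qed.

Lemma nm_ge0 x : 0 <= nm x.
Proof. by have := normr_ge0 x; rewrite nmE lecR. Qed.

Lemma nm0 : nm 0 = 0. Proof. by rewrite /nm normr0. Qed.

Lemma nm_eq0 x : nm x = 0 -> x = 0.
Proof. by move=> x0; apply/normr0_eq0; rewrite nmE x0. Qed.

Lemma nmN x : nm (- x) = nm x. Proof. by rewrite /nm normrN. Qed.

Lemma nmB x y : nm (x - y) = nm (y - x). Proof. by rewrite -nmN opprB. Qed.

Lemma nmD x y : nm (x + y) <= nm x + nm y.
Proof. by have := ler_normD x y; rewrite !nmE -rmorphD lecR. Qed.

Lemma nm_sum (I : Type) (r : seq I) (P : pred I) (F : I -> B) :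
  nm (\sum_(i <- r | P i) F i) <= \sum_(i <- r | P i) nm (F i).
Proof.
elim/big_rec2: _ => [|i u v _ le_vu]; first by rewrite nm0.
by apply: le_trans (nmD _ _) _; rewrite lerD2l.
Qed.

Lemma nmZ a x : nm (a *: x) = Normc.normc a * nm x.
Proof.
have /complexI // : (nm (a *: x))%:C = (Normc.normc a * nm x)%:C.
by rewrite -nmE normrZ nmE rmorphM.
Qed.

Lemma nmZr (t : R) x : nm (t%:C *: x) = `|t| * nm x.
Proof. by rewrite nmZ /= expr0n addr0 sqrtr_sqr. Qed.

Lemma nmM x y : nm (x '** y) <= nm x * nm y.
Proof. by have := cnorm_mul_le x y; rewrite !nmE -rmorphM lecR. Qed.

Lemma nm_starM x : nm (x '^* '** x) = nm x ^+ 2.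
Proof.
have := cnorm_starM x; rewrite !nmE -rmorphXn => /complexI //.
Qed.

Lemma nm_star x : nm (x '^*) = nm x.
Proof.
suff le y : nm y <= nm (y '^*) by apply/eqP; rewrite eq_le le -{2}(cstarK x) le.
have [->|y0] := eqVneq (nm y) 0; first exact: nm_ge0.
have y_gt0 : 0 < nm y by rewrite lt_def y0 nm_ge0.
by rewrite -(ler_pM2r y_gt0) -expr2 -nm_starM nmM.
Qed.

End RealNorm.

Section CstarRules.
Variables (R : realType) (B : cstarAlgType R).
Implicit Types (x y : B) (a : R[i]).

Lemma cmul0x x : 0 '** x = 0.
Proof. by rewrite -[X in X '** _](scale0r x) cmulZl scale0r. Qed.
Lemma cmulx0 x : x '** 0 = 0.
Proof. by rewrite -[X in _ '** X](scale0r x) cmulZr scale0r. Qed.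
Lemma cmulNx x y : (- x) '** y = - (x '** y).
Proof. by rewrite -[- x]scaleN1r cmulZl scaleN1r. Qed.
Lemma cmulxN x y : x '** (- y) = - (x '** y).
Proof. by rewrite -[- y]scaleN1r cmulZr scaleN1r. Qed.
Lemma cmulBl x y z : (x - y) '** z = x '** z - y '** z.
Proof. by rewrite cmulDl cmulNx. Qed.
Lemma cmulBr x y z : z '** (x - y) = z '** x - z '** y.
Proof. by rewrite cmulDr cmulxN. Qed.
Lemma cstar0 : (0 : B) '^* = 0.
Proof. by rewrite -[X in X '^*](scale0r 0) cstarZ conjc0 scale0r. Qed.
Lemma cstarN x : (- x) '^* = - (x '^*).
Proof. by rewrite -[- x]scaleN1r cstarZ rmorphN1 scaleN1r. Qed.
Lemma cstarB x y : (x - y) '^* = x '^* - y '^*.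
Proof. by rewrite cstarD cstarN. Qed.
Lemma cmul_suml (I : Type) (r : seq I) (P : pred I) (F : I -> B) y :
  (\sum_(i <- r | P i) F i) '** y = \sum_(i <- r | P i) (F i '** y).
Proof. by elim/big_rec2: _ => [|i u v _ <-]; rewrite ?cmul0x // cmulDl. Qed.
Lemma cmul_sumr (I : Type) (r : seq I) (P : pred I) (F : I -> B) y :
  y '** (\sum_(i <- r | P i) F i) = \sum_(i <- r | P i) (y '** F i).
Proof. by elim/big_rec2: _ => [|i u v _ <-]; rewrite ?cmulx0 // cmulDr. Qed.
Lemma cstar_sum (I : Type) (r : seq I) (P : pred I) (F : I -> B) :
  (\sum_(i <- r | P i) F i) '^* = \sum_(i <- r | P i) (F i) '^*.
Proof. by elim/big_rec2: _ => [|i u v _ <-]; rewrite ?cstar0 // cstarD. Qed.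
Lemma conjcr (t : R) : conjc t%:C = t%:C.
Proof. by rewrite /= oppr0. Qed.
Lemma cstarZr (t : R) x : (t%:C *: x) '^* = t%:C *: x '^*.
Proof. by rewrite cstarZ conjcr. Qed.
End CstarRules.

(** * The unitization *)

Section Unitization.
Variables (R : realType) (B : cstarAlgType R).

(** A unit is added even if B has one; then [act] is not faithful, and an operator
    bound controls an element only within the image of B ([nm_opbd]). *)
Definition unitization : Type := (B * R[i]^o)%type.
HB.instance Definition _ := GRing.Lmodule.copy unitization (B * R[i]^o)%type.

Implicit Types (u v w : unitization) (x y : B) (a : R[i]).

Definition umul u v : unitization :=
  (u.1 '** v.1 + u.2 *: v.1 + v.2 *: u.1, u.2 * v.2).
Definition uone : unitization := (0, 1).

Lemma u_ext u v : u.1 = v.1 -> u.2 = v.2 -> u = v.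
Proof. by case: u v => [? ?] [? ?] /= -> ->. Qed.

Lemma umulA : associative umul.
Proof.
move=> [x a] [y b] [z c]; rewrite /umul /=; apply: u_ext; last by rewrite mulrA.
rewrite !cmulDl !cmulDr !cmulZl !cmulZr !scalerDr !scalerA cmulA.
rewrite !addrA [c * a]mulrC [c * b]mulrC.
by rewrite [LHS](ACl (1*4*2*5*3*6*7)).
Qed.

Lemma umul1u : left_id uone umul.
Proof.
by case=> x a; rewrite /umul /= cmul0x scaler0 scale1r add0r addr0 mul1r.
Qed.

Lemma umulu1 : right_id uone umul.
Proof.
by case=> x a; rewrite /umul /= cmulx0 scaler0 scale1r !add0r mulr1.
Qed.

Lemma umulDl : left_distributive umul +%R.
Proof.
move=> [x a] [y b] [z c]; rewrite /umul /=; apply: u_ext; last by rewrite mulrDl.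
rewrite /= cmulDl scalerDl scalerDr.
by rewrite !addrA [LHS](ACl (1*3*5*2*4*6)).
Qed.

Lemma umulDr : right_distributive umul +%R.
Proof.
move=> [x a] [y b] [z c]; rewrite /umul /=; apply: u_ext; last by rewrite mulrDr.
rewrite /= cmulDr scalerDl scalerDr.
by rewrite !addrA [LHS](ACl (1*3*5*2*4*6)).
Qed.

Lemma uone_neq0 : uone != 0.
Proof. by rewrite xpair_eqE oner_eq0 andbF. Qed.

HB.instance Definition _ := GRing.Zmodule_isNzRing.Build unitization
  umulA umul1u umulu1 umulDl umulDr uone_neq0.

Lemma uscaleAl (a : R[i]) u v : a *: (u * v) = (a *: u) * v.
Proof.
case: u v => [x b] [y c]; apply: u_ext; last by rewrite /= -scalerAl.
by rewrite /= !scalerDr !scalerA -cmulZl [a * c]mulrC.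
Qed.

HB.instance Definition _ :=
  GRing.Lmodule_isLalgebra.Build R[i] unitization uscaleAl.

Lemma uscaleAr (a : R[i]) u v : a *: (u * v) = u * (a *: v).
Proof.
case: u v => [x b] [y c]; apply: u_ext; last by rewrite /= scalerAr.
by rewrite /= !scalerDr !scalerA -cmulZr [a * b]mulrC.
Qed.

HB.instance Definition _ :=
  GRing.Lalgebra_isAlgebra.Build R[i] unitization uscaleAr.

Definition ustar u : unitization := (u.1 '^*, conjc u.2).
Definition inU x : unitization := (x, 0).
Definition act u x : B := u.1 '** x + u.2 *: x.

Lemma ustarK : involutive ustar.
Proof. by case=> x a; rewrite /ustar /= cstarK conjcK. Qed.
Lemma ustarD : {morph ustar : u v / u + v}.
Proof. by move=> [x a] [y b]; apply: u_ext; rewrite /= ?cstarD ?rmorphD. Qed.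
Lemma ustarZ (a : R[i]) u : ustar (a *: u) = conjc a *: ustar u.
Proof. by case: u => x b; apply: u_ext; rewrite /= ?cstarZ ?rmorphM. Qed.
Lemma ustarZr (t : R) u : ustar (t%:C *: u) = t%:C *: ustar u.
Proof. by rewrite ustarZ conjcr. Qed.
Lemma ustarN u : ustar (- u) = - ustar u.
Proof. by rewrite -[- u]scaleN1r ustarZ rmorphN1 scaleN1r. Qed.
Lemma ustarB u v : ustar (u - v) = ustar u - ustar v.
Proof. by rewrite ustarD ustarN. Qed.
Lemma ustarM u v : ustar (u * v) = ustar v * ustar u.
Proof.
case: u v => [x a] [y b]; apply: u_ext; rewrite /= ?rmorphM 1?mulrC //.
by rewrite /= !cstarD !cstarZ cstarM [LHS](ACl (1*3*2)).
Qed.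
Lemma ustar1 : ustar 1 = 1.
Proof. by apply: u_ext; [exact: cstar0|exact: conjc1]. Qed.
Lemma ustarX u n : ustar (u ^+ n) = ustar u ^+ n.
Proof. by elim: n => [|n IH]; rewrite ?ustar1 // exprS ustarM IH exprSr. Qed.
Lemma inU_star x : ustar (inU x) = inU (x '^*).
Proof. by apply: u_ext => //; exact: conjc0. Qed.
Lemma inUD x y : inU (x + y) = inU x + inU y.
Proof. by apply: u_ext; rewrite /= ?addr0. Qed.
Lemma inUN x : inU (- x) = - inU x.
Proof. by apply: u_ext; rewrite /= ?oppr0. Qed.
Lemma inUB x y : inU (x - y) = inU x - inU y.
Proof. by rewrite inUD inUN. Qed.
Lemma inUM x y : inU (x '** y) = inU x * inU y.
Proof. by apply: u_ext; rewrite /= ?mulr0 ?scale0r ?addr0. Qed.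
Lemma inUZ (a : R[i]) x : inU (a *: x) = a *: inU x.
Proof. by apply: u_ext; rewrite /= ?scaler0. Qed.
Lemma inU_inj : injective inU. Proof. by move=> x y []. Qed.

Lemma act1 x : act 1 x = x.
Proof. by rewrite /act /= cmul0x add0r scale1r. Qed.
Lemma actM u v x : act (u * v) x = act u (act v x).
Proof.
rewrite /act /= !cmulDl cmulDr !cmulZl cmulZr !scalerDr !scalerA -cmulA.
by rewrite !addrA [LHS](ACl (1*3*2*4)).
Qed.
Lemma actDl u v x : act (u + v) x = act u x + act v x.
Proof. by rewrite /act /= cmulDl scalerDl addrACA. Qed.
Lemma actZl (a : R[i]) u x : act (a *: u) x = a *: act u x.
Proof. by rewrite /act /= cmulZl scalerDr scalerA. Qed.
Lemma actNl u x : act (- u) x = - act u x.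
Proof. by rewrite -[- u]scaleN1r actZl scaleN1r. Qed.
Lemma act_inU x y : act (inU x) y = x '** y.
Proof. by rewrite /act /= scale0r addr0. Qed.
Lemma act_star u x y : (act u x) '^* '** y = x '^* '** act (ustar u) y.
Proof.
by rewrite /act /= cstarD cstarM cstarZ cmulDl cmulDr cmulA cmulZl cmulZr.
Qed.

End Unitization.

(** * Operator bounds on the unitization *)

Section Bounds.
Variables (R : realType) (B : cstarAlgType R).
Implicit Types (u v : unitization B) (x y : B) (s t : R).

(** The left regular action makes the C*-identity available in the unitization
    ([opbd_starM]) without constructing a norm there. *)
Definition opbd u t := forall x, nm (act u x) <= t * nm x.

Lemma opbd_le u s t : s <= t -> opbd u s -> opbd u t.
Proof.
by move=> st us x; apply: le_trans (us x) _; rewrite ler_wpM2r ?nm_ge0.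
Qed.

Lemma opbd1 : opbd 1 1. Proof. by move=> x; rewrite act1 mul1r. Qed.

Lemma opbdM u v s t : 0 <= s -> opbd u s -> opbd v t -> opbd (u * v) (s * t).
Proof.
move=> s0 us vt x; rewrite actM; apply: le_trans (us _) _.
by rewrite -mulrA ler_wpM2l.
Qed.

Lemma opbdD u v s t : opbd u s -> opbd v t -> opbd (u + v) (s + t).
Proof.
move=> us vt x; rewrite actDl mulrDl; apply: le_trans (nmD _ _) _.
exact: lerD.
Qed.

Lemma opbdZ (a : R[i]) u t : opbd u t -> opbd (a *: u) (Normc.normc a * t).
Proof.
move=> ut x; rewrite actZl nmZ -mulrA ler_wpM2l //.
by case: (a) => p q /=; exact: sqrtr_ge0.
Qed.

Lemma opbdZr s u t : 0 <= s -> opbd u t -> opbd (s%:C *: u) (s * t).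
Proof. by move=> s0 ut x; rewrite actZl nmZr ger0_norm // -mulrA ler_wpM2l. Qed.

Lemma opbdN u t : opbd u t -> opbd (- u) t.
Proof. by move=> ut x; rewrite actNl nmN. Qed.

Lemma opbdB u v s t : opbd u s -> opbd v t -> opbd (u - v) (s + t).
Proof. by move=> us vt; apply: opbdD => //; apply: opbdN. Qed.

Lemma opbd0 : opbd 0 0.
Proof. by move=> x; rewrite -(subrr 1) actDl actNl subrr nm0 mul0r. Qed.

Lemma opbd_sum (I : Type) (r : seq I) (F : I -> unitization B) (f : I -> R) :
  (forall i, opbd (F i) (f i)) ->
  opbd (\sum_(i <- r) F i) (\sum_(i <- r) f i).
Proof.
move=> Ff; elim/big_rec2: _ => [|i a b _ IH]; first exact: opbd0.
exact: opbdD.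
Qed.

Lemma opbdX u t n : 0 <= t -> opbd u t -> opbd (u ^+ n) (t ^+ n).
Proof.
move=> t0 ut; elim: n => [|n IH]; first exact: opbd1.
by rewrite !exprS; apply: opbdM.
Qed.

Lemma opbd_inU x : opbd (inU x) (nm x).
Proof. by move=> y; rewrite act_inU nmM. Qed.

Lemma nm_opbd x t : 0 <= t -> opbd (inU x) t -> nm x <= t.
Proof.
move=> t0 xt; have [->|x0] := eqVneq (nm x) 0; first by [].
have x_gt0 : 0 < nm x by rewrite lt_def x0 nm_ge0.
rewrite -(ler_pM2r x_gt0) -expr2 -[nm x]nm_star -nm_starM cstarK.
by have := xt (x '^*); rewrite act_inU nm_star.
Qed.

Lemma opbd_starM u t : 0 <= t -> opbd (ustar u * u) (t ^+ 2) -> opbd u t.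
Proof.
move=> t0 ut x; rewrite -(ler_pXn2r (ltn0Sn 1)) ?nnegrE ?mulr_ge0 ?nm_ge0 //.
rewrite -nm_starM act_star -actM; apply: le_trans (nmM _ _) _.
by rewrite nm_star exprMn expr2 [nm x ^+ 2]expr2 mulrCA ler_wpM2l ?nm_ge0 // -expr2.
Qed.

Lemma opbd_star u t : 0 <= t -> opbd u t -> opbd (ustar u) t.
Proof.
move=> t0 ut x; set y := act (ustar u) x.
have [->|y0] := eqVneq (nm y) 0; first by rewrite mulr_ge0 ?nm_ge0.
have y_gt0 : 0 < nm y by rewrite lt_def y0 nm_ge0.
rewrite -(ler_pM2r y_gt0) -expr2 -nm_starM {1}/y act_star ustarK.
apply: le_trans (nmM _ _) _; rewrite nm_star -mulrA mulrCA.
by rewrite ler_wpM2l ?nm_ge0.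
Qed.

(** Bounds for all larger constants suffice. *)
Lemma opbd_lim u t : (forall e, 0 < e -> opbd u (t + e)) -> opbd u t.
Proof.
move=> ue x; apply/ler_addgt0Pr => e e0.
have d0 : 0 < e / (nm x + 1) by rewrite divr_gt0 // ltr_wpDl ?nm_ge0.
apply: le_trans (ue _ d0 x) _; rewrite mulrDl lerD2l.
have := nm_ge0 x => nx; rewrite mulrAC ler_pdivrMr ?ltr_wpDl //.
by rewrite ler_pM2l // lerDl.
Qed.

Lemma bernoulli s n : 0 <= s -> 1 + n%:R * s <= (1 + s) ^+ n.
Proof.
move=> s0; elim: n => [|n IH]; first by rewrite mul0r addr0.
rewrite exprS; apply: le_trans (_ : (1 + s) * (1 + n%:R * s) <= _); last first.
  by rewrite ler_wpM2l // addr_ge0.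
rewrite -natr1; have : 0 <= n%:R * s * s by rewrite !mulr_ge0.
lra.
Qed.

Lemma linear_lt_pow (c s : R) : 0 < s ->
  exists k, c * (2 ^ k)%N.+1%:R <= (1 + s) ^+ (2 ^ k)%N.
Proof.
move=> s0; pose N := Num.bound (3 * `|c| / s ^+ 2).
have Nlt : 3 * `|c| <= (2 ^ N)%:R * s ^+ 2.
  rewrite -ler_pdivrMr ?exprn_gt0 //; apply: (@le_trans _ _ N%:R).
    by apply/ltW/archi_boundP/divr_ge0; [apply: mulr_ge0|rewrite exprn_ge0 // ltW].
  by rewrite ler_nat ltnW // ltn_expl.
exists N.+1; set m := (2 ^ N)%N in Nlt *.
have m1 : (1 <= m)%N by rewrite expn_gt0.
rewrite expnS mulnC exprM -/m.
apply: (@le_trans _ _ ((m%:R * s) ^+ 2)); last first.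
  have s1 := ltW s0.
  apply: lerXn2r; rewrite ?nnegrE ?mulr_ge0 // ?exprn_ge0 ?addr_ge0 //.
  by apply: le_trans (bernoulli m s1); rewrite lerDr.
apply: (@le_trans _ _ (`|c| * (3 * m%:R))); last first.
  by rewrite exprMn expr2; have := ler_wpM2l (ler0n R m) Nlt; lra.
apply: le_trans (ler_wpM2r _ (ler_norm c)) _ => //.
rewrite ler_wpM2l // -natrM ler_nat; lia.
Qed.

Lemma opbd_root u t k : ustar u = u -> 0 <= t ->
  opbd (u ^+ (2 ^ k)%N) (t ^+ (2 ^ k)%N) -> opbd u t.
Proof.
move=> us t0; elim: k => [//|k IH]; rewrite expnSr !exprM => ut; apply: IH.
by apply: opbd_starM; rewrite ?exprn_ge0 // ustarX us -expr2.
Qed.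

(** For self-adjoint u the C*-identity turns the norm of u^(2^k) into a
    2^k-th power, so that any loss linear in the exponent disappears in the limit. *)
Lemma opbd_growth u s (c : R) : ustar u = u -> 0 < s ->
  (forall n, opbd (u ^+ n) (c * n.+1%:R * s ^+ n)) -> opbd u s.
Proof.
move=> us s0 un; apply: opbd_lim => e e0.
have [k ck] := linear_lt_pow c (divr_gt0 e0 s0).
apply: (opbd_root (k := k)) => //; first by rewrite addr_ge0 ?ltW.
apply: opbd_le (un _).
have -> : s + e = (1 + e / s) * s by field; rewrite gt_eqF.
by rewrite exprMn ler_wpM2r // exprn_ge0 // ltW.
Qed.

End Bounds.

(** * Roots of unity *)

Section RootsOfUnity.
Variable R : realType.
Implicit Types (x : R) (n : nat).

Definition expi x : R[i] := Complex (cos x) (sin x).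
Definition uroot n : R[i] := expi (2 * pi / n%:R).

Lemma normc_expi x : Normc.normc (expi x) = 1.
Proof. by rewrite /= cos2Dsin2 sqrtr1. Qed.

Lemma expiX x n : expi x ^+ n = expi (n%:R * x).
Proof.
elim: n => [|n IH]; first by rewrite mul0r /expi cos0 sin0.
rewrite exprSr IH -natr1 mulrDl mul1r /expi cosD sinD.
by congr Complex; rewrite addrC; congr (_ + _); rewrite mulrC.
Qed.

Lemma urootX n : (0 < n)%N -> uroot n ^+ n = 1.
Proof.
move=> n0; rewrite expiX mulrC divfK ?pnatr_eq0 -?lt0n // mulr_natl.
by rewrite /expi cos2pi sin2pi.
Qed.

Lemma cos_half x : cos x = 1 - 2 * sin (x / 2) ^+ 2.
Proof.
rewrite {1}(splitr x) cosD -!expr2 cos2sin2; ring.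
Qed.

Lemma uroot_neq1 n j : (0 < j < n)%N -> uroot n ^+ j != 1.
Proof.
move=> /andP[j0 jn]; apply/eqP; rewrite expiX => -[+ _].
set x := _ * _; rewrite cos_half => /eqP.
have n0 : 0 < n%:R :> R by rewrite ltr0n (leq_trans _ jn).
have xE : x / 2 = j%:R * pi / n%:R by rewrite /x; field; rewrite gt_eqF.
have : 0 < sin (x / 2).
  apply: sin_gt0_pi; rewrite xE divr_gt0 ?mulr_gt0 ?pi_gt0 ?n0 ?ltr0n //=.
  by rewrite ltr_pdivrMr // mulrC ltr_pM2l ?pi_gt0 // ltr_nat.
move=> s0; rewrite -subr_eq0; have := mulr_gt0 s0 s0.
by move=> s2 /eqP; rewrite expr2; lra.
Qed.

Lemma uroot_sum n k : (0 < n)%N ->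
  \sum_(l < n) (uroot n ^+ l) ^+ k = if (n %| k)%N then n%:R else 0.
Proof.
move=> n0; under eq_bigr do rewrite exprAC.
have xn : (uroot n ^+ k) ^+ n = 1 by rewrite exprAC urootX // expr1n.
case: ifP => nk.
  have -> : uroot n ^+ k = 1.
    by rewrite -(divnK nk) mulnC exprM urootX // expr1n.
  by under eq_bigr do rewrite expr1n; rewrite sumr_const card_ord.
have x1 : uroot n ^+ k != 1.
  rewrite (divn_eq k n) exprD mulnC exprM urootX // expr1n mul1r.
  by apply: uroot_neq1; rewrite ltn_mod n0 lt0n [_ == _]nk.
apply/eqP; have /eqP := subrX1 (uroot n ^+ k) n.
by rewrite xn subrr eq_sym mulf_eq0 subr_eq0 (negbTE x1).
Qed.

(** Weighting by the (n-1)-st power, the inverse of the root, selects the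
    coefficient of degree 1 of a polynomial of degree less than n. *)
Lemma uroot_filter n j : (1 < n)%N -> (j < n)%N ->
  \sum_(l < n) (uroot n ^+ l) ^+ (n.-1 + j) = if j == 1%N then n%:R else 0.
Proof.
move=> n1 jn; rewrite uroot_sum; last by lia.
have -> // : (n %| n.-1 + j)%N = (j == 1%N).
apply/dvdnP/eqP => [[k]|->]; last by exists 1%N; lia.
by case: k => [|[|k]]; nia.
Qed.

Lemma normc_uroot n l : Normc.normc (uroot n ^+ l) = 1.
Proof. by rewrite expiX normc_expi. Qed.

Lemma expi_near1 (d : R) : 0 < d -> exists2 t : R, 0 < t &
  forall x, 0 <= x <= t -> Normc.normc (expi x - 1) <= d.
Proof.
move=> d0; have d2 : 0 < d ^+ 2 / 2 by rewrite divr_gt0 ?exprn_gt0.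
have /cvgrPdist_le /(_ _ d2) := @continuous_cos R 0.
case=> e /= e0 cos_near; exists (e / 2); first by rewrite divr_gt0.
move=> x /andP[x0 xe]; have /cos_near : ball_ Num.norm (0 : R) e x.
  rewrite /ball_ /= sub0r normrN ger0_norm //; lra.
rewrite cos0 ler_norml => /andP[_ cx].
rewrite /= -(ger0_norm (ltW d0)) -sqrtr_sqr ler_wsqrtr //.
by have := cos2Dsin2 x; rewrite oppr0 addr0 !expr2; move: cx; rewrite expr2; nra.
Qed.

(** The first q of the L q roots lie on an arc whose length depends on L only. *)
Lemma uroot_near1 (d : R) : 0 < d -> exists2 L, (0 < L)%N &
  forall q l, (l < q)%N -> Normc.normc (uroot (L * q) ^+ l - 1) <= d.
Proof.
move=> /expi_near1[t t0 near1].
pose L := (Num.bound (2 * pi / t)).+1; exists L => // q l lq.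
have q0 : 0 < q%:R :> R by rewrite ltr0n (leq_trans _ lq).
have L0 : 0 < L%:R :> R by rewrite ltr0n.
rewrite expiX; apply: near1; rewrite mulr_ge0 ?divr_ge0 ?mulr_ge0 ?pi_ge0 //=.
have Lt : 2 * pi <= L%:R * t.
  rewrite -ler_pdivrMr //; apply: le_trans (ltW (archi_boundP _)) _.
    by rewrite divr_ge0 ?mulr_ge0 ?pi_ge0 // ltW.
  by rewrite ler_nat /L leqnSn.
rewrite natrM mulrA ler_pdivrMr ?mulr_gt0 //.
apply: (@le_trans _ _ (q%:R * (L%:R * t))); last by rewrite mulrA mulrC [q%:R * _]mulrC.
apply: ler_pM => //; first by rewrite mulr_ge0 // pi_ge0.
by rewrite ler_nat ltnW.
Qed.

End RootsOfUnity.

(** * Fixed points and square roots near the identity *)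

Section FixedPoints.
Variables (R : realType) (B : cstarAlgType R).
Implicit Types (x y : B).

Lemma complete_geometric (u : nat -> B) (C : R) : 0 <= C ->
  (forall n, nm (u n.+1 - u n) <= C * 2^-1 ^+ n) ->
  exists l, forall e : R, 0 < e -> exists N, forall n, (N <= n)%N -> nm (u n - l) <= e.
Proof.
move=> C0 uC.
have tail n k : nm (u (n + k)%N - u n) <= 2 * C * 2^-1 ^+ n * (1 - 2^-1 ^+ k).
  elim: k => [|k IH]; first by rewrite addn0 !subrr nm0 mulr0.
  rewrite addnS -(subrK (u (n + k)%N) (u _.+1)) -addrA.
  apply: le_trans (nmD _ _) _; apply: le_trans (lerD (uC _) IH) _.
  by rewrite exprD exprS; lra.
have tail2 n k : nm (u (n + k)%N - u n) <= 2 * C * 2^-1 ^+ n.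
  by apply: le_trans (tail n k) _; rewrite ler_piMr ?mulr_ge0 ?exprn_ge0 //.
have small (e : R) : 0 < e -> exists N, 2 * C * 2^-1 ^+ N <= e.
  move=> e0; pose N := Num.bound (2 * C / e); exists N.
  have : 2 * C <= (2 ^ N)%:R * e.
    rewrite -ler_pdivrMr //; apply: (@le_trans _ _ N%:R).
      by apply/ltW/archi_boundP/divr_ge0; [apply: mulr_ge0|apply: ltW].
    by rewrite ler_nat ltnW // ltn_expl.
  by rewrite exprVn -natrX ler_pdivrMr ?ltr0n ?expn_gt0 // [e * _]mulrC.
have /cauchy_cvgP cu : cauchy (u @ \oo).
  apply: cauchy_exP => e; rewrite ltcE /= => /andP[/eqP Ie e0].
  have [N Ne] := small _ (divr_gt0 e0 (ltr0Sn R 1)).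
  exists (u N); exists N => // n /= Nn; rewrite -ball_normE /ball_ /=.
  rewrite -normrN opprB nmE ltcE /= -(subnKC Nn).
  rewrite Ie eqxx /=; apply: le_lt_trans (tail2 _ _) _; apply: le_lt_trans Ne _.
  lra.
exists (lim (u @ \oo)) => e e0.
have /cvgrPdist_le/(_ e%:C) : u @ \oo --> lim (u @ \oo) by [].
rewrite ltcR => /(_ e0) [N _ Nu]; exists N => n Nn.
by have := Nu n Nn; rewrite nmE lecR nmB.
Qed.

(** Closedness in the form needed to pass from the iterates to a fixed point. *)
Definition closed_prop (P : B -> Prop) := forall l,
  (forall e : R, 0 < e -> exists2 x, P x & nm (x - l) <= e) -> P l.

Lemma closed_lin (f : B -> B) (K : R) :
  (forall x y, f (x - y) = f x - f y) -> (forall x, nm (f x) <= K * nm x) ->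
  closed_prop (fun x => f x = 0).
Proof.
move=> fB fK l fl; apply: nm_eq0; apply/eqP; rewrite eq_le nm_ge0 andbT.
have K0 : 0 <= `|K| by [].
apply/ler_addgt0Pr => e e0; rewrite add0r.
have d0 : 0 < e / (`|K| + 1) by rewrite divr_gt0 // ltr_wpDl.
have [x fx xl] := fl _ d0.
have := fK (x - l); rewrite fB fx sub0r nmN => le1.
apply: le_trans le1 _; apply: (@le_trans _ _ (`|K| * nm (x - l))).
  by rewrite ler_wpM2r ?nm_ge0 ?ler_norm.
apply: le_trans (ler_wpM2l K0 xl) _.
by rewrite mulrA ler_pdivrMr ?ltr_wpDl // mulrC ler_pM2l // lerDl.
Qed.

Lemma closed_nm (r : R) : closed_prop (fun x => nm x <= r).
Proof.
move=> l H; apply/ler_addgt0Pr => e /H[x xr xl].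
rewrite -[l](subKr x) -opprB nmN; apply: le_trans (nmD _ _) _.
by rewrite nmN addrC lerD.
Qed.

Lemma closed_and P Q : closed_prop P -> closed_prop Q ->
  closed_prop (fun x => P x /\ Q x).
Proof.
by move=> cP cQ l H; split; [apply: cP|apply: cQ] => e /H[x [Px Qx] xl]; exists x.
Qed.

Lemma closed_mull (q : B) : closed_prop (fun x => q '** x - x = 0).
Proof.
apply: (closed_lin (K := nm q + 1)) => [x y|x].
  by rewrite cmulBr !opprD !addrA !opprK [LHS](ACl (1*3*2*4)).
apply: le_trans (nmD _ _) _; rewrite nmN mulrDl mul1r lerD2r.
exact: nmM.
Qed.

Lemma closed_star : closed_prop (fun x : B => x '^* - x = 0).
Proof.
apply: (closed_lin (K := 2)).
  by move=> x y; rewrite cstarB !opprD !addrA !opprK [LHS](ACl (1*3*2*4)).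
move=> x; apply: le_trans (nmD _ _) _; rewrite nmN nm_star; have := nm_ge0 x; lra.
Qed.

Lemma closed_comm (b : B) : closed_prop (fun x => b '** x - x '** b = 0).
Proof.
apply: (closed_lin (K := 2 * nm b)) => [x y|x].
  by rewrite cmulBr cmulBl !opprB !addrA [LHS](ACl (1*4*3*2)).
apply: le_trans (nmD _ _) _; rewrite nmN.
by have := nmM b x; have := nmM x b; lra.
Qed.

(** Iteration from 0 of a contraction of the ball of radius r.  A closed
    property preserved by T passes to the limit; this is how symmetry and
    commutation relations of the fixed point are obtained. *)
Lemma fixed_point (T : B -> B) (r : R) (P : B -> Prop) : 0 <= r ->
  (forall x, nm x <= r -> nm (T x) <= r) ->
  (forall x y, nm x <= r -> nm y <= r -> nm (T x - T y) <= 2^-1 * nm (x - y)) ->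
  closed_prop P -> P 0 -> (forall x, P x -> P (T x)) ->
  exists c, [/\ T c = c, nm c <= r & P c].
Proof.
move=> r0 Tr TL cP P0 PT; pose u n := iter n T 0.
have ur n : nm (u n) <= r by elim: n => [|n]; [rewrite nm0|exact: Tr].
have Pu n : P (u n) by elim: n => [|n] //; exact: PT.
have [|l ul] := @complete_geometric u r r0.
  elim=> [|n IH]; first by rewrite subr0 expr0 mulr1 (ur 1).
  apply: le_trans (TL _ _ (ur n.+1) (ur n)) _.
  by rewrite exprS mulrCA ler_wpM2l.
have lr : nm l <= r.
  by apply: closed_nm => e /ul[N /(_ N (leqnn N)) ?]; exists (u N).
exists l; split => //; last by apply: cP => e /ul[N /(_ N (leqnn N)) ?]; exists (u N).
apply/eqP; rewrite -subr_eq0; apply/eqP/nm_eq0/eqP.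
rewrite eq_le nm_ge0 andbT; apply/ler_addgt0Pr => e e0; rewrite add0r.
have e2 : 0 < e / 2 by rewrite divr_gt0.
have [N Nl] := ul _ e2.
rewrite -(subrK (u N.+1) (T l)) -addrA; apply: le_trans (nmD _ _) _.
rewrite (splitr e); apply: lerD; last exact/Nl.
apply: le_trans (TL _ _ lr (ur N)) _; rewrite nmB; have := Nl N (leqnn N).
have := nm_ge0 (u N - l); lra.
Qed.

Lemma sqr_1sub x : (1 - inU x) ^+ 2 = 1 - inU (x + x - x '** x).
Proof.
by rewrite -opprB sqrrN sqrrB1 inUB inUD inUM -expr2 -mulr2n opprB [RHS]addrC.
Qed.

(** The square root 1 - c of 1 - e solves c = (e + c^2) / 2.  The property P
    records relations, such as commutation, that the square root inherits. *)
Lemma sqrt_1sub (e : B) (P : B -> Prop) :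
  e '^* = e -> nm e <= 2^-1 ->
  closed_prop P -> P 0 -> (forall x, P x -> P (2^-1%:C *: (e + x '** x))) ->
  exists c, [/\ c '^* = c, nm c <= 2^-1, (1 - inU c) ^+ 2 = 1 - inU e & P c].
Proof.
move=> es e2 cP P0 PT; pose T x := 2^-1%:C *: (e + x '** x).
have h0 : (0 : R) <= 2^-1 by [].
have [|||||c [Tc c2 [cs Pc]]] :=
    @fixed_point T 2^-1 (fun x => (x '^* - x = 0) /\ P x) h0.
- move=> x x2; rewrite nmZr ger0_norm //; apply: le_trans (ler_wpM2l h0 (nmD _ _)) _.
  have := nmM x x; have : nm x * nm x <= 2^-1 * 2^-1 by rewrite ler_pM ?nm_ge0.
  lra.
- move=> x y x2 y2; rewrite -scalerBr nmZr ger0_norm // ler_wpM2l //.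
  rewrite opprD addrACA subrr add0r.
  have -> : x '** x - y '** y = x '** (x - y) + (x - y) '** y.
    by rewrite cmulBl cmulBr addrA subrK.
  apply: le_trans (nmD _ _) _; have := nmM x (x - y); have := nmM (x - y) y.
  have := ler_wpM2r (nm_ge0 (x - y)) x2; have := ler_wpM2l (nm_ge0 (x - y)) y2.
  lra.
- by apply: closed_and cP; apply: closed_star.
- by rewrite cstar0 subrr.
- move=> x [/eqP + Px]; rewrite subr_eq0 => /eqP xs; split; last exact: PT.
  by rewrite /T cstarZr cstarD cstarM es xs subrr.
exists c; split => //; first by apply/eqP; rewrite -subr_eq0 cs.
have Ec : e = c + c - c '** c.
  have : 2%:C *: c = e + c '** c.
    by rewrite -{1}Tc /T scalerA -rmorphM /= mulfV ?pnatr_eq0 // scale1r.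
  by rewrite rmorph_nat scaler_nat mulr2n => ->; rewrite addrK.
by rewrite Ec sqr_1sub.
Qed.

End FixedPoints.

(** * Lower bounds of self-adjoint elements *)

Section OrderBounds.
Variables (R : realType) (B : cstarAlgType R).
Implicit Types (u v a : unitization B) (x y : B) (s t M : R).

(** The inequality - M <= a: if a is self-adjoint with spectrum in [- M, N], the
    norm of 1 - t a is at most 1 + t M as soon as t (N - M) <= 2. *)
Definition lbounded a M :=
  exists2 d : R, 0 < d & forall t, 0 <= t <= d -> opbd (1 - t%:C *: a) (1 + t * M).

Lemma halfDD (V : lmodType R[i]) (v : V) : 2^-1%:C *: (v + v) = v.
Proof.
have -> : v + v = 2%:C *: v by rewrite rmorph_nat scaler_nat mulr2n.
by rewrite scalerA -rmorphM /= mulVf ?pnatr_eq0 // scale1r.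
Qed.

Lemma lbounded_le a M N : M <= N -> lbounded a M -> lbounded a N.
Proof.
move=> MN [d d0 da]; exists d => // t td; apply: opbd_le (da t td).
by rewrite lerD2l ler_wpM2l //; case/andP: td.
Qed.

(** Since 1 - t (a + b) is the mean of 1 - 2 t a and 1 - 2 t b. *)
Lemma lbounded_add a b M N : lbounded a M -> lbounded b N -> lbounded (a + b) (M + N).
Proof.
move=> [d d0 da] [e e0 eb]; exists (Num.min d e / 2).
  by rewrite divr_gt0 // lt_min d0.
move=> t /andP[t0]; rewrite ler_pdivlMr // le_min => /andP[td te].
have t2 : 0 <= t * 2 by rewrite mulr_ge0.
have -> : 1 - t%:C *: (a + b) =
    2^-1%:C *: ((1 - (t * 2)%:C *: a) + (1 - (t * 2)%:C *: b)).
  rewrite -[LHS]halfDD; congr (_ *: _).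
  rewrite mulr_natr mulr2n rmorphD /= !scalerDl scalerDr !opprD !addrA.
  by rewrite [LHS](ACl (1*2*5*4*3*6)).
have -> : 1 + t * (M + N) = 2^-1 * ((1 + t * 2 * M) + (1 + t * 2 * N)).
  by field.
apply: opbdZr; first by rewrite invr_ge0.
by apply: opbdD; [apply: da|apply: eb]; rewrite t2.
Qed.

Lemma lbounded_add0 a b : lbounded a 0 -> lbounded b 0 -> lbounded (a + b) 0.
Proof. by move=> a0 b0; have := lbounded_add a0 b0; rewrite addr0. Qed.

Lemma lbounded_scale (s : R) a M : 0 < s -> lbounded a M -> lbounded (s%:C *: a) (s * M).
Proof.
move=> s0 [d d0 da]; exists (d / s); first by rewrite divr_gt0.
move=> t /andP[t0]; rewrite ler_pdivlMr // => td.
rewrite scalerA -rmorphM mulrA; apply: da.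
by rewrite td mulr_ge0 // ltW.
Qed.

Lemma lbounded0 : lbounded (0 : unitization B) 0.
Proof.
by exists 1 => // t _; rewrite scaler0 subr0 mulr0 addr0; apply: opbd1.
Qed.

Lemma lbounded_sum (I : Type) (r : seq I) (F : I -> unitization B) :
  (forall i, lbounded (F i) 0) -> lbounded (\sum_(i <- r) F i) 0.
Proof.
move=> F0; elim/big_rec: _ => [|i a _ IH]; first exact: lbounded0.
exact: lbounded_add0.
Qed.

Lemma lbounded_inU x : lbounded (inU x) (nm x).
Proof.
exists 1 => // t /andP[t0 _].
by apply: opbdB; [exact: opbd1|apply: opbdZr => //; apply: opbd_inU].
Qed.

(** For small t the square root q of 1 - t a^2 exists and commutes with a, and
    q + i t^(1/2) a is unitary.  So q is the mean of two contractions. *)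
Lemma lbounded_sqr a : ustar a = a -> lbounded (a ^+ 2) 0.
Proof.
case: a => b z; rewrite /ustar /= => -[bs zs].
have [l zl] : exists l : R, z = l%:C.
  exists (complex.Re z); apply/eqP; rewrite eq_complex /= eqxx /=.
  by case: (z) zs => p q /= [/eqP]; rewrite eq_sym -subr_eq0 opprK -mulr2n mulrn_eq0.
rewrite {}zl in zs *; set a : unitization B := (b, _).
pose g : B := (l *+ 2)%:C *: b + b '** b.
have aE : a ^+ 2 = (l ^+ 2)%:C *: 1 + inU g.
  rewrite expr2; apply: u_ext => /=.
    rewrite scaler0 add0r /g [RHS]addrC -addrA; congr (_ + _).
    by rewrite -scalerDl -rmorphD.
  by rewrite addr0 -rmorphM -expr2; apply: esym; apply: mulr1.
have gs : g '^* = g by rewrite /g cstarD cstarZr cstarM bs.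
(* Small enough for k = 1 - t l^2 >= 1/2 and | t g / k | <= 1/2. *)
pose d := Num.min (1 / (2 * (l ^+ 2 + 1))) (1 / (4 * (nm g + 1))).
have l2 : 0 <= l ^+ 2 by rewrite sqr_ge0.
have g0 := nm_ge0 g.
exists d.
  by rewrite lt_min !divr_gt0 // mulr_gt0 // ltr_wpDl.
move=> t /andP[t0]; rewrite le_min => /andP[].
rewrite !ler_pdivlMr ?mulr_gt0 ?ltr_wpDl // => tl tg.
have tl2 : 0 <= t * l ^+ 2 by rewrite mulr_ge0.
have tng : 0 <= t * nm g by rewrite mulr_ge0.
pose k := 1 - t * l ^+ 2; have k2 : 2^-1 <= k by rewrite /k; lra.
have k0 : 0 < k by lra.
pose e : B := (t / k)%:C *: g.
have es : e '^* = e by rewrite cstarZr gs.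
have e2 : nm e <= 2^-1.
  rewrite nmZr ger0_norm ?divr_ge0 ?(ltW k0) //.
  rewrite mulrAC ler_pdivrMr //; lra.
have [|||c [cs _ ce cb]] := @sqrt_1sub _ _ e (fun x => b '** x - x '** b = 0) es e2.
- exact: closed_comm.
- by rewrite cmulx0 cmul0x subrr.
- move=> x /eqP; rewrite subr_eq0 => /eqP bx.
  have be : b '** e = e '** b.
    by rewrite /e /g !(cmulZr, cmulZl) cmulDr cmulDl !(cmulZr, cmulZl) cmulA.
  rewrite cmulZr cmulZl -scalerBr cmulDr cmulDl be cmulA bx -!cmulA bx.
  by rewrite subrr scaler0.
pose q := (Num.sqrt k)%:C *: (1 - inU c).
have qs : ustar q = q by rewrite ustarZr ustarB ustar1 inU_star cs.
have q2 : q ^+ 2 = 1 - t%:C *: a ^+ 2.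
  rewrite exprZn ce -rmorphXn sqr_sqrtr ?(ltW k0) // aE inUZ /=.
  rewrite scalerBr scalerA -rmorphM mulrCA mulfV ?gt_eqF // mulr1.
  rewrite /k rmorphB scalerBl scale1r scalerDr scalerA -rmorphM.
  by rewrite opprD addrA.
have qa : q * a = a * q.
  rewrite -scalerAl -scalerAr; congr (_ *: _); rewrite mulrBl mulrBr mul1r mulr1.
  congr (_ - _); apply: u_ext; rewrite /= ?mul0r ?mulr0 // !scale0r !addr0.
  by move/eqP: cb; rewrite subr_eq0 => /eqP ->.
clearbody q.
have as_ : ustar a = a by rewrite /ustar /= bs oppr0.
pose h : R[i] := Complex 0 (Num.sqrt t).
have h2 : h * h = - t%:C.
  apply/eqP; rewrite eq_complex /= !mulr0 !mul0r sub0r -expr2 sqr_sqrtr //.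
  by rewrite ?addr0 ?oppr0 !eqxx.
have hc : conjc h = - h by apply/eqP; rewrite eq_complex /= oppr0 !eqxx.
pose w := q + h *: a.
have ws : ustar w = q - h *: a by rewrite /w ustarD ustarZ qs as_ hc scaleNr.
have ww : ustar w * w = 1.
  have hqa : q * (h *: a) = (h *: a) * q by rewrite -scalerAl -scalerAr qa.
  have hh : (h *: a) * (h *: a) = - (t%:C *: a ^+ 2).
    by rewrite -scalerAl -scalerAr scalerA h2 scaleNr.
  by rewrite ws /w mulrDr !mulrBl hqa hh addrA subrK opprK -expr2 q2 subrK.
have bw : opbd w 1 by apply: opbd_starM => //; rewrite ww expr1n; apply: opbd1.
have bws := opbd_star ler01 bw.
have bq : opbd q 1.
  have -> : q = 2^-1%:C *: (ustar w + w).
    by rewrite ws /w addrACA [- _ + _]addrC subrr addr0 halfDD.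
  by apply: opbd_le (opbdZr _ (opbdD bws bw)); rewrite ?invr_ge0 //; lra.
rewrite mulr0 addr0 -q2 expr2 -(mulr1 1).
exact: opbdM.
Qed.

End OrderBounds.

(** * From two-sided bounds to norms *)

Section Positivity.
Variables (R : realType) (B : cstarAlgType R).
Implicit Types (u v a : unitization B) (x y : B) (s t M : R).

(** The powers of 1 - t y^* y are expressed by sums of powers of
    1 - t y y^*, with a loss linear in the exponent that [opbd_growth] removes.
    This stands in for the coincidence of the nonzero spectra of y^* y and y y^* . *)
Lemma opbd_starC y t M : 0 <= t -> 0 <= M ->
  opbd (1 - t%:C *: inU (y '** y '^*)) (1 + t * M) ->
  opbd (1 - t%:C *: inU (y '^* '** y)) (1 + t * M).
Proof.
move=> t0 M0; set r := 1 + t * M; set p' := 1 - _; set p := 1 - _ => bp'.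
have r1 : 1 <= r by rewrite lerDl mulr_ge0.
have r0 : 0 <= r by lra.
pose Y := inU y; pose Ys := inU (y '^*).
have pE : p = 1 - t%:C *: (Ys * Y) by rewrite -inUM.
have p'E : p' = 1 - t%:C *: (Y * Ys) by rewrite -inUM.
clearbody p p'.
have pYs : p * Ys = Ys * p'.
  by rewrite pE p'E mulrBl mulrBr mul1r mulr1 -scalerAl -scalerAr mulrA.
have pk k : p ^+ k = 1 - t%:C *: (Ys * (\sum_(j < k) p' ^+ j) * Y).
  elim: k => [|k IH]; first by rewrite big_ord0 mulr0 mul0r scaler0 subr0.
  have -> : \sum_(j < k.+1) p' ^+ j = 1 + p' * \sum_(j < k) p' ^+ j.
    rewrite big_ord_recl mulr_sumr; congr (_ + _).
    by apply: eq_bigr => j _; rewrite lift0 exprS.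
  rewrite exprS IH mulrBr mulr1 -scalerAr !mulrA pYs {1}pE.
  rewrite mulrDr mulr1 mulrDl scalerDr opprD addrA.
  by rewrite !mulrA.
apply: (@opbd_growth _ _ _ _ (1 + t * (nm y * nm y))) => [||n].
- by rewrite pE ustarB ustar1 ustarZr ustarM !inU_star cstarK.
- lra.
rewrite pk; have rn1 : 1 <= r ^+ n by rewrite exprn_ege1.
have bsum : opbd (\sum_(j < n) p' ^+ j) (n%:R * r ^+ n).
  have -> : n%:R * r ^+ n = \sum_(j < n) r ^+ n.
    by rewrite sumr_const card_ord mulr_natl.
  apply: opbd_sum => j; apply: opbd_le (opbdX j r0 bp').
  by rewrite ler_weXn2l // ltnW.
have := opbdM (mulr_ge0 (nm_ge0 (y '^*)) (mulr_ge0 (ler0n _ n) (exprn_ge0 n r0)))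
  (opbdM (nm_ge0 _) (opbd_inU (y '^*)) bsum) (opbd_inU y).
move=> /(opbdZr t0) /(opbdB (@opbd1 R B)); apply: opbd_le.
rewrite nm_star -natr1; have y0 := mulr_ge0 (nm_ge0 y) (nm_ge0 y).
set N := nm y * nm y in y0 *.
have -> : t * (nm y * (n%:R * r ^+ n) * nm y) = t * N * n%:R * r ^+ n by rewrite /N; ring.
have h1 := mulr_ge0 (mulr_ge0 t0 y0) (exprn_ge0 n r0).
have h2 := mulr_ge0 (ler0n R n) (exprn_ge0 n r0).
lra.
Qed.

Lemma lbounded_starC y M : 0 <= M -> lbounded (inU (y '** y '^*)) M -> lbounded (inU (y '^* '** y)) M.
Proof.
move=> M0 [d d0 dy]; exists d => // t td; apply: opbd_starC (dy t td) => //.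
by case/andP: td.
Qed.

Lemma pow_le2 (x : R) m : 0 <= x -> 2 * m%:R * x <= 1 ->
  (1 + x) ^+ m <= 1 + 2 * m%:R * x.
Proof.
move=> x0; elim: m => [|m IH]; first by rewrite mulr0 mul0r addr0.
rewrite -natr1 => mx; have mx1 : 2 * m%:R * x <= 1 by lra.
rewrite exprSr; apply: le_trans (_ : (1 + 2 * m%:R * x) * (1 + x) <= _).
  by rewrite ler_wpM2r ?IH //; lra.
by have := ler_wpM2r x0 mx1; lra.
Qed.

(** For small t and every z of modulus 1, the norm of 1 + z t x is at most
    1 + t M up to an error quadratic in t, because the imaginary part of z t
    contributes only to second order.  Hence (1 + z t x)^(2 m) stays bounded when
    t is of the order of 1 / m, and its coefficient 2 m t x of z, extracted by
    averaging over roots of unity, is bounded by the same constant. *)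
Lemma two_sided_pos x M : x '^* = x -> 0 < M ->
  lbounded (inU x) M -> lbounded (- inU x) M -> nm x <= 8 * M.
Proof.
move=> xs M0 [d1 d10 xlow] [d2 d20 xup].
pose N := nm x; have N0 : 0 <= N := nm_ge0 x.
pose d := Num.min d1 d2; have d0 : 0 < d by rewrite lt_min d10.
pose m1 := Num.bound (1 / (8 * M * d)).
pose m2 := Num.bound ((1 + (N / M) ^+ 2) / 16).
pose m := (m1 + m2).+1; have m0 : 0 < m%:R :> R by rewrite ltr0n.
have mm1 : m1%:R <= m%:R :> R by rewrite ler_nat /m; lia.
have mm2 : m2%:R <= m%:R :> R by rewrite ler_nat /m; lia.
pose t := 1 / (8 * M * m%:R); have t0 : 0 < t by rewrite divr_gt0 ?mulr_gt0.
have tM : t * M * m%:R = 8^-1 by rewrite /t; field; rewrite !gt_eqF.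
have td : t <= d.
  rewrite ler_pdivrMr ?mulr_gt0 //.
  have : 1 / (8 * M * d) < m1%:R by apply/archi_boundP/divr_ge0; rewrite ?mulr_ge0 ?ltW.
  by rewrite ltr_pdivrMr ?mulr_gt0 // => h; have := ler_wpM2r (ltW (mulr_gt0 (mulr_gt0 (ltr0Sn R 7) M0) d0)) mm1; lra.
have tN : t ^+ 2 * (M ^+ 2 + N ^+ 2) <= (4 * m%:R)^-1.
  have : (1 + (N / M) ^+ 2) / 16 < m2%:R.
    by apply/archi_boundP/divr_ge0 => //; rewrite addr_ge0 ?sqr_ge0.
  move=> /ltW/le_trans/(_ mm2).
  have -> : M ^+ 2 + N ^+ 2 = M ^+ 2 * (1 + (N / M) ^+ 2).
    by rewrite mulrDr mulr1 -exprMn mulrCA mulfV ?gt_eqF // mulr1.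
  rewrite ler_pdivrMr // => hN.
  have -> : t ^+ 2 * (M ^+ 2 * (1 + (N / M) ^+ 2)) = (1 + (N / M) ^+ 2) / (64 * m%:R ^+ 2).
    have t1 : t * M = (8 * m%:R)^-1.
      by rewrite invfM -tM mulfK // gt_eqF.
    by rewrite mulrA -exprMn t1 exprVn mulrC; congr (_ / _); ring.
  rewrite ler_pdivrMr ?mulr_gt0 ?exprn_gt0 //.
  by have -> : (4 * m%:R)^-1 * (64 * m%:R ^+ 2) = m%:R * 16 :> R by field; rewrite gt_eqF.
clearbody t.
(* r2 bounds the square of the norm of 1 + z t x; by the choice of m and t its
   m-th power is at most 2. *)
pose r2 := (1 + t * M) ^+ 2 + t ^+ 2 * N ^+ 2.
have r2m : r2 ^+ m <= 2.
  have r2le : r2 <= 1 + (2 * m%:R)^-1.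
    have -> : r2 = 1 + 2 * (t * M) + t ^+ 2 * (M ^+ 2 + N ^+ 2).
      by rewrite /r2; ring.
    have -> : t * M = (8 * m%:R)^-1 by rewrite invfM -tM mulfK // gt_eqF.
    move: tN; rewrite !invfM; have : 0 < m%:R^-1 :> R by rewrite invr_gt0.
    lra.
  apply: le_trans (lerXn2r _ _ _ r2le) _.
  - by rewrite nnegrE addr_ge0 ?sqr_ge0 // mulr_ge0 ?sqr_ge0.
  - by rewrite nnegrE addr_ge0 // invr_ge0 mulr_ge0.
  apply: le_trans (pow_le2 _ _) _.
  - by rewrite invr_ge0 mulr_ge0.
  - by rewrite mulfV // gt_eqF // mulr_gt0.
  by rewrite mulfV ?gt_eqF // mulr_gt0.
pose X := inU x; have Xs : ustar X = X by rewrite inU_star xs.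
have realdir (c : R) : `|c| <= 1 -> opbd (1 + (c * t)%:C *: X) (1 + t * M).
  move=> c1; have := ler_norm c; have := ler_norm (- c); rewrite normrN => cN cP.
  have [c0|c0] := leP 0 c.
    have := @xup (c * t); rewrite scalerN opprK => H.
    apply: opbd_le (H _).
      by rewrite lerD2l ler_wpM2r ?(ltW M0) // ler_piMl ?(ltW t0) //; lra.
    rewrite mulr_ge0 ?(ltW t0) //= (le_trans _ (le_trans td _)) //.
      by rewrite ler_piMl ?(ltW t0) //; lra.
    by rewrite ge_min lexx orbT.
  have := @xlow (- (c * t)); rewrite rmorphN scaleNr opprK => H.
  apply: opbd_le (H _).
    by rewrite lerD2l ler_wpM2r ?(ltW M0) // -mulNr ler_piMl ?(ltW t0) //; lra.
  rewrite -mulNr mulr_ge0 ?(ltW t0) //=; last by lra.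
  rewrite (le_trans _ (le_trans td _)) //.
    by rewrite ler_piMl ?(ltW t0) //; lra.
  by rewrite ge_min lexx.
(* For z = c + i dd, the square of the norm of 1 + z t x is that of
   (1 + c t x)^2 + dd^2 t^2 x^2. *)
have cdir (z : R[i]) : Normc.normc z = 1 ->
    opbd ((1 + (z * t%:C) *: X) ^+ (m + m)) 2.
  move=> z1; have [c [dd zE]] : exists c dd : R, z = Complex c dd.
    by case: (z) => p q; exists p; exists q.
  have cd : c ^+ 2 + dd ^+ 2 = 1.
    by rewrite -[LHS]sqr_sqrtr ?addr_ge0 ?sqr_ge0 //; move: z1; rewrite zE /= => ->; rewrite expr1n.
  have c1 : `|c| <= 1.
    rewrite -(@ler_pXn2r _ 2) ?nnegrE // expr1n -normrX ger0_norm ?sqr_ge0 //.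
    by have := sqr_ge0 dd; lra.
  have dd1 : dd ^+ 2 <= 1 by have := sqr_ge0 c; lra.
  set w := 1 + _.
  have wE : ustar w * w = (1 + (c * t)%:C *: X) ^+ 2 + (dd ^+ 2 * t ^+ 2)%:C *: (X * X).
    rewrite /w ustarD ustar1 ustarZ Xs.
    pose f := (c * t)%:C; pose g : R[i] := Complex 0 (dd * t).
    have zt : z * t%:C = f + g.
      by apply/eqP; rewrite zE eq_complex /= !mulr0 !subr0 ?addr0 ?add0r !eqxx.
    have zct : conjc (z * t%:C) = f - g.
      by apply/eqP; rewrite zE eq_complex /= ?oppr0 !mulr0 !subr0 ?addr0 ?add0r !eqxx.
    rewrite zct zt -/f.
    have -> : (dd ^+ 2 * t ^+ 2)%:C = - (g * g).
      apply/eqP; rewrite eq_complex /= !mulr0 !mul0r sub0r opprK ?addr0 ?oppr0 eqxx andbT.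
      by apply/eqP; ring.
    rewrite expr2 !mulrDr !mulrDl !mul1r !mulr1 -!scalerAl -!scalerAr !scalerA.
    rewrite -!addrA; congr (_ + _).
    have e1 : (f - g) *: X + (f + g) *: X = f *: X + f *: X.
      by rewrite -!scalerDl; congr (_ *: _); ring.
    have -> : (f - g) * (f + g) = f * f + - (g * g) by ring.
    by rewrite [LHS]addrA [X in X + _ = _]e1 -[LHS]addrA scalerDl.
  have bw2 : opbd (ustar w * w) r2.
    rewrite wE; apply: opbd_le (opbdD (opbdX 2 _ (realdir c c1)) (opbdZr _ (opbdM _ (opbd_inU x) (opbd_inU x)))) => //.
    - rewrite /r2 lerD2l -expr2 -/N -mulrA ler_piMl //.
      by rewrite mulr_ge0 ?sqr_ge0.
    - by rewrite addr_ge0 // mulr_ge0 ?ltW.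
    - by rewrite mulr_ge0 ?sqr_ge0.
  have r20 : 0 <= r2 by rewrite addr_ge0 ?sqr_ge0 // mulr_ge0 ?sqr_ge0.
  have bw : opbd w (Num.sqrt r2) by apply: opbd_starM; rewrite ?sqrtr_ge0 // sqr_sqrtr.
  apply: opbd_le (opbdX (m + m) (sqrtr_ge0 _) bw).
  by rewrite addnn -mul2n exprM sqr_sqrtr.
have [n nE] : exists n, n = (m + m).+1 by exists (m + m).+1.
have n1 : (1 < n)%N by rewrite nE /m addSn.
pose z l : R[i] := uroot R n ^+ l.
have filter : \sum_(l < n) (z l) ^+ n.-1 *: (1 + (z l * t%:C) *: X) ^+ (m + m)
    = (n%:R * (m + m)%:R * t)%:C *: X.
  under eq_bigr => l _.
    rewrite addrC exprD1n -nE scaler_sumr.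
    under eq_bigr => j _ do rewrite exprZn exprMn scalerMnr scalerA mulrA -exprD -scalerA.
    over.
  rewrite exchange_big /=.
  under eq_bigr => j _ do rewrite -scaler_suml (uroot_filter _ n1 (ltn_ord j)).
  rewrite (bigD1 (Ordinal n1)) //= big1 ?addr0; last first.
    by move=> j j1; rewrite ifN ?scale0r.
  rewrite bin1 !expr1 -scaler_nat !scalerA.
  by congr (_ *: _); rewrite !rmorphM !rmorph_nat; ring.
have bsum : opbd ((n%:R * (m + m)%:R * t)%:C *: X) (n%:R * 2).
  have -> : n%:R * 2 = \sum_(l < n) 2 :> R by rewrite sumr_const card_ord mulr_natl.
  rewrite -filter.
  apply: opbd_sum => l; apply: opbd_le (opbdZ _ (cdir _ (normc_uroot _ _ _))).
  by rewrite /z -exprM normc_uroot mul1r.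
have nm_le : nm ((n%:R * (m + m)%:R * t)%:C *: x) <= n%:R * 2.
  by apply: nm_opbd; rewrite ?mulr_ge0 // inUZ.
move: nm_le; rewrite nmZr ger0_norm ?mulr_ge0 ?(ltW t0) //.
rewrite -!mulrA ler_pM2l ?ltr0n 1?ltnW // natrD.
have m8 : 8 * M * (t * m%:R) = 1.
  by rewrite -[RHS](mulfV (x := 8)) ?pnatr_eq0 // -tM; ring.
have mt0 : 0 < t * m%:R by rewrite mulr_gt0.
move=> h; have h2 : nm x * (t * m%:R) <= 8 * M * (t * m%:R) by rewrite m8; lra.
by rewrite ler_pM2r in h2.
Qed.

End Positivity.

(** * Positivity of sums of squares *)

Section StarSquaresPositive.
Variables (R : realType) (B : cstarAlgType R).
Implicit Types (u v a : unitization B) (x y : B) (s t M : R).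

(** With t = s / (1 + s), the element 1 + s a is (1 + s) (1 - t (1 - a)). *)
Lemma lbounded_shift a : lbounded (1 - a) 0 -> lbounded (- a) 1.
Proof.
move=> [d d0 da]; exists d => // s /andP[s0 sd]; pose t := s / (1 + s).
have s1 : 0 < 1 + s by lra.
have st : s - t - s * t = 0 by rewrite /t; field; rewrite gt_eqF.
have ts : t <= s by rewrite ler_pdivrMr // ler_peMr // lerDl.
have t0 : 0 <= t by rewrite divr_ge0 // ltW.
have -> : 1 - s%:C *: - a = (1 + s)%:C *: (1 - t%:C *: (1 - a)).
  rewrite scalerN opprK !scalerBr !scalerA -!rmorphM opprB addrA.
  have -> : (1 + s) * t = s by rewrite /t mulrC divfK // gt_eqF.
  by rewrite addrAC -scalerBl -rmorphB addrK scale1r.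
apply: opbd_le (opbdZr (ltW s1) (da _ _)); first by rewrite mulr0 addr0 !mulr1.
by rewrite t0 (le_trans ts sd).
Qed.

Lemma inU_ideal x u : inU x * u = inU (inU x * u).1.
Proof. by apply: u_ext; rewrite //= mul0r. Qed.

(** The sum is half the sum of the squares of y + y^* and i (y - y^* ). *)
Lemma lbounded_realimag y : lbounded (inU (y '^* '** y) + inU (y '** y '^*)) 0.
Proof.
pose Y := inU y; pose Ys := inU (y '^*).
pose i : R[i] := Complex 0 1; have i2 : i * i = - 1.
  by apply/eqP; rewrite eq_complex /= !mulr0 !mul0r mulr1 sub0r addr0 oppr0 !eqxx.
have ic : conjc i = - i by apply/eqP; rewrite eq_complex /= oppr0 !eqxx.
have YsE : ustar Y = Ys by rewrite inU_star.
have YE : ustar Ys = Y by rewrite inU_star cstarK.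
have -> : inU (y '^* '** y) + inU (y '** y '^*) =
    2^-1%:C *: ((Y + Ys) ^+ 2 + (i *: (Y - Ys)) ^+ 2).
  rewrite !inUM -/Y -/Ys -[LHS]halfDD; congr (_ *: _).
  rewrite exprZn [i ^+ 2]expr2 i2 scaleN1r !expr2 !mulrDl !mulrDr !mulNr !mulrN !opprD !opprK !addrA.
  by rewrite [RHS](ACl (1*5*4*8*3*2*6*7)) /= subrr add0r subrr add0r [LHS](ACl (1*2*4*3)).
rewrite -(mulr0 2^-1); apply: lbounded_scale; first by rewrite invr_gt0.
apply: lbounded_add0; apply: lbounded_sqr.
  by rewrite ustarD YsE YE addrC.
by rewrite ustarZ ustarB YsE YE ic scaleNr -scalerN opprB.
Qed.

(** The argument of Kelley and Vaught, in a quantitative form.  With w = x^* x,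
    v = 1 - w and y = x v^n one has y^* y = w v^(2 n), and 1 - w v^(2 n) is a sum
    of squares.  So y^* y <= 1; subtracting it from y^* y + y y^* >= 0 gives
    y y^* >= - 1, hence y^* y >= - 1.  Thus w v^(2 n) is bounded
    independently of n, the powers of v grow at most linearly, and | v | <= 1. *)
Lemma opbd_1sub_star x : nm (x '^* '** x) <= 2^-1 -> opbd (1 - inU (x '^* '** x)) 1.
Proof.
set w := _ '** _ => w2.
have ws : w '^* = w by rewrite cstarM cstarK.
have wE : x '^* '** x = w by [].
clearbody w.
have [|||c [cs _ r2 cw]] := @sqrt_1sub _ _ w (fun z => w '** z - z '** w = 0) ws w2.
- exact: closed_comm.
- by rewrite cmulx0 cmul0x subrr.
- move=> z /eqP; rewrite subr_eq0 => /eqP wz.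
  by rewrite cmulZr cmulZl -scalerBr cmulDr cmulDl cmulA wz -!cmulA wz subrr scaler0.
set r := 1 - inU c in r2.
have [W WE] : exists W, W = inU w by exists (inU w).
have [v vE] : exists v, v = 1 - W by exists (1 - W).
rewrite -WE -vE.
have rs : ustar r = r by rewrite ustarB ustar1 inU_star cs.
have Ws : ustar W = W by rewrite WE inU_star ws.
have vs : ustar v = v by rewrite vE ustarB ustar1 Ws.
have rW : r * W = W * r.
  rewrite /r mulrBl mulrBr mul1r mulr1 WE -!inUM; congr (_ - inU _).
  by apply: esym; apply/eqP; rewrite -subr_eq0 cw.
have rvE : r ^+ 2 = v by rewrite vE WE.
have W1 : W = 1 - v by rewrite vE opprB addrC subrK.
have vW : v * W = W * v by rewrite vE mulrBl mulrBr mul1r mulr1.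
clearbody r.
have rjW j : r ^+ j * W = W * r ^+ j by apply/commr_sym/commrX.
have vjW j : v ^+ j * W = W * v ^+ j by apply/commr_sym/commrX.
have bW n : opbd (W * v ^+ (n + n)) 8.
  pose y := (inU x * v ^+ n).1.
  have yE : inU y = inU x * v ^+ n by rewrite -inU_ideal.
  have ysE : inU (y '^*) = v ^+ n * inU (x '^*).
    by rewrite -inU_star yE ustarM ustarX vs inU_star.
  have yyE : inU (y '^* '** y) = W * v ^+ (n + n).
    rewrite inUM ysE yE mulrA -[_ * inU x]mulrA -inUM wE -WE vjW -mulrA.
    by rewrite exprD.
  (* 1 - w v^(2 n) = v + w (1 - v^(2 n)), and both v = r^2 and
     w (1 - v^(2 n)) = sum of w^2 v^j are sums of squares. *)
  have low : lbounded (- inU (y '^* '** y)) 1.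
    apply: lbounded_shift.
    have -> : 1 - inU (y '^* '** y) =
        r ^+ 2 + \sum_(j < n + n) (W * r ^+ j) ^+ 2.
      rewrite rvE yyE.
      have -> : \sum_(j < n + n) (W * r ^+ j) ^+ 2 =
          W * (W * \sum_(j < n + n) v ^+ j).
        rewrite !mulr_sumr; apply: eq_bigr => j _.
        by rewrite expr2 -mulrA [r ^+ j * _]mulrA rjW -!mulrA -exprD addnn -mul2n exprM rvE.
      have -> : W * \sum_(j < n + n) v ^+ j = 1 - v ^+ (n + n).
        by rewrite W1 -opprB mulNr -subrX1 opprB.
      by rewrite vE mulrBr mulr1 addrA subrK.
    apply: lbounded_add0; first exact: lbounded_sqr.
    apply: lbounded_sum => j; apply: lbounded_sqr.
    by rewrite ustarM ustarX rs Ws rjW.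
  have up : lbounded (inU (y '^* '** y)) 1.
    apply: lbounded_starC => //.
    have -> : inU (y '** y '^*) =
        (inU (y '^* '** y) + inU (y '** y '^*)) + - inU (y '^* '** y).
      by rewrite addrAC subrr add0r.
    by rewrite -(add0r 1); apply: lbounded_add => //; apply: lbounded_realimag.
  have y8 : nm (y '^* '** y) <= 8.
    rewrite -(mulr1 8); apply: two_sided_pos => //.
    by rewrite cstarM cstarK.
  by rewrite -yyE; apply: opbd_le y8 (opbd_inU _).
have bv1 : opbd (1 + v) 3.
  have : opbd (1 + (1 - W)) (1 + (1 + nm w)).
    by rewrite WE; apply: opbdD; [exact: opbd1|apply: opbdB; [exact: opbd1|exact: opbd_inU]].
  by rewrite vE; apply: opbd_le; lra.
have bv2 : opbd (v ^+ 2) 1.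
  apply: (@opbd_growth _ _ _ _ 25) => //; first by rewrite ustarX vs.
  move=> n; rewrite expr1n mulr1.
  have -> : (v ^+ 2) ^+ n = 1 - (1 + v) * \sum_(j < n) W * v ^+ (j + j).
    have -> : \sum_(j < n) W * v ^+ (j + j) = W * \sum_(j < n) (v ^+ 2) ^+ j.
      by rewrite mulr_sumr; apply: eq_bigr => j _; rewrite -exprM mul2n addnn.
    rewrite mulrA W1.
    have -> : (1 + v) * (1 - v) = - (v ^+ 2 - 1).
      by rewrite mulrBr mulr1 mulrDl mul1r opprB opprD addrA addrK expr2.
    by rewrite mulNr -subrX1 opprK addrC subrK.
  have bs : opbd (\sum_(j < n) W * v ^+ (j + j)) (\sum_(j < n) 8).
    by apply: opbd_sum => j; apply: bW.
  apply: opbd_le (opbdB (@opbd1 R B) (opbdM _ bv1 bs)) => //.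
  by rewrite sumr_const card_ord -mulr_natl -natr1; have := ler0n R n; lra.
by apply: opbd_starM; rewrite // vs -expr2 expr1n.
Qed.

(** The previous lemma applies to t^(1/2) x for every small t. *)
Lemma lbounded_star x : lbounded (inU (x '^* '** x)) 0.
Proof.
set w := _ '** _; have w0 := nm_ge0 w.
exists (1 / (2 * (nm w + 1))); first by rewrite divr_gt0 // mulr_gt0 // ltr_wpDl.
move=> t /andP[t0]; rewrite ler_pdivlMr ?mulr_gt0 ?ltr_wpDl // => tw.
have E : t%:C *: w = ((Num.sqrt t)%:C *: x) '^* '** ((Num.sqrt t)%:C *: x).
  by rewrite cstarZr cmulZl cmulZr scalerA -rmorphM -expr2 sqr_sqrtr.
rewrite -inUZ E mulr0 addr0; apply: opbd_1sub_star; rewrite -E nmZr ger0_norm //.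
by lra.
Qed.

Lemma two_sided x M : x '^* = x -> 0 <= M ->
  lbounded (inU x) M -> lbounded (- inU x) M -> nm x <= 8 * M.
Proof.
move=> xs M0 l u; apply/ler_addgt0Pr => e e0.
have le : M <= M + e / 8 by rewrite lerDl divr_ge0 // ltW.
have := two_sided_pos xs (lt_le_trans _ (lexx (M + e / 8))) (lbounded_le le l) (lbounded_le le u).
by move=> H; apply: le_trans (H _) _; lra.
Qed.

Lemma lbounded_sum_star (I : Type) (r : seq I) (F : I -> B) :
  lbounded (inU (\sum_(i <- r) ((F i) '^* '** F i))) 0.
Proof.
rewrite (big_morph (@inU R B) (@inUD _ _) (erefl _)).
by apply: lbounded_sum => i; apply: lbounded_star.
Qed.

(** The norm is monotone on positive elements up to a constant: if
    0 <= a <= b then - a >= - b >= - | b |, and [two_sided] applies to a. *)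
Lemma nm_sum_star_le (I J : Type) (e : seq I) (F : I -> B) (r : seq J) (G : J -> B) :
  nm (\sum_(i <- e) ((F i) '^* '** F i)) <=
  8 * nm (\sum_(i <- e) ((F i) '^* '** F i) + \sum_(i <- r) ((G i) '^* '** G i)).
Proof.
set a := \sum_(i <- e) _; set s := \sum_(i <- r) _; set b := _ + s.
apply: two_sided (nm_ge0 b) _ _.
- by rewrite cstar_sum; apply: eq_bigr => i _; rewrite cstarM cstarK.
- exact: lbounded_le (nm_ge0 b) (lbounded_sum_star e F).
have -> : - inU a = inU (- b) + inU s.
  by rewrite -inUN -inUD /b opprD subrK.
by rewrite -(addr0 (nm b)) -[nm b]nmN; apply: lbounded_add (lbounded_sum_star r G); apply: lbounded_inU.
Qed.

Lemma nm_star_le x (I : Type) (r : seq I) (F : I -> B) :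
  nm (x '^* '** x) <= 8 * nm (x '^* '** x + \sum_(i <- r) ((F i) '^* '** F i)).
Proof. by have := nm_sum_star_le [:: x] id r F; rewrite big_seq1. Qed.

Lemma sum_star_eq0 (I : eqType) (r : seq I) (F : I -> B) :
  \sum_(i <- r) ((F i) '^* '** F i) = 0 -> forall i, i \in r -> F i = 0.
Proof.
move=> F0 i ir; move: F0; rewrite (perm_big _ (perm_to_rem ir)) big_cons.
move=> F0; have := nm_star_le (F i) (rem i r) F.
rewrite F0 nm0 mulr0 nm_starM => H; apply: nm_eq0; apply/eqP.
by rewrite -sqrf_eq0 eq_le H sqr_ge0.
Qed.

End StarSquaresPositive.

(** * Boundedness of star morphisms *)

Section MorphismsBounded.
Variables (R : realType) (B E : cstarAlgType R) (f : B -> E).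
Hypothesis fM : star_morphism f.

Lemma mor0 : f 0 = 0.
Proof.
have [fl _ _] := fM; have := fl (-1) 0 0.
by rewrite scaler0 addr0 scaleN1r addrC subrr.
Qed.
Lemma morD x y : f (x + y) = f x + f y.
Proof. by have [fl _ _] := fM; have := fl 1 x y; rewrite !scale1r. Qed.
Lemma morZ (a : R[i]) x : f (a *: x) = a *: f x.
Proof. by have [fl _ _] := fM; have := fl a x 0; rewrite !addr0 mor0 addr0. Qed.
Lemma morN x : f (- x) = - f x.
Proof. by rewrite -[- x]scaleN1r morZ scaleN1r. Qed.
Lemma morB x y : f (x - y) = f x - f y.
Proof. by rewrite morD morN. Qed.
Lemma morM x y : f (x '** y) = f x '** f y. Proof. by have [_ ->] := fM. Qed.
Lemma morS x : f (x '^*) = (f x) '^*. Proof. by have [_ _ ->] := fM. Qed.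
Lemma mor_sum (I : Type) (r : seq I) (P : pred I) (F : I -> B) :
  f (\sum_(i <- r | P i) F i) = \sum_(i <- r | P i) f (F i).
Proof. exact: (big_morph f morD mor0). Qed.

(** If | y | <= 1/2 then 1 - y is the square of a self-adjoint element, and so is
    its image.  Applied to x and - x this confines f x between - 1 and 1. *)
Lemma mor_sa_le x : x '^* = x -> nm x <= 2^-1 -> nm (f x) <= 8.
Proof.
move=> xs x2.
have sq y : y '^* = y -> nm y <= 2^-1 -> lbounded (- inU (f y)) 1.
  move=> ys y2.
  have [//|//|//|c [cs _ ce _]] := @sqrt_1sub _ _ y (fun=> True) ys y2.
  apply: lbounded_shift.
  have cE : y = c + c - c '** c.
    by move: ce; rewrite sqr_1sub => /addrI/oppr_inj/inU_inj.
  rewrite cE morB morD morM -sqr_1sub; apply: lbounded_sqr.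
  by rewrite ustarB ustar1 inU_star -morS cs.
rewrite -(mulr1 8); apply: two_sided => //; [by rewrite -morS xs| |exact: sq].
by rewrite -[inU _]opprK -inUN -morN; apply: sq; rewrite ?cstarN ?xs ?nmN.
Qed.

(** Reduction to the self-adjoint case by the C*-identity; the constant is not
    optimal. *)
Lemma mor_bounded x : nm (f x) <= 4 * nm x.
Proof.
have [x0|x0] := eqVneq (nm x) 0.
  by rewrite (nm_eq0 x0) mor0 !nm0 mulr0.
have n0 : 0 < nm x by rewrite lt_def x0 nm_ge0.
pose k : R := 2^-1 / nm x ^+ 2; have k0 : 0 < k by rewrite divr_gt0 ?invr_gt0 ?exprn_gt0.
have := @mor_sa_le (k%:C *: (x '^* '** x)).
rewrite cstarZr cstarM cstarK nmZr nm_starM ger0_norm ?(ltW k0) // divfK ?expf_neq0 // => /(_ erefl (lexx _)).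
rewrite morZ morM morS nmZr nm_starM ger0_norm ?(ltW k0) // => H.
rewrite -(@ler_pXn2r _ 2) ?nnegrE ?mulr_ge0 ?nm_ge0 // exprMn.
move: H; rewrite mulrAC ler_pdivrMr ?exprn_gt0 //; lra.
Qed.

End MorphismsBounded.

(** * Shapes *)

Section Shapes.
Variable r : nat.
Implicit Types l m n : mshape r.

Lemma shapeD l m i : (l + m) i = (l i + m i)%N. Proof. by rewrite ffunE. Qed.
Lemma shape0 i : (0 : mshape r) i = 0%N. Proof. by rewrite ffunE. Qed.
Lemma in_boxP m l : reflect (forall i, (l i <= m i)%N) (in_box m l).
Proof. exact: forallP. Qed.
Lemma in_box0 m : in_box m 0. Proof. by apply/in_boxP => i; rewrite shape0. Qed.
Lemma in_boxx m : in_box m m. Proof. by apply/in_boxP. Qed.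
Lemma in_boxDl m n : in_box (m + n) m.
Proof. by apply/in_boxP => i; rewrite shapeD leq_addr. Qed.
Lemma in_boxD2 k m n : in_box m n -> in_box (k + m) (k + n).
Proof. by move=> /in_boxP h; apply/in_boxP => i; rewrite !shapeD leq_add2l. Qed.
Lemma in_box_trans m l k : in_box m l -> in_box l k -> in_box m k.
Proof.
by move=> /in_boxP ml /in_boxP lk; apply/in_boxP => i; apply: leq_trans (ml i).
Qed.

Definition subS m l : mshape r := [ffun i => (m i - l i)%N].
Lemma subSK m l : in_box m l -> l + subS m l = m.
Proof. by move=> /in_boxP lm; apply/ffunP => i; rewrite shapeD ffunE subnKC. Qed.
Lemma addSI l m n : l + m = l + n -> m = n.
Proof.
move=> /ffunP lmn; apply/ffunP => i; apply/eqP.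
by rewrite -(eqn_add2l (l i)) -!shapeD lmn.
Qed.
Definition joinS m l : mshape r := [ffun i => maxn (m i) (l i)].
Lemma in_box_joinl m l : in_box (joinS m l) m.
Proof. by apply/in_boxP => i; rewrite ffunE leq_maxl. Qed.
Lemma in_box_joinr m l : in_box (joinS m l) l.
Proof. by apply/in_boxP => i; rewrite ffunE leq_maxr. Qed.

(** Any shape is reached from 0 by unit steps, in whatever order: this is what the
    summation relation of the generators, which lengthens words one step in
    one direction at a time, requires. *)
Lemma shape_ind (P : mshape r -> Prop) :
  P 0 -> (forall m j, P m -> P (m + unit_shape j)) -> forall m, P m.
Proof.
move=> P0 PS m; have [N] := ubnP (\sum_i m i); elim: N m => // N IH m.
have [/eqP m0 _|[j j0] mN] : m == 0 \/ exists j, (0 < m j)%N.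
- case: (pickP (fun j => 0 < m j)%N) => [j ?|m0]; [by right; exists j|left].
  by apply/eqP/ffunP => i; rewrite shape0; have /negbT := m0 i; rewrite -eqn0Ngt => /eqP.
- by rewrite m0.
have mE : m = subS m (unit_shape j) + unit_shape j.
  rewrite addrC subSK //; apply/in_boxP => i; rewrite ffunE.
  by case: eqP => [->|].
rewrite mE; apply/PS/IH; rewrite -ltnS; apply: leq_trans mN; rewrite ltnS.
rewrite (bigD1 j) //= [X in (_ < X)%N](bigD1 j) //= !ffunE eqxx.
rewrite -addSn leq_add //; first by rewrite /= subn1 prednK.
by apply: leq_sum => i ij; rewrite !ffunE leq_subr.
Qed.

End Shapes.

(** * Words *)

Section WordTheory.
Variables (r : nat) (A : finType) (M : 'I_r -> A -> A -> nat).
Implicit Types (l m n : mshape r) (u v w : word M) (a b : A).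

(** Values are indexed by all shapes rather than by the points of a box depending
    on w; outside the box of w they carry no information. *)
Definition wval w l : A := val (tagged w) (to_box (tag w) l).

Lemma worigin_val w : worigin w = wval w 0. Proof. by []. Qed.
Lemma wterm_val w : wterm w = wval w (wshape w). Proof. by []. Qed.

Lemma word_ext u v : wshape u = wshape v ->
  (forall l, in_box (wshape u) l -> wval u l = wval v l) -> u = v.
Proof.
case: u v => [m u] [n v]; rewrite /wshape /= => mn; case: n / mn v => v uv.
congr existT; apply/val_inj/ffunP => x.
have := uv (coords x) (in_box_coords x).
by rewrite /wval /= to_boxK.
Qed.

Lemma wval_step w j l : in_box (wshape w) (l + unit_shape j) ->
  M j (wval w (l + unit_shape j)) (wval w l) = 1%N.
Proof.
move=> lj; have lw := in_box_trans lj (in_boxDl l (unit_shape j)).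
have /forallP/(_ j)/forallP/(_ (to_box (wshape w) l)) := valP (tagged w).
by rewrite coordsK // => /implyP/(_ lj)/eqP.
Qed.

(** Words can be specified by functions of shapes, without handling boxes. *)
Lemma word_make m (f : mshape r -> A) :
  (forall j l, in_box m (l + unit_shape j) -> M j (f (l + unit_shape j)) (f l) = 1%N) ->
  exists w : word M, wshape w = m /\ forall l, in_box m l -> wval w l = f l.
Proof.
move=> fM; pose g : {ffun box m -> A} := [ffun x => f (coords x)].
have gw : is_word M g.
  apply/forallP => j; apply/forallP => x; apply/implyP => xj; apply/eqP.
  by rewrite !ffunE coordsK // fM.
exists (mkword (Sub g gw : word_of M m)); split => // l lm.
by rewrite /wval /= ffunE coordsK.
Qed.

Lemma is_productP (u v : word M) (w : word_of M (wshape u + wshape v)) :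
  is_product (tagged u) (tagged v) w <->
  (forall l, in_box (wshape u) l -> wval (mkword w) l = wval u l) /\
  (forall l, in_box (wshape v) l -> wval (mkword w) (wshape u + l) = wval v l).
Proof.
rewrite /is_product; split.
  move=> /andP[/eqP /ffunP uw /eqP /ffunP vw]; split => l lm.
    by have := uw (to_box _ l); rewrite ffunE coordsK // addr0.
  by have := vw (to_box _ l); rewrite ffunE coordsK // [l + _]addrC.
move=> [uw vw]; apply/andP; split; apply/eqP/ffunP => x; rewrite ffunE.
  by rewrite addr0; have := uw _ (in_box_coords x); rewrite /wval /= to_boxK.
by rewrite [coords x + _]addrC; have := vw _ (in_box_coords x); rewrite /wval /= to_boxK.
Qed.

Definition is_cat u v w :=
  [/\ wshape w = wshape u + wshape v,
      forall l, in_box (wshape u) l -> wval w l = wval u l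
    & forall l, in_box (wshape v) l -> wval w (wshape u + l) = wval v l].

Hypothesis adm : admissible M.

Lemma wprod_cat u v : wterm u = worigin v -> is_cat u v (wprod u v).
Proof.
move=> uv; have [w [wp _]] := adm_product adm (u := tagged u) (v := tagged v) uv.
rewrite /wprod; case: pickP => [w' /is_productP[w'u w'v]|/(_ w)]; last by rewrite wp.
by split.
Qed.

Lemma wprod_uniq u v w : wterm u = worigin v -> is_cat u v w -> w = wprod u v.
Proof.
move=> uv [+ wu wv]; have [pE pu pv] := wprod_cat uv.
have [w0 [wp w0u]] := adm_product adm (u := tagged u) (v := tagged v) uv.
have key (x : word M) : wshape x = wshape u + wshape v ->
  (forall l, in_box (wshape u) l -> wval x l = wval u l) ->
  (forall l, in_box (wshape v) l -> wval x (wshape u + l) = wval v l) ->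
  x = mkword w0.
  case: x => [m x]; rewrite {1}/wshape /= => mE; subst m => xu xv.
  by congr existT; apply/esym/w0u/is_productP; split.
by move=> wE; rewrite (key _ wE) // (key _ pE).
Qed.

Lemma wshapeM u v : wterm u = worigin v -> wshape (wprod u v) = wshape u + wshape v.
Proof. by case/wprod_cat. Qed.
Lemma wvall u v l : wterm u = worigin v -> in_box (wshape u) l ->
  wval (wprod u v) l = wval u l.
Proof. by case/wprod_cat => _ + _; exact. Qed.
Lemma wvalr u v l : wterm u = worigin v -> in_box (wshape v) l ->
  wval (wprod u v) (wshape u + l) = wval v l.
Proof. by case/wprod_cat => _ _; exact. Qed.
Lemma wtermM u v : wterm u = worigin v -> wterm (wprod u v) = wterm v.
Proof. by move=> uv; rewrite wterm_val wshapeM // wvalr // in_boxx. Qed.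

Lemma wprodA u v w : wterm u = worigin v -> wterm v = worigin w ->
  wprod (wprod u v) w = wprod u (wprod v w).
Proof.
move=> uv vw; have uvw : wterm (wprod u v) = worigin w by rewrite wtermM.
have u_vw : wterm u = worigin (wprod v w) by rewrite worigin_prod.
apply: wprod_uniq => //; split.
- by rewrite !wshapeM // addrA.
- move=> l lu; rewrite !wvall // wshapeM //; exact: in_box_trans (in_boxDl _ _) lu.
move=> l; rewrite wshapeM // => lvw.
have key k : in_box (wshape v) k -> wval (wprod (wprod u v) w) (wshape u + k) = wval v k.
  by move=> kv; rewrite wvall ?wvalr // wshapeM // in_boxD2.
have key2 k : in_box (wshape w) k ->
    wval (wprod (wprod u v) w) (wshape u + wshape v + k) = wval w k.
  by move=> kw; rewrite -wshapeM // wvalr.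
have [j k kj|x [xE xv]] := @word_make (wshape v + wshape w)
    (fun k => wval (wprod (wprod u v) w) (wshape u + k)).
  by rewrite addrA; apply: wval_step; rewrite !wshapeM // -!addrA; apply: in_boxD2.
have <- : x = wprod v w.
  apply: wprod_uniq => //; split => // k kb.
    rewrite xv ?key //; exact: in_box_trans (in_boxDl _ _) kb.
  by rewrite xv ?in_boxD2 // addrA key2.
by rewrite xv.
Qed.

Lemma wsub_ex w k n : in_box (wshape w) (k + n) -> exists v,
  wshape v = n /\ forall l, in_box n l -> wval v l = wval w (k + l).
Proof.
move=> kn; apply: word_make => j l lj; rewrite addrA; apply: wval_step.
by apply: in_box_trans kn _; rewrite -addrA; apply: in_boxD2.
Qed.

Lemma wfactor w m n : wshape w = m + n -> exists u v,
  [/\ wshape u = m, wshape v = n, wterm u = worigin v & w = wprod u v].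
Proof.
move=> wE.
have [|u [um uw]] := @wsub_ex w 0 m; first by rewrite add0r wE in_boxDl.
have [|v [vn vw]] := @wsub_ex w m n; first by rewrite wE in_boxx.
have uv : wterm u = worigin v.
  by rewrite wterm_val worigin_val um uw ?in_boxx // vw ?in_box0 // add0r addr0.
exists u, v; split => //; apply: wprod_uniq => //; split; first by rewrite um vn.
  by rewrite um => l lu; rewrite uw // add0r.
by rewrite um vn => l lv; rewrite vw.
Qed.

Lemma wfactor_inj u u' v v' : wterm u = worigin v -> wterm u' = worigin v' ->
  wshape u = wshape u' -> wprod u v = wprod u' v' -> u = u' /\ v = v'.
Proof.
move=> uv uv' us E; have vs : wshape v = wshape v'.
  by apply: (@addSI _ (wshape u)); rewrite {2}us -!wshapeM // E.
split; apply: word_ext => // l lb.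
  by rewrite -(wvall uv lb) E wvall // -us.
by rewrite -(wvalr uv lb) E us wvalr // -vs.
Qed.

Lemma vertex_ex a : exists w, [/\ wshape w = 0, worigin w = a & wterm w = a].
Proof.
have [|w [w0 wa]] := @word_make 0 (fun=> a).
  by move=> j l /in_boxP/(_ j); rewrite shapeD shape0 ffunE eqxx addn1.
by exists w; rewrite worigin_val wterm_val w0 !wa ?in_box0.
Qed.

Lemma wprod_vertex u v : wshape v = 0 -> wterm u = worigin v -> wprod u v = u.
Proof.
move=> v0 uv; apply/esym/wprod_uniq => //; split => //; first by rewrite v0 addr0.
move=> l; rewrite v0 => /in_boxP l0.
have -> : l = 0 by apply/ffunP => i; have := l0 i; rewrite shape0 leqn0 => /eqP.
by rewrite addr0 -worigin_val -uv.
Qed.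

Lemma edge_ex j a b : M j b a = 1%N ->
  exists w, [/\ wshape w = unit_shape j, worigin w = a & wterm w = b].
Proof.
move=> ab.
have [|w [wj wa]] := @word_make (unit_shape j) (fun l => if l j == 0%N then a else b).
  move=> i l /in_boxP lij.
  have ij : i = j.
    apply/eqP; have := lij i; rewrite shapeD !ffunE eqxx.
    by case: eqP => // _; rewrite addn1.
  by have := lij j; rewrite ij shapeD ffunE eqxx; case: (l j) => //= k; rewrite addn1.
exists w; rewrite worigin_val wterm_val wj !wa ?in_box0 ?in_boxx //.
by rewrite shape0 ffunE !eqxx.
Qed.

Lemma path_ex a b : exists w, worigin w = a /\ wterm w = b.
Proof.
have /connectP[p] := adm_irreducible adm a b.
elim: p a => [|c p IH] a /=.
  by move=> _ ->; have [w [_ ? ?]] := vertex_ex a; exists w.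
move=> /andP[/existsP[j /eqP ac] /IH{}IH /IH[w [wc wb]]].
have [e [_ ea ec]] := edge_ex ac.
by exists (wprod e w); rewrite worigin_prod wtermM ?ec.
Qed.

Definition nonper (p : {ffun 'I_r -> int}) w := exists l l',
  [/\ in_box (wshape w) l, in_box (wshape w) l',
      forall i, (l' i)%:Z = (l i)%:Z - p i & wval w l <> wval w l'].

Lemma nonper_ex p : p != 0 -> exists w, nonper p w.
Proof.
move=> /eqP/(adm_aperiodic adm)[m [w]] /existsNP[x] /existsNP[y] /not_implyP[xy wxy].
exists (mkword w), (coords x), (coords y).
rewrite /wval /= !to_boxK; split => //; try exact: in_box_coords.
by move=> i; rewrite !ffunE.
Qed.

Lemma nonper_catr p u v : wterm u = worigin v -> nonper p v -> nonper p (wprod u v).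
Proof.
move=> uv [l [l' [lv lv' ll' ne]]]; exists (wshape u + l), (wshape u + l').
rewrite !wvalr // wshapeM // !in_boxD2 //; split => // i.
by rewrite !shapeD !PoszD ll' addrA.
Qed.

Lemma nonper_catl p u v : wterm u = worigin v -> nonper p u -> nonper p (wprod u v).
Proof.
move=> uv [l [l' [lv lv' ll' ne]]]; exists l, l'.
rewrite !wvall // wshapeM //; split => //; exact: in_box_trans (in_boxDl _ _) _.
Qed.

(** Concatenate, along connecting paths, one word that is not p-periodic for each
    p in the list: failure of periodicity survives concatenation on either side. *)
Lemma nonper_seq (ps : seq {ffun 'I_r -> int}) a :
  exists2 w, worigin w = a & forall p, p \in ps -> p != 0 -> nonper p w.
Proof.
elim: ps => [|p ps [w wa IH]].
  by have [w [_ ? _]] := vertex_ex a; exists w.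
have [->|p0] := eqVneq p 0.
  by exists w => // q; rewrite inE => /orP[/eqP ->|/IH //]; rewrite eqxx.
have [v pv] := nonper_ex p0.
have [f [fo ft]] := path_ex (wterm w) (worigin v).
exists (wprod w (wprod f v)); first by rewrite worigin_prod.
have wfv : wterm w = worigin (wprod f v) by rewrite worigin_prod.
move=> q; rewrite inE => /orP[/eqP -> _|qs q0].
  by apply: nonper_catr => //; apply: nonper_catr.
by apply: nonper_catl => //; apply: IH.
Qed.

(** Let g be a loop at b of nonzero shape p, and x a word from b that is not
    p-periodic.  Either the initial part of x of shape p differs from g, or x and
    its translate by p, which then also starts at b, differ somewhere.  In both
    cases two distinct words of one shape leave b, the first of which is
    completed to a loop. *)
Lemma two_words (r1 : (1 <= r)%N) b : exists w h w' : word M,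
  [/\ worigin w = b, worigin w' = b, wshape w = wshape w', w <> w' &
      wterm w = worigin h /\ wterm h = b].
Proof.
pose j0 := Ordinal r1.
have [a [c ac]] := adm_neq0 adm j0.
have {}ac : M j0 c a = 1%N by case: (adm_01 adm j0 a c).
have [e [ej ea ec]] := edge_ex ac.
have [f [fb fa]] := path_ex b a; have [f' [fc fb']] := path_ex c b.
have fe : wterm f = worigin e by rewrite fa.
have fef : wterm (wprod f e) = worigin f' by rewrite wtermM // ec.
pose g := wprod (wprod f e) f'.
have gb : worigin g = b by rewrite !worigin_prod.
have gt : wterm g = b by rewrite wtermM.
have g0 : (0 < wshape g j0)%N.
  by rewrite !wshapeM // !shapeD ej ffunE eqxx addn1.
pose p : {ffun 'I_r -> int} := [ffun i => (wshape g i)%:Z].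
have p0 : p != 0.
  apply/eqP => /ffunP/(_ j0); rewrite !ffunE => -[g00].
  by rewrite g00 in g0.
have [v pv] := nonper_ex p0.
have [k [kb kv]] := path_ex b (worigin v).
have [l [l' [lx lx' ll' ne]]] := nonper_catr kv pv.
set x := wprod k v in lx lx' ne.
have xb : worigin x = b by rewrite worigin_prod.
have lE : l = wshape g + l'.
  apply/ffunP => i; rewrite shapeD; have := ll' i; rewrite /p ffunE; move: (l i) (l' i) (wshape g i) => x1 x2 x3.
by lia.
have gx : in_box (wshape x) (0 + wshape g).
  by rewrite add0r; apply: in_box_trans lx _; rewrite lE in_boxDl.
have [y [yg yx]] := wsub_ex gx.
have yb : worigin y = b by rewrite worigin_val yx ?in_box0 // addr0.
have [gy|gy] := EM (g = y); last first.
  have [d [_ ob ot]] := vertex_ex b.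
  by exists g, d, y; rewrite ob.
pose q := subS (wshape x) (wshape g).
have qx : wshape g + q = wshape x by rewrite subSK // -[wshape g]add0r.
have [|z [zq zx]] := @wsub_ex x (wshape g) q; first by rewrite qx in_boxx.
have [|z' [zq' zx']] := @wsub_ex x 0 q.
  by rewrite add0r -qx addrC in_boxDl.
have lq : in_box q l'.
  apply/in_boxP => i; have /in_boxP/(_ i) := lx; rewrite lE -qx !shapeD.
  by rewrite leq_add2l.
have [h [ho ht]] := path_ex (wterm z) b.
exists z, h, z'; split => //; try by rewrite ?zq ?zq'.
- rewrite worigin_val zx ?in_box0 // addr0.
  by rewrite -[wshape g]add0r -yx ?in_boxx // -yg -wterm_val -gy.
- by rewrite worigin_val zx' ?in_box0 // addr0.
- by move=> /(congr1 (wval^~ l')); rewrite zx // zx' // add0r -lE.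
Qed.

End WordTheory.

(** * Sums over words *)

Section WordSums.
Variables (r : nat) (A : finType) (M : 'I_r -> A -> A -> nat).
Hypothesis adm : admissible M.
Variable V : zmodType.
Implicit Types (l m n : mshape r) (u v w : word M) (a b : A) (F : word M -> V).

(** The summand is a function on words of all shapes, so that sums over words
    of different shapes can be composed. *)
Definition wsum m a F : V :=
  \sum_(w : word_of M m | worigin (mkword w) == a) F (mkword w).

Lemma mkword_ex w m : wshape w = m -> exists x : word_of M m, w = mkword x.
Proof. by case: w => n w; rewrite /wshape /= => nm; subst n; exists w. Qed.

Lemma mkword_inj m : injective (@mkword r A M m).
Proof.
move=> x y xy; apply/val_inj/ffunP => z.
have := congr1 (fun w => wval w (coords z)) xy.
by rewrite /wval /= to_boxK.
Qed.

Lemma eq_wsum m a F G : (forall w, wshape w = m -> worigin w = a -> F w = G w) ->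
  wsum m a F = wsum m a G.
Proof. by move=> FG; apply: eq_bigr => w /eqP; apply: FG. Qed.

Lemma wsum1 m a F w0 : wshape w0 = m -> worigin w0 = a ->
  (forall w, wshape w = m -> worigin w = a -> w <> w0 -> F w = 0) ->
  wsum m a F = F w0.
Proof.
move=> w0m; have [x ->] := mkword_ex w0m => xa F0.
rewrite /wsum (bigD1 x) ?xa //= big1 ?addr0 // => y /andP[/eqP ya yx].
by apply: F0 => // /mkword_inj yx'; rewrite yx' eqxx in yx.
Qed.

Lemma wsum0 a F w0 : wshape w0 = 0 -> worigin w0 = a -> wsum 0 a F = F w0.
Proof.
move=> w00 w0a; apply: wsum1 => // w w_0 wa; case; apply: word_ext.
  by rewrite w_0 w00.
move=> l; rewrite w_0 => /in_boxP l0.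
have -> : l = 0 by apply/ffunP => i; have := l0 i; rewrite shape0 leqn0 => /eqP.
by rewrite -!worigin_val wa w0a.
Qed.

(** Unique factorization of words of shape m + n. *)
Lemma wsumD m n a F : wsum (m + n) a F =
  wsum m a (fun w => wsum n (wterm w) (fun e => F (wprod w e))).
Proof.
have /choice[h hP] : forall x : word_of M (m + n), exists p : word_of M m * word_of M n,
    wterm (mkword p.1) = worigin (mkword p.2) /\
    mkword x = wprod (mkword p.1) (mkword p.2).
  move=> x; have [u [v [um vn uv E]]] := wfactor adm (erefl : wshape (mkword x) = m + n).
  have [u' u'E] := mkword_ex um; have [v' v'E] := mkword_ex vn.
  by exists (u', v'); rewrite /= -u'E -v'E.
rewrite /wsum pair_big_dep /=.
pose X := [set x : word_of M (m + n) | worigin (mkword x) == a]%SET.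
transitivity (\sum_(p in [set h x | x in X]%SET) F (wprod (mkword p.1) (mkword p.2))).
  rewrite big_imset /=; last first.
    by move=> x y _ _ hxy; apply: mkword_inj; rewrite (hP x).2 (hP y).2 hxy.
  by apply: eq_big => x; rewrite ?inE // => _; rewrite -(hP x).2.
apply: eq_bigl => -[w e] /=; apply/imsetP/andP => [[x]|[/eqP wa /eqP ew]].
  rewrite inE => /eqP xa hx; have [] := hP x; rewrite -hx /= => we E.
  by rewrite -xa E worigin_prod -we !eqxx.
have [//|x xE] := @mkword_ex (wprod (mkword w) (mkword e)) (m + n); first by rewrite wshapeM.
have xa : x \in X by rewrite inE -xE worigin_prod wa.
exists x => //; have [hx E] := hP x.
have [] // := wfactor_inj adm (esym ew) hx (erefl : wshape (mkword w) = wshape (mkword (h x).1)) _.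
  by rewrite -E -xE.
by move=> /mkword_inj -> /mkword_inj ->; case: (h x).
Qed.

End WordSums.

(** * Projections adding up to a projection *)

Section Projections.
Variables (R : realType) (B : cstarAlgType R).

(** The positive elements (1 - q) (F j) (1 - q) add up to (1 - q) q (1 - q) = 0. *)
Lemma proj_sum_absorb (I : finType) (P : pred I) (F : I -> B) q :
  (forall i, P i -> projection (F i)) -> projection q ->
  \sum_(i | P i) F i = q -> forall i, P i -> q '** F i = F i.
Proof.
move=> Fp [qs qq] Fq i Pi.
have FE j : P j -> (F j - F j '** q) '^* '** (F j - F j '** q) =
    F j - F j '** q - q '** F j + q '** F j '** q.
  move=> Pj; have [js jj] := Fp j Pj.
  rewrite cstarB cstarM js qs cmulBl !cmulBr !cmulA jj -!cmulA jj [F j '** (F j '** q)]cmulA jj.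
  by rewrite opprB addrA [LHS](ACl (1*2*4*3)).
have S0 : \sum_(j <- enum P) (F j - F j '** q) '^* '** (F j - F j '** q) = 0.
  rewrite big_enum /= (eq_bigr _ FE) !big_split /= !sumrN.
  by rewrite -!cmul_suml -!cmul_sumr Fq !qq subrr add0r addNr.
have /(sum_star_eq0 S0)/eqP : i \in enum P by rewrite mem_enum.
rewrite subr_eq0 => /eqP E.
have := congr1 (@cstar R B) E; rewrite cstarM qs (Fp i Pi).1 => <- //.
Qed.

(** Compressing the sum by F j shows that the positive elements
    (F j) (F k) (F j), k <> j, add up to 0. *)
Lemma proj_sum_orth (I : finType) (P : pred I) (F : I -> B) q :
  (forall i, P i -> projection (F i)) -> projection q ->
  \sum_(i | P i) F i = q -> forall i j, P i -> P j -> i != j -> F i '** F j = 0.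
Proof.
move=> Fp qp Fq i j Pi Pj ij.
have [js jj] := Fp j Pj.
(* The term of k = j is removed by hand, to let the sum range over all of P. *)
have S0 : \sum_(k <- enum P) (if k == j then 0 else F k '** F j) '^* '**
                             (if k == j then 0 else F k '** F j) = 0.
  rewrite big_enum /=.
  have E : \sum_(k | P k) F j '** F k '** F j = F j.
    by rewrite -cmul_suml -cmul_sumr Fq -cmulA (proj_sum_absorb Fp qp Fq Pj).
  rewrite (bigD1 j) //= eqxx cmulx0 add0r.
  move: E; rewrite (bigD1 j) //= jj jj -[X in _ = X]addr0 => /addrI E.
  rewrite -[RHS]E; apply: eq_bigr => k /andP[Pk /negPf ->].
  by rewrite cstarM js (Fp k Pk).1 !cmulA -[F j '** F k '** F k]cmulA (Fp k Pk).2.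
have /(sum_star_eq0 S0) : i \in enum P by rewrite mem_enum.
by rewrite (negPf ij).
Qed.

End Projections.

(** * The generating partial isometries *)

Section Algebra.
Variables (r : nat) (A : finType) (M : 'I_r -> A -> A -> nat).
Hypothesis adm : admissible M.
Variables (D : countType) (delta : D -> A).
Implicit Types (l m n : mshape r) (u v w x : decorated M delta) (f g h : word M).

Definition dval u l := wval (val u).2 l.

Lemma dorigin_vertex u : worigin (val u).2 = delta (val u).1.
Proof. exact/eqP/(valP u). Qed.

Lemma decorated_ext u v : (val u).1 = (val v).1 -> (val u).2 = (val v).2 -> u = v.
Proof.
by move=> uv1 uv2; apply: val_inj; rewrite [LHS]surjective_pairing [RHS]surjective_pairing uv1 uv2.
Qed.

Lemma dshapeM u g : dterm u = worigin g -> dshape (dprod u g) = dshape u + wshape g.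
Proof. exact: wshapeM. Qed.

Lemma dtermM u g : dterm u = worigin g -> dterm (dprod u g) = wterm g.
Proof. exact: wtermM. Qed.

Lemma dprodA u f g : dterm u = worigin f -> wterm f = worigin g ->
  dprod (dprod u f) g = dprod u (wprod f g).
Proof. by move=> uf fg; apply: decorated_ext => //=; apply: wprodA. Qed.

Lemma dprod_vertex u g : wshape g = 0 -> dterm u = worigin g -> dprod u g = u.
Proof. by move=> g0 ug; apply: decorated_ext => //=; apply: wprod_vertex. Qed.

Lemma dvall u g l : dterm u = worigin g -> in_box (dshape u) l ->
  dval (dprod u g) l = dval u l.
Proof. exact: wvall. Qed.

Lemma dvalr u g l : dterm u = worigin g -> in_box (wshape g) l ->
  dval (dprod u g) (dshape u + l) = wval g l.
Proof. exact: wvalr. Qed.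

(** This puts words with one decoration inside a single expansion, that of the
    projection of the decoration itself. *)
Lemma dorigin_ex u : exists o, [/\ dshape o = 0, dterm o = worigin (val u).2,
  (val o).1 = (val u).1 & dprod o (val u).2 = u].
Proof.
have [w [w0 wo wt]] := vertex_ex M (delta (val u).1).
have wd : worigin w == delta (val u).1 by rewrite wo.
pose o : decorated M delta := Sub ((val u).1, w) wd.
have ot : dterm o = worigin (val u).2 by rewrite dorigin_vertex.
exists o; split => //; apply: decorated_ext => //=.
apply/esym/wprod_uniq => //; split => //; first by rewrite w0 add0r.
  move=> l; rewrite w0 => /in_boxP l0.
  have -> : l = 0 by apply/ffunP => i; have := l0 i; rewrite shape0 leqn0 => /eqP.
  by rewrite -!worigin_val wo dorigin_vertex.
by move=> l _; rewrite w0 add0r.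
Qed.

Variables (R : realType) (B : cstarAlgType R) (s : decorated M delta -> decorated M delta -> B).
Hypothesis rel : relations s.

Local Notation p u := (s u u).

Lemma s_star u v : dterm u = dterm v -> (s u v) '^* = s v u.
Proof. by move=> uv; apply: (rel_star rel). Qed.
Lemma s_mul u v w : dterm u = dterm v -> dterm v = dterm w -> s u v '** s v w = s u w.
Proof. by move=> uv vw; apply: (rel_mul rel). Qed.
Lemma s_proj u : projection (p u).
Proof. by split; [exact: s_star|exact: s_mul]. Qed.

Lemma s_step j u v : dterm u = dterm v ->
  s u v = wsum (unit_shape j) (dterm u) (fun g => s (dprod u g) (dprod v g)).
Proof. by move=> uv; apply: (rel_sum rel). Qed.

(** The summation relation, iterated along an arbitrary shape. *)
Lemma s_expand m u v : dterm u = dterm v ->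
  s u v = wsum m (dterm u) (fun g => s (dprod u g) (dprod v g)).
Proof.
move=> uv; elim/shape_ind: m => [|m j IH].
  have [g [g0 go _]] := vertex_ex M (dterm u).
  by rewrite (wsum0 _ g0 go) !dprod_vertex -?uv.
rewrite wsumD // {1}IH; apply: eq_wsum => g gm go.
have ug : dterm u = worigin g by rewrite go.
have vg : dterm v = worigin g by rewrite -uv.
rewrite (s_step j) ?dtermM //; apply: eq_wsum => e ej eo.
by rewrite !dprodA.
Qed.

Lemma s_orth_origin o f g : dterm o = worigin f -> dterm o = worigin g ->
  wshape f = wshape g -> f <> g -> p (dprod o f) '** p (dprod o g) = 0.
Proof.
move=> of_ og; have [x fx] := mkword_ex (erefl (wshape f)).
move=> /esym/mkword_ex[y gy] fg; rewrite fx gy.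
have S := @s_expand (wshape f) o o erefl.
apply: (proj_sum_orth (q := p o) (P := fun z : word_of M (wshape f) => worigin (mkword z) == dterm o)
  (F := fun z => p (dprod o (mkword z)))) => //.
- by move=> z _; apply: s_proj.
- exact: s_proj.
- by rewrite -fx of_.
- by rewrite -gy og.
by apply/eqP => xy; apply: fg; rewrite fx gy xy.
Qed.

(** In the expansion of s u v along the shape of g, only the term of g survives
    multiplication by the projection of v g. *)
Lemma s_absorb u v g : dterm u = dterm v -> dterm u = worigin g ->
  s u v '** p (dprod v g) = s (dprod u g) (dprod v g).
Proof.
move=> uv ug; rewrite (s_expand (wshape g) uv) cmul_suml.
have vg : dterm v = worigin g by rewrite -uv.
rewrite -[LHS]/(wsum _ _ (fun h => s (dprod u h) (dprod v h) '** p (dprod v g))).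
rewrite (wsum1 (w0 := g)) //; first by rewrite s_mul ?dtermM.
move=> h hg ho hgN; have vh : dterm v = worigin h by rewrite -uv ho.
have uh : dterm u = worigin h by rewrite ho.
by rewrite -(s_mul (v := dprod v h)) ?dtermM // -cmulA s_orth_origin ?cmulx0.
Qed.

Lemma s_absorbl u v g : dterm u = dterm v -> dterm u = worigin g ->
  p (dprod u g) '** s u v = s (dprod u g) (dprod v g).
Proof.
move=> uv ug; have vg : dterm v = worigin g by rewrite -uv.
rewrite -[LHS]cstarK cstarM !s_star ?dtermM // s_absorb // s_star //.
by rewrite !dtermM.
Qed.

(** If the decorations agree, both projections occur in one expansion of the
    projection of that decoration; otherwise they lie below orthogonal ones. *)
Lemma s_orth u v : dshape u = dshape v -> u <> v -> p u '** p v = 0.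
Proof.
move=> uvs uv.
have [c [c0 ct cu cE]] := dorigin_ex u; have [c' [c0' ct' cv cE']] := dorigin_ex v.
have [cc|cc] := EM (c = c').
  subst c'; rewrite -cE -cE'; apply: s_orth_origin => //.
  by move=> E; apply: uv; rewrite -cE -cE' E.
have <- : p u '** p c = p u by have := s_absorbl (v := c) erefl ct; rewrite cE.
have <- : p c' '** p v = p v by have := s_absorb (v := c') erefl ct'; rewrite cE'.
rewrite -cmulA [p c '** _]cmulA (rel_orth rel) // cmul0x cmulx0 //.
Qed.

Lemma s_mul_same u v w x : dterm u = dterm v -> dterm w = dterm x ->
  dshape v = dshape w -> s u v '** s w x = if v == w then s u x else 0.
Proof.
move=> uv wx vw; case: eqVneq => [E|/eqP E]; first by subst w; rewrite s_mul.
by rewrite -(s_mul (v := v)) // -(s_mul (u := w) (v := w)) // -cmulA [p v '** _]cmulA s_orth // cmul0x cmulx0.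
Qed.

(** Both projections are expanded along a common shape. *)
Lemma s_orth_incompatible u v :
  (forall f g, dterm u = worigin f -> dterm v = worigin g ->
     dshape u + wshape f = dshape v + wshape g -> dprod u f <> dprod v g) ->
  p u '** p v = 0.
Proof.
move=> uv; pose m := joinS (dshape u) (dshape v).
rewrite (s_expand (subS m (dshape u)) (erefl (dterm u))).
rewrite (s_expand (subS m (dshape v)) (erefl (dterm v))).
rewrite /wsum cmul_suml big1 // => f /eqP fo; rewrite cmul_sumr big1 // => g /eqP go.
have E : dshape u + wshape (mkword f) = dshape v + wshape (mkword g).
  by rewrite !subSK ?in_box_joinl ?in_box_joinr.
by apply: s_orth; [rewrite !dshapeM|apply: uv].
Qed.

Lemma s_orth_dval u v l : in_box (dshape u) l -> in_box (dshape v) l ->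
  dval u l <> dval v l -> p u '** p v = 0.
Proof.
move=> lu lv uv; apply: s_orth_incompatible => f g uf vg _ E; apply: uv.
by rewrite -(dvall uf lu) E dvall.
Qed.

(** By irreducibility every letter is reached from every decorated word.  So the
    vanishing of one projection propagates to all of them. *)
Lemma s_neq0 : (exists u v, dterm u = dterm v /\ s u v <> 0) -> forall u, p u <> 0.
Proof.
move=> [u0 [v0 [uv0 s0]]] u pu; apply: s0.
have [g [go gt]] := path_ex adm (dterm u) (dterm u0).
have pug : p (dprod u g) = 0 by rewrite -s_absorb // pu cmul0x.
have tt : dterm (dprod u g) = dterm u0 by rewrite dtermM.
rewrite -(s_mul (v := u0)) // -(s_mul (v := dprod u g)) //.
by rewrite -(s_mul (u := dprod u g) (v := dprod u g)) // pug cmul0x cmulx0 cmul0x.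
Qed.

(** With w h a loop at the end of u and w' a different word of the shape of w,
    the projection of u is equivalent to that of u w h, and what is left
    contains the nonzero projection of u w'. *)
Lemma s_infinite : (1 <= r)%N -> (exists u v, dterm u = dterm v /\ s u v <> 0) ->
  forall u, infinite_projection (p u).
Proof.
move=> r1 s0 u; split; first exact: s_proj.
have [w [h [w' [wo wo' ww' wwN [wh ht]]]]] := two_words adm r1 (dterm u).
pose v := dprod u (wprod w h).
have uwh : dterm u = worigin (wprod w h) by rewrite worigin_prod.
have vt : dterm v = dterm u by rewrite dtermM // wtermM.
exists (p v); split; last by exists (s v u); rewrite !s_star // !s_mul.
split; [exact: s_proj|exact: s_absorb|] => E.
apply: (s_neq0 s0 (u := dprod u w')).
rewrite -s_absorbl // -E.
have vE : v = dprod (dprod u w) h by rewrite dprodA.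
have uwt : dterm (dprod u w) = worigin h by rewrite dtermM.
by rewrite vE -(s_absorb (u := dprod u w)) // cmulA s_orth_origin ?cmul0x //; apply: nesym.
Qed.

End Algebra.

(** * Closed star subalgebras *)

Section SubCstar.
Variables (R : realType) (B : cstarAlgType R).

(** The universal property has to be applied to the closed span of the
    generators, which must therefore be made a C*-algebra of its own. *)
Record subcstar := SubCstar {
  carrier : B -> Prop;
  carrier0 : carrier 0;
  carrierD : forall x y, carrier x -> carrier y -> carrier (x + y);
  carrierZ : forall (a : R[i]) x, carrier x -> carrier (a *: x);
  carrierM : forall x y, carrier x -> carrier y -> carrier (x '** y);
  carrierS : forall x, carrier x -> carrier (x '^*);
  carrier_closed : closed_prop carrier
}.

Variable S : subcstar.
Definition subcstar_sort : Type := {x : B | `[< carrier S x >]}.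
Local Notation T := subcstar_sort.
HB.instance Definition _ := Choice.copy T {x : B | `[< carrier S x >]}.

Definition sub_val (x : T) : B := sval x.
Definition sub_mk (x : B) (Sx : carrier S x) : T := exist _ x (asboolT Sx).
Lemma sub_valP (x : T) : carrier S (sub_val x).
Proof. by case: x => x /= /asboolP. Qed.
Lemma sub_val_inj : injective sub_val. Proof. exact: val_inj. Qed.

Definition sub_add (x y : T) := sub_mk (carrierD (sub_valP x) (sub_valP y)).
Definition sub_scale (a : R[i]) (x : T) := sub_mk (carrierZ a (sub_valP x)).
Definition sub_zero : T := sub_mk (carrier0 S).
Definition sub_opp (x : T) := sub_scale (-1) x.
Definition sub_mul (x y : T) := sub_mk (carrierM (sub_valP x) (sub_valP y)).
Definition sub_star (x : T) := sub_mk (carrierS (sub_valP x)).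

Lemma sub_addA : associative sub_add.
Proof. by move=> x y z; apply: sub_val_inj; apply: addrA. Qed.
Lemma sub_addC : commutative sub_add.
Proof. by move=> x y; apply: sub_val_inj; apply: addrC. Qed.
Lemma sub_add0 : left_id sub_zero sub_add.
Proof. by move=> x; apply: sub_val_inj; apply: add0r. Qed.
Lemma sub_addN : left_inverse sub_zero sub_opp sub_add.
Proof. by move=> x; apply: sub_val_inj; rewrite /= scaleN1r addNr. Qed.
HB.instance Definition _ :=
  GRing.isZmodule.Build T sub_addA sub_addC sub_add0 sub_addN.

Lemma sub_scaleA a b (x : T) : sub_scale a (sub_scale b x) = sub_scale (a * b) x.
Proof. by apply: sub_val_inj; apply: scalerA. Qed.
Lemma sub_scale1 : left_id 1 sub_scale.
Proof. by move=> x; apply: sub_val_inj; apply: scale1r. Qed.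
Lemma sub_scaleDr : right_distributive sub_scale +%R.
Proof. by move=> a x y; apply: sub_val_inj; apply: scalerDr. Qed.
Lemma sub_scaleDl (x : T) : {morph sub_scale^~ x : a b / a + b}.
Proof. by move=> a b; apply: sub_val_inj; apply: scalerDl. Qed.
HB.instance Definition _ := GRing.Zmodule_isLmodule.Build R[i] T
  sub_scaleA sub_scale1 sub_scaleDr sub_scaleDl.

Definition sub_norm (x : T) : R[i] := `|sub_val x|.
Lemma sub_normD (x y : T) : sub_norm (x + y) <= sub_norm x + sub_norm y.
Proof. exact: ler_normD. Qed.
Lemma sub_normZ (a : R[i]) (x : T) : sub_norm (a *: x) = `|a| * sub_norm x.
Proof. exact: normrZ. Qed.
Lemma sub_norm0 (x : T) : sub_norm x = 0 -> x = 0.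
Proof. by move=> /normr0_eq0 x0; apply: sub_val_inj. Qed.
HB.instance Definition _ :=
  Lmodule_isNormed.Build R[i] T sub_normD sub_normZ sub_norm0.

Lemma sub_valB (x y : T) : sub_val (x - y) = sub_val x - sub_val y.
Proof. by rewrite /= scaleN1r. Qed.

Lemma sub_complete (F : set_system T) : ProperFilter F -> cauchy F -> cvg F.
Proof.
move=> FF Fc.
have Fe : cauchy_ex F by apply/cauchyP.
have /cauchy_cvgP Gl : cauchy (sub_val @ F).
  apply: cauchy_exP => e e0; have [x Fx] := Fe e e0.
  exists (sub_val x); rewrite /fmap /=; apply: filterS Fx => y.
  by rewrite -!ball_normE /ball_ /= -sub_valB.
set l := lim (sub_val @ F) in Gl.
have near_l (e : R[i]) : 0 < e -> F [set y | `|l - sub_val y| < e].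
  by move=> e0; move/cvgrPdist_lt: Gl => /(_ e e0).
have lS : carrier S l.
  apply: carrier_closed => e e0.
  have ec : 0 < e%:C by rewrite ltcR.
  have [y ly] := filter_ex (near_l _ ec).
  exists (sub_val y); first exact: sub_valP.
  by move: ly => /= /ltW; rewrite nmE lecR nmB.
apply/cvg_ex; exists (sub_mk lS); apply/cvgrPdist_lt => e e0.
by apply: filterS (near_l e e0) => y /= ; rewrite [X in _ -> X < _]/Num.norm /= /sub_norm sub_valB.
Qed.
HB.instance Definition _ := Uniform_isComplete.Build T sub_complete.

Lemma sub_mulA : associative sub_mul.
Proof. by move=> x y z; apply: sub_val_inj; apply: cmulA. Qed.
Lemma sub_mulDl : left_distributive sub_mul +%R.
Proof. by move=> x y z; apply: sub_val_inj; apply: cmulDl. Qed.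
Lemma sub_mulDr : right_distributive sub_mul +%R.
Proof. by move=> x y z; apply: sub_val_inj; apply: cmulDr. Qed.
Lemma sub_mulZl (a : R[i]) x y : sub_mul (a *: x) y = a *: sub_mul x y.
Proof. by apply: sub_val_inj; apply: cmulZl. Qed.
Lemma sub_mulZr (a : R[i]) x y : sub_mul x (a *: y) = a *: sub_mul x y.
Proof. by apply: sub_val_inj; apply: cmulZr. Qed.
Lemma sub_starK : involutive sub_star.
Proof. by move=> x; apply: sub_val_inj; apply: cstarK. Qed.
Lemma sub_starD : {morph sub_star : x y / x + y}.
Proof. by move=> x y; apply: sub_val_inj; apply: cstarD. Qed.
Lemma sub_starZ (a : R[i]) x : sub_star (a *: x) = conjc a *: sub_star x.
Proof. by apply: sub_val_inj; apply: cstarZ. Qed.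
Lemma sub_starM x y : sub_star (sub_mul x y) = sub_mul (sub_star y) (sub_star x).
Proof. by apply: sub_val_inj; apply: cstarM. Qed.
Lemma sub_norm_mul (x y : T) : `|sub_mul x y| <= `|x| * `|y|.
Proof. exact: cnorm_mul_le. Qed.
Lemma sub_norm_star (x : T) : `|sub_mul (sub_star x) x| = `|x| ^+ 2.
Proof. exact: cnorm_starM. Qed.
HB.instance Definition _ := CompleteNormedModule_isCstarAlgebra.Build R T
  sub_mulA sub_mulDl sub_mulDr sub_mulZl sub_mulZr sub_starK sub_starD sub_starZ
  sub_starM sub_norm_mul sub_norm_star.

Definition subcstarAlg : cstarAlgType R := T.

Lemma sub_val_morphism : star_morphism (sub_val : subcstarAlg -> B).
Proof. by []. Qed.

End SubCstar.

(** * The span of the generators *)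

Section Span.
Variables (r : nat) (A : finType) (M : 'I_r -> A -> A -> nat).
Hypothesis adm : admissible M.
Variables (D : countType) (delta : D -> A).
Local Notation W := (decorated M delta).
Variables (R : realType) (B : cstarAlgType R) (s : W -> W -> B).
Hypothesis rel : relations s.
Implicit Types (u v w : W).

Definition good (L : seq (R[i] * (W * W))) :=
  all (fun q => dterm q.2.1 == dterm q.2.2) L.
Definition lsum (L : seq (R[i] * (W * W))) := \sum_(q <- L) q.1 *: s q.2.1 q.2.2.
Definition span x := exists2 L, good L & x = lsum L.

Lemma span0 : span 0.
Proof. by exists [::] => //; rewrite /lsum big_nil. Qed.
Lemma spanD x y : span x -> span y -> span (x + y).
Proof.
move=> [L Lg ->] [K Kg ->]; exists (L ++ K); first by rewrite /good all_cat; apply/andP.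
by rewrite /lsum big_cat.
Qed.
Lemma spanZ a x : span x -> span (a *: x).
Proof.
move=> [L Lg ->]; exists (map (fun q => (a * q.1, q.2)) L); first by rewrite /good all_map.
by rewrite /lsum big_map scaler_sumr; apply: eq_bigr => q _; rewrite scalerA.
Qed.
Lemma span_s u v : dterm u = dterm v -> span (s u v).
Proof.
move=> uv; exists [:: (1, (u, v))]; first by rewrite /good /= uv eqxx.
by rewrite /lsum big_seq1 scale1r.
Qed.
Lemma span_sum (I : Type) (e : seq I) (P : pred I) (F : I -> B) :
  (forall i, P i -> span (F i)) -> span (\sum_(i <- e | P i) F i).
Proof. by move=> PF; elim/big_ind: _ => //; [exact: span0|exact: spanD]. Qed.

Lemma span_ind (P : B -> Prop) : P 0 -> (forall x y, P x -> P y -> P (x + y)) ->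
  (forall a u v, dterm u = dterm v -> P (a *: s u v)) -> forall x, span x -> P x.
Proof.
move=> P0 PD Ps x [L + ->]; rewrite /lsum; elim: L => [|q L IH]; first by rewrite big_nil.
by rewrite big_cons => /= /andP[/eqP qg Lg]; apply: PD; [apply: Ps|apply: IH].
Qed.

Lemma spanS x : span x -> span (x '^*).
Proof.
elim/span_ind => [|y z ys zs|a u v uv]; first by rewrite cstar0; apply: span0.
  by rewrite cstarD; apply: spanD.
by rewrite cstarZ (s_star rel) //; apply/spanZ/span_s.
Qed.

Lemma spanM_gen u v w x : dterm u = dterm v -> dterm w = dterm x ->
  span (s u v '** s w x).
Proof.
move=> uv wx; pose m := joinS (dshape v) (dshape w).
rewrite (s_expand adm rel (subS m (dshape v)) uv) cmul_suml.
rewrite (s_expand adm rel (subS m (dshape w)) wx).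
apply: span_sum => f /eqP fo; rewrite cmul_sumr; apply: span_sum => g /eqP go.
rewrite (s_mul_same adm rel) ?dtermM -?wx -?uv //; last first.
  by rewrite !dshapeM -?uv // /wshape /= !subSK ?in_box_joinl ?in_box_joinr.
by case: eqP => [/(congr1 (@dterm _ _ _ _ _))|_]; [rewrite !dtermM -?uv // => fg; apply: span_s; rewrite !dtermM -?wx|exact: span0].
Qed.

Lemma spanM x y : span x -> span y -> span (x '** y).
Proof.
elim/span_ind => [_|a b IHa IHb ys|a u v uv]; first by rewrite cmul0x; apply: span0.
  by rewrite cmulDl; apply: spanD; [apply: IHa|apply: IHb].
elim/span_ind => [|b c IHb IHc|b w t wt]; first by rewrite cmulx0; apply: span0.
  by rewrite cmulDr; apply: spanD.
by rewrite cmulZl cmulZr; apply/spanZ/spanZ/spanM_gen.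
Qed.

Definition approx (P : B -> Prop) x := forall e : R, 0 < e -> exists2 y, P y & nm (x - y) <= e.

Lemma approx_self (P : B -> Prop) x : P x -> approx P x.
Proof. by move=> Px e e0; exists x => //; rewrite subrr nm0 ltW. Qed.

Lemma approxD x y : approx span x -> approx span y -> approx span (x + y).
Proof.
move=> xs ys e e0; have e2 : 0 < e / 2 by rewrite divr_gt0.
have [x' x's xx'] := xs _ e2; have [y' y's yy'] := ys _ e2.
exists (x' + y'); first exact: spanD.
by rewrite opprD addrACA (splitr e); apply: le_trans (nmD _ _) (lerD xx' yy').
Qed.

Lemma approxZ a x : approx span x -> approx span (a *: x).
Proof.
move=> xs e e0; have a0 : 0 <= Normc.normc a by case: (a) => p q; apply: sqrtr_ge0.
have d0 : 0 < e / (Normc.normc a + 1) by rewrite divr_gt0 // ltr_wpDl.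
have [y ys xy] := xs _ d0; exists (a *: y); first exact: spanZ.
rewrite -scalerBr nmZ; apply: le_trans (ler_wpM2l a0 xy) _.
by rewrite mulrA ler_pdivrMr ?ltr_wpDl // mulrC ler_pM2l // lerDl.
Qed.

Lemma approxM x y : approx span x -> approx span y -> approx span (x '** y).
Proof.
move=> xs ys e e0; have x0 := nm_ge0 x; have y0 := nm_ge0 y.
pose d := Num.min 1 (e / (nm x + nm y + 2)).
have d0 : 0 < d by rewrite lt_min ltr01 divr_gt0 //; lra.
have [x' x's xx'] := xs _ d0; have [y' y's yy'] := ys _ d0.
exists (x' '** y'); first exact: spanM.
have -> : x '** y - x' '** y' = (x - x') '** y + x' '** (y - y').
  by rewrite cmulBl cmulBr addrA subrK.
have x'1 : nm x' <= nm x + 1.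
  rewrite -[x'](subKr x) -opprB nmN; apply: le_trans (nmD _ _) _; rewrite nmN addrC lerD2l.
  by apply: le_trans xx' _; rewrite ge_min lexx.
apply: le_trans (nmD _ _) _.
have h1 := nmM (x - x') y; have h2 := nmM x' (y - y').
have h3 := ler_wpM2r y0 xx'.
have h4 := ler_pM (nm_ge0 x') (nm_ge0 (y - y')) x'1 yy'.
have : d * (nm x + nm y + 2) <= e.
  by rewrite -ler_pdivlMr ?ge_min ?lexx ?orbT //; lra.
have := ltW d0; lra.
Qed.

Lemma approxS x : approx span x -> approx span (x '^*).
Proof.
move=> xs e /xs[y ys xy]; exists (y '^*); first exact: spanS.
by rewrite -cstarB nm_star.
Qed.

Lemma approx_closed (P : B -> Prop) : closed_prop (approx P).
Proof.
move=> l H e e0; have e2 : 0 < e / 2 by rewrite divr_gt0.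
have [x xs xl] := H _ e2; have [y ys xy] := xs _ e2.
exists y => //; rewrite -(subrK x l) -addrA (splitr e).
by apply: le_trans (nmD _ _) (lerD _ xy); rewrite nmB.
Qed.

Definition span_closure : subcstar B :=
  SubCstar (approx_self span0) approxD approxZ approxM approxS (@approx_closed span).

Lemma relations_intro (E : cstarAlgType R) (t : W -> W -> E) :
  (forall u v, dterm u = dterm v -> (t u v) '^* = t v u) ->
  (forall u v w, dterm u = dterm v -> dterm v = dterm w -> t u v '** t v w = t u w) ->
  (forall u v, dterm u = dterm v -> forall j : 'I_r,
    t u v = \sum_(w : word_of M (unit_shape j) | worigin (mkword w) == dterm u)
              t (dprod u (mkword w)) (dprod v (mkword w))) ->
  (forall u v, dshape u = 0 -> dshape v = 0 -> u <> v -> t u u '** t v v = 0) ->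
  relations t.
Proof.
by move=> ts tm tsum torth; split => // u v uv; rewrite /partial_isometry ts // !tm.
Qed.

End Span.

(** * Density of the span and the gauge action *)

Section Universal.
Variables (r : nat) (A : finType) (M : 'I_r -> A -> A -> nat).
Hypothesis adm : admissible M.
Variables (D : countType) (delta : D -> A).
Local Notation W := (decorated M delta).
Variables (R : realType) (B : cstarAlgType R) (s : W -> W -> B).
Hypothesis univ : is_universal_algebra s.

Let rel : relations s := univ.1.

Lemma star_morphism_comp (E F : cstarAlgType R) (f : B -> E) (g : E -> F) :
  star_morphism f -> star_morphism g -> star_morphism (g \o f).
Proof.
move=> [fl fm fs] [gl gm gs]; split => [a x y|x y|x] /=.
- by rewrite fl gl.
- by rewrite fm gm.
- by rewrite fs gs.
Qed.

(** The universal map into the closure of the span, followed by the inclusion,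
    fixes the generators.  By uniqueness it is the identity. *)
Lemma span_dense x : approx (span s) x.
Proof.
pose S := span_closure adm rel; pose T := subcstarAlg S.
have sS u v : dterm u = dterm v -> carrier S (s u v).
  by move=> uv; apply/approx_self/span_s.
pose t u v : T := match pselect (dterm u = dterm v) with
                  | left uv => sub_mk (sS u v uv) | right _ => 0 end.
have tE u v : dterm u = dterm v -> sub_val (t u v) = s u v.
  by rewrite /t; case: pselect.
have vm := @sub_val_morphism R B S.
have trel : relations t.
  apply: relations_intro.
  - by move=> u v uv; apply: sub_val_inj; rewrite (morS vm) !tE // (s_star rel).
  - move=> u v w uv vw; apply: sub_val_inj.
    by rewrite (morM vm) !tE ?uv ?(s_mul rel) // uv.
  - move=> u v uv j; apply: sub_val_inj; rewrite (mor_sum vm) tE // (rel_sum rel uv j).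
    by apply: eq_bigr => w /eqP wo; rewrite tE // !dtermM -?uv.
  move=> u v u0 v0 uv; apply: sub_val_inj.
  by rewrite (morM vm) !tE // (rel_orth rel) // (mor0 vm).
have [f [[fm fE] _]] := univ.2 T t trel.
have [g [gE gu]] := univ.2 B s rel.
have id_g : @id B = g by apply/esym/gu; split.
have vf_g : @sub_val R B S \o f = g.
  apply/esym/gu; split; first exact: star_morphism_comp.
  by move=> u v uv /=; rewrite fE // tE.
have : x = sub_val (f x) by rewrite -[LHS]/(@id B x) id_g -vf_g.
by move=> ->; apply: (sub_valP (f x : subcstar_sort S)).
Qed.

Section Gauge.
Variable z : 'I_r -> R[i].
Hypothesis z1 : forall i, z i * conjc (z i) = 1.

(** The character z^m of the torus; on the generator s u v the gauge automorphism
    acts by z^(shape u - shape v), which is [gcoef] since the z i are unimodular. *)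
Definition gchar (m : mshape r) : R[i] := \prod_i z i ^+ m i.
Lemma gcharD m n : gchar (m + n) = gchar m * gchar n.
Proof. by rewrite -big_split; apply: eq_bigr => i _; rewrite shapeD exprD. Qed.
Lemma gcharK m : gchar m * conjc (gchar m) = 1.
Proof.
rewrite rmorph_prod -big_split big1 //= => i _.
by rewrite rmorphXn -exprMn z1 expr1n.
Qed.
Lemma gcharK' m : conjc (gchar m) * gchar m = 1. Proof. by rewrite mulrC gcharK. Qed.

Definition gcoef (u v : W) : R[i] := gchar (dshape u) * conjc (gchar (dshape v)).

Lemma gauge_relations : relations (fun u v : W => gcoef u v *: s u v).
Proof.
apply: relations_intro.
- move=> u v uv; rewrite cstarZ (s_star rel) // /gcoef rmorphM /= conjcK.
  by rewrite mulrC.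
- move=> u v w uv vw; rewrite cmulZl cmulZr scalerA (s_mul rel) //; congr (_ *: _).
  by rewrite /gcoef mulrA -[X in X * _ = _]mulrA gcharK' mulr1.
- move=> u v uv j; rewrite (rel_sum rel uv j) scaler_sumr; apply: eq_bigr => w /eqP wo.
  congr (_ *: _); rewrite /gcoef !dshapeM -?uv // !gcharD rmorphM /= mulrACA.
  by rewrite gcharK mulr1.
move=> u v u0 v0 uv; rewrite cmulZl cmulZr (rel_orth rel) // !scaler0 //.
Qed.

Lemma gauge_ex : exists f : B -> B, star_morphism f /\
  forall u v, dterm u = dterm v -> f (s u v) = gcoef u v *: s u v.
Proof. by have [f [? _]] := univ.2 B _ gauge_relations; exists f. Qed.

End Gauge.
End Universal.

(** * Cutting down to an infinite projection *)

Section CutDown.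
Variables (R : realType) (B : cstarAlgType R).
Implicit Types (h x y q b c p : B).

Lemma nm_proj q : projection q -> nm q <= 1.
Proof.
move=> [qs qq]; have := nm_starM q; rewrite qs qq expr2 => E.
have [->|q0] := eqVneq (nm q) 0; first by [].
have q_gt0 : 0 < nm q by rewrite lt_def q0 nm_ge0.
by rewrite -(ler_pM2r q_gt0) mul1r -E.
Qed.

(** With q as unit, 1 - b is the square root of a and c = (1 - b)^(-1) solves
    c = 1 + b c. *)
Lemma corner_invsqrt q a : projection q -> a '^* = a -> q '** a = a ->
  nm (q - a) <= 2^-1 -> exists c, [/\ c '^* = c, q '** c = c & c '** a '** c = q].
Proof.
move=> qp as_ qa qa2; have [qs qq] := qp.
have aq : a '** q = a by rewrite -as_ -{1}qs -cstarM qa.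
pose e := q - a.
have es : e '^* = e by rewrite cstarB qs as_.
have qe : q '** e = e by rewrite cmulBr qq qa.
have [|||b [bs b2 be qb0]] := @sqrt_1sub _ _ e (fun x => q '** x - x = 0) es qa2.
- exact: closed_mull.
- by rewrite cmulx0 subrr.
- move=> x /eqP; rewrite subr_eq0 => /eqP qx.
  by rewrite cmulZr cmulDr qe cmulA qx subrr.
have qb : q '** b = b by apply/eqP; rewrite -subr_eq0 qb0.
have bq : b '** q = b by rewrite -bs -{1}qs -cstarM qb.
have aE : a = (q - b) '** (q - b).
  have : e = b + b - b '** b.
    by move: be; rewrite sqr_1sub => /addrI/oppr_inj/inU_inj.
  rewrite cmulBl !cmulBr qq qb bq => E.
  by rewrite -[a](subKr q) -/e E !opprB opprD !addrA [RHS](ACl (1*2*4*3)) /= addrAC [RHS](ACl (1*3*4*2)).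
pose T x := q + b '** x.
pose P x := (q '** x - x = 0 /\ b '** x - x '** b = 0) /\ x '^* - x = 0.
have r0 : (0 : R) <= 2 by [].
have q1 := nm_proj qp.
have [|||||c [Tc _ [[qc0 bc0] cs0]]] := @fixed_point _ _ T 2 P r0.
- move=> x x2; apply: le_trans (nmD _ _) _; have := nmM b x.
  have : nm b * nm x <= 2^-1 * 2 by rewrite ler_pM ?nm_ge0.
  lra.
- move=> x y _ _; rewrite /T opprD addrACA subrr add0r -cmulBr.
  by apply: le_trans (nmM _ _) _; rewrite ler_wpM2r ?nm_ge0.
- by apply: closed_and (@closed_star _ _); apply: closed_and; [exact: closed_mull|exact: closed_comm].
- by split; [split|]; rewrite ?cmulx0 ?cmul0x ?cstar0 subrr.
- move=> x [[/subr0_eq qx /subr0_eq bx] /subr0_eq xs].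
  split; [split|]; rewrite /T.
  + by rewrite cmulDr qq cmulA qb subrr.
  + by rewrite cmulDr cmulDl bq qb -cmulA -bx cmulA subrr.
  by rewrite cstarD cstarM xs bs qs bx subrr.
move: qc0 bc0 cs0 => /subr0_eq qc /subr0_eq bc /subr0_eq cs.
exists c; split => //.
have cqb : c '** (q - b) = q.
  have cq : c '** q = c by rewrite -cs -{1}qs -cstarM qc.
  by rewrite cmulBr cq -bc -{1}Tc /T addrK.
have qbc : (q - b) '** c = q by rewrite cmulBl qc -{1}Tc /T addrK.
by rewrite aE cmulA cqb -cmulA qbc qq.
Qed.

(** If c is the inverse square root of y^* h^2 y in the corner of q, then
    v = h y c has v^* v = q, and v v^* belongs to h B h.  Conjugation by v carries
    a proper subprojection equivalent to q to one of v v^* . *)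
Lemma cutdown h q y : h '^* = h -> infinite_projection q -> y '** q = y ->
  nm (q - y '^* '** (h '** h) '** y) <= 2^-1 ->
  exists p, hereditary h p /\ infinite_projection p.
Proof.
move=> hs [qp [q' [[[q's q'q'] qq' q'q] [w [ww wws]]]]] yq near.
have [qs qq] := qp; pose a := y '^* '** (h '** h) '** y.
have as_ : a '^* = a by rewrite /a !cstarM hs cstarK !cmulA.
have qys : q '** y '^* = y '^* by rewrite -{1}qs -cstarM yq.
have qa : q '** a = a by rewrite /a !cmulA qys.
have [c [cs qc cac]] := corner_invsqrt qp as_ qa near.
pose v := h '** y '** c.
have vv : v '^* '** v = q.
  by rewrite /v !cstarM hs -cac /a cs !cmulA.
have cq : c '** q = c by rewrite -cs -{1}qs -cstarM qc.
have vq : v '** q = v by rewrite /v -cmulA cq.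
have qw : q '** w = w.
  apply/eqP; rewrite eq_sym -subr_eq0; apply/eqP/nm_eq0/eqP.
  rewrite -sqrf_eq0 -nm_star -nm_starM cstarK cstarB cstarM qs.
  rewrite cmulBl !cmulBr -!cmulA [w '** (w '^* '** q)]cmulA [w '** w '^*]wws cmulA.
  by rewrite qq' subrr nm0.
have wq : w '** q = w.
  apply/eqP; rewrite eq_sym -subr_eq0; apply/eqP/nm_eq0/eqP.
  rewrite -sqrf_eq0 -nm_starM cstarB cstarM qs.
  rewrite cmulBl !cmulBr !cmulA ww -!cmulA [w '^* '** (w '** q)]cmulA ww !qq.
  by rewrite !subrr nm0.
have vsv z : v '^* '** (v '** z) = q '** z by rewrite cmulA vv.
have vE : v = h '** y '** c by [].
clearbody v.
have vqv : v '** v '^* '** v = v by rewrite -cmulA vv vq.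
pose p := v '** v '^*.
exists p; split.
  apply: subset_closure; exists (y '** c '** c '** y '^*) => //.
  by rewrite /p vE !cstarM hs cs !cmulA.
split; first by split; [rewrite /p cstarM cstarK|rewrite /p cmulA vqv].
pose p' := v '** q' '** v '^*.
exists p'; split; [split|].
- split; first by rewrite /p' !cstarM cstarK q's cmulA.
  by rewrite /p' -!cmulA vsv [q '** _]cmulA qq' [q' '** (q' '** _)]cmulA q'q'.
- by rewrite /p /p' !cmulA vqv.
- move=> E; apply: q'q.
  have := congr1 (fun z => v '^* '** z '** v) E.
  rewrite /p /p' -!cmulA !vsv vv !qq cmulA qq'.
  have q'q0 : q' '** q = q' by rewrite -q's -{1}qs -cstarM qq'.
  by rewrite q'q0 => ->.
exists (v '** w '** v '^*); rewrite /p /p'; split.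
  rewrite !cstarM cstarK -!cmulA vsv [q '** _]cmulA qw [w '^* '** (w '** _)]cmulA ww.
  by rewrite cmulA vq.
rewrite !cstarM cstarK -!cmulA vsv [q '** _]cmulA.
have qws : q '** w '^* = w '^* by rewrite -{1}qs -cstarM wq.
by rewrite qws [w '** (w '^* '** _)]cmulA wws.
Qed.

End CutDown.

(** * Averages over the gauge action *)

Section Averages.
Variables (r : nat) (A : finType) (M : 'I_r -> A -> A -> nat).
Hypothesis adm : admissible M.
Variables (D : countType) (delta : D -> A).
Local Notation W := (decorated M delta).
Variables (R : realType) (B : cstarAlgType R) (s : W -> W -> B).
Hypothesis univ : is_universal_algebra s.
Local Notation normc := (@Normc.normc R).

Let rel : relations s := univ.1.

Definition is_gauge (z : 'I_r -> R[i]) (f : B -> B) := star_morphism f /\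
  forall u v : W, dterm u = dterm v -> f (s u v) = gcoef z u v *: s u v.

Lemma normc_ge0 (a : R[i]) : 0 <= normc a.
Proof. by case: a => p q; apply: sqrtr_ge0. Qed.

Lemma normcX (a : R[i]) n : normc (a ^+ n) = normc a ^+ n.
Proof. by elim: n => [|n IH]; [exact: Normc.normc1|rewrite !exprS Normc.normcM IH]. Qed.

Lemma normc_conj (a : R[i]) : normc (conjc a) = normc a.
Proof. by case: a => p q /=; rewrite sqrrN. Qed.

Lemma near_mul (a b : R[i]) : normc a = 1 ->
  normc (a * b - 1) <= normc (a - 1) + normc (b - 1).
Proof.
move=> a1; have -> : a * b - 1 = (a - 1) + a * (b - 1) by ring.
by apply: le_trans (le_normcD _ _) _; rewrite Normc.normcM a1 mul1r.
Qed.

Lemma near_exp (a : R[i]) (d : R) n : normc a = 1 -> normc (a - 1) <= d ->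
  normc (a ^+ n - 1) <= n%:R * d.
Proof.
move=> a1 ad; elim: n => [|n IH]; first by rewrite subrr Normc.normc0 mul0r.
rewrite exprS; apply: le_trans (near_mul _ a1) _.
by rewrite -natr1 mulrDl mul1r addrC lerD.
Qed.

Lemma near_gchar z (d : R) (m : mshape r) :
  (forall i, normc (z i) = 1) -> (forall i, normc (z i - 1) <= d) ->
  normc (gchar z m - 1) <= (\sum_i m i)%:R * d /\ normc (gchar z m) = 1.
Proof.
move=> z1 zd; rewrite /gchar.
elim/big_rec2: _ => [|i a x _ [IH1 IH2]]; first by rewrite subrr Normc.normc0 mul0r Normc.normc1.
have zi1 : normc (z i ^+ m i) = 1 by rewrite normcX z1 expr1n.
split; last by rewrite Normc.normcM zi1 IH2 mulr1.
apply: le_trans (near_mul _ zi1) _; rewrite natrD mulrDl lerD //.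
exact: near_exp.
Qed.

Lemma near_gcoef z (d : R) (u v : W) :
  (forall i, normc (z i) = 1) -> (forall i, normc (z i - 1) <= d) ->
  normc (gcoef z u v - 1) <= (\sum_i dshape u i + \sum_i dshape v i)%:R * d.
Proof.
move=> z1 zd; have [ud u1] := near_gchar (dshape u) z1 zd.
have [vd v1] := near_gchar (dshape v) z1 zd.
apply: le_trans (near_mul _ u1) _; rewrite natrD mulrDl lerD //.
by rewrite -(rmorph1 (@conjc R)) -rmorphB /= normc_conj.
Qed.

(** Clear on generators, hence on their span; and gauge automorphisms are
    uniformly bounded, so that the approximation by the span does no harm. *)
Lemma gauge_cont x (e : R) : 0 < e -> exists2 d : R, 0 < d & forall z f,
  (forall i, normc (z i) = 1) -> (forall i, normc (z i - 1) <= d) -> is_gauge z f ->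
  nm (f x - x) <= e.
Proof.
pose P x := forall e : R, 0 < e -> exists2 d : R, 0 < d & forall z f,
  (forall i, normc (z i) = 1) -> (forall i, normc (z i - 1) <= d) -> is_gauge z f ->
  nm (f x - x) <= e.
suff {e} Pspan : forall y, span s y -> P y.
  move=> e0; have e6 : 0 < e / 6 by rewrite divr_gt0.
  have [y /Pspan ys xy] := span_dense adm univ x e6.
  have [d d0 dP] := ys _ e6; exists d => // z f z1 zd fz.
  have -> : f x - x = f (x - y) + (f y - y) + - (x - y).
    by rewrite (morB fz.1) addrA subrK opprB addrA subrK.
  apply: le_trans (nmD _ _) _; have := nmD (f (x - y)) (f y - y).
  by have := mor_bounded fz.1 (x - y); have := dP z f z1 zd fz; rewrite nmN; lra.
move=> y; elim/span_ind => {y} [|y y' IH IH'|a u v uv] e e0.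
- exists 1 => // z f _ _ fz; rewrite (mor0 fz.1) subrr nm0; exact: ltW.
- have e2 : 0 < e / 2 by rewrite divr_gt0.
  have [d d0 dP] := IH _ e2; have [d' d0' dP'] := IH' _ e2.
  exists (Num.min d d') => [|z f z1 zd fz]; first by rewrite lt_min d0.
  rewrite (morD fz.1) opprD addrACA; apply: le_trans (nmD _ _) _.
  rewrite (splitr e) lerD //.
    by apply: dP fz => // i; apply: le_trans (zd i) _; rewrite ge_min lexx.
  by apply: dP' fz => // i; apply: le_trans (zd i) _; rewrite ge_min lexx orbT.
pose N : R := (\sum_i dshape u i + \sum_i dshape v i)%:R.
(* The displacement of a s u v is at most C times the distance of the z i to 1. *)
pose C := normc a * nm (s u v) * N.
have C0 : 0 <= C by rewrite !mulr_ge0 ?normc_ge0 ?nm_ge0.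
exists (e / (C + 1)); first by rewrite divr_gt0 // ltr_wpDl.
move=> z f z1 zd fz.
rewrite (morZ fz.1) fz.2 // -[X in _ - _ *: X]scale1r -scalerBr -scalerBl !nmZ.
have := near_gcoef u v z1 zd; rewrite -/N => gN.
apply: (@le_trans _ _ (C * (e / (C + 1)))).
  move: gN; set t := e / _ => gN.
  have -> : C * t = normc a * (N * t * nm (s u v)) by rewrite /C; ring.
  by rewrite ler_wpM2l ?normc_ge0 // ler_wpM2r ?nm_ge0.
by rewrite mulrA ler_pdivrMr ?ltr_wpDl // mulrC ler_pM2l // lerDl.
Qed.

Section Roots.
Variable n : nat.
Hypothesis n0 : (0 < n)%N.

Definition rootz (l : {ffun 'I_r -> 'I_n}) (i : 'I_r) : R[i] := uroot R n ^+ l i.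

Lemma normc_rootz l i : normc (rootz l i) = 1.
Proof. exact: normc_uroot. Qed.

Lemma conj_uroot k : conjc (uroot R n ^+ k) = (uroot R n ^+ k) ^+ n.-1.
Proof.
rewrite rmorphXn exprAC; congr (_ ^+ _).
have u1 : uroot R n * conjc (uroot R n) = 1.
  apply/eqP; rewrite eq_complex /= mulrN opprK -!expr2 cos2Dsin2 eqxx /=.
  by rewrite mulrN [sin _ * _]mulrC addNr.
have un : uroot R n * uroot R n ^+ n.-1 = 1 by rewrite -exprS prednK // urootX.
by rewrite -[LHS]mul1r -un [_ * _ ^+ _]mulrC -mulrA u1 mulr1.
Qed.

Lemma rootz1 l i : rootz l i * conjc (rootz l i) = 1.
Proof. by rewrite /rootz conj_uroot -exprS prednK // exprAC urootX // expr1n. Qed.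

(** The sum factors into one geometric sum for each coordinate, which vanishes
    unless the exponents agree modulo n; both are less than n. *)
Lemma sum_gcoef (u v : W) :
  (forall i, (dshape u i < n)%N) -> (forall i, (dshape v i < n)%N) ->
  \sum_l gcoef (rootz l) u v = if dshape u == dshape v then (n ^ r)%:R else 0.
Proof.
move=> un vn.
have E l : gcoef (rootz l) u v =
    \prod_i (uroot R n ^+ l i) ^+ (dshape u i + n.-1 * dshape v i)%N.
  rewrite /gcoef /gchar rmorph_prod -big_split; apply: eq_bigr => i _ /=.
  by rewrite rmorphXn /= conj_uroot exprD exprM.
under eq_bigr do rewrite E.
rewrite -(bigA_distr_bigA (fun i (j : 'I_n) => (uroot R n ^+ j) ^+ (dshape u i + n.-1 * dshape v i))).
under eq_bigr do rewrite uroot_sum //.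
have dv i : (n %| dshape u i + n.-1 * dshape v i)%N = (dshape u i == dshape v i).
  move: (un i) (vn i); move: (dshape u i) (dshape v i) => a b an bn.
  have nb : (n.-1 * b + b = n * b)%N by rewrite -mulSnr prednK.
  apply/dvdnP/eqP => [[k kE]|->]; last by exists b; rewrite addnC nb mulnC.
  have : (b * n + a = k * n + b)%N by rewrite -kE -addnA nb addnC mulnC.
  by move=> /(congr1 (modn^~ n)); rewrite !modnMDl !modn_small.
case: eqVneq => [uv|/eqP uv].
  rewrite (eq_bigr (fun=> n%:R)) => [|i _]; last by rewrite dv uv eqxx.
  by rewrite prodr_const card_ord natrX.
have [i iuv] : exists i, dshape u i != dshape v i.
  have [/existsP//|/existsPn H] := boolP [exists i, dshape u i != dshape v i].
  case: uv; apply/ffunP => i.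
  by have := H i; rewrite negbK => /eqP.
by rewrite (bigD1 i) //= dv (negPf iuv) mul0r.
Qed.

(** For n larger than all shapes involved the average is exactly the part of
    degree 0. *)
Lemma average_lsum L (f : {ffun 'I_r -> 'I_n} -> B -> B) :
  (forall l, is_gauge (rootz l) (f l)) -> good L ->
  (forall q, q \in L -> forall i, (dshape q.2.1 i < n)%N /\ (dshape q.2.2 i < n)%N) ->
  \sum_l f l (lsum s L) =
  (n ^ r)%:R *: lsum s [seq q <- L | dshape q.2.1 == dshape q.2.2].
Proof.
move=> fg; rewrite /lsum; elim: L => [_ _|q L IH /andP[/eqP qg Lg] Ln].
  rewrite !big_nil scaler0 big1 // => l _; exact: mor0 (fg l).1.
have [q1 q2] : (forall i, (dshape q.2.1 i < n)%N) /\ (forall i, (dshape q.2.2 i < n)%N).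
  by split => i; have [] := Ln q (mem_head _ _) i.
under eq_bigr => l _.
  rewrite big_cons (morD (fg l).1) (morZ (fg l).1) (fg l).2 // scalerA mulrC -scalerA.
  over.
rewrite big_split /= IH //; last by move=> p pL; apply: Ln; rewrite inE pL orbT.
rewrite -scaler_suml sum_gcoef //=.
case: ifP => _; last by rewrite scale0r add0r.
by rewrite big_cons scalerDr.
Qed.

End Roots.


(** The roots indexed below q in every coordinate are a fraction L^(-r) of all,
    whatever q, and their automorphisms hardly move h if L is large.  The other
    terms are positive, so that [nm_sum_star_le] bounds the full sum from below. *)
Lemma average_lower h : h <> 0 -> exists (c : R) (L : nat), [/\ 0 < c, (0 < L)%N &
  forall q, (0 < q)%N -> forall f : {ffun 'I_r -> 'I_(L * q)} -> B -> B,
  (forall l, is_gauge (rootz l) (f l)) ->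
  c * ((L * q) ^ r)%:R <= nm (\sum_l (f l h) '^* '** f l h)].
Proof.
move=> h0; have H0 : 0 < nm h.
  by rewrite lt_def nm_ge0 andbT; apply/eqP => /nm_eq0.
have e0 : 0 < nm h / 8 by rewrite divr_gt0.
have [d d0 near] := gauge_cont h e0.
have [L L0 rootL] := @uroot_near1 R d d0.
exists (nm h ^+ 2 / 16 / (L ^ r)%:R), L; split => //.
  by rewrite !divr_gt0 ?exprn_gt0 // ltr0n expn_gt0 L0.
move=> q q0 f fg; set n := (L * q)%N in f fg *.
have qn : (q <= n)%N by rewrite leq_pmull.
pose S := [pred l : {ffun 'I_r -> 'I_n} | [forall i, (l i < q)%N]].
have nearS l : S l -> nm (f l h - h) <= nm h / 8.
  move=> /forallP Sl; apply: near (fg l) => i; first exact: normc_rootz.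
  exact: rootL.
have cardS : #|S| = (q ^ r)%N.
  pose Q := [pred j : 'I_n | (j < q)%N].
  have cardQ : #|Q| = q.
    by rewrite -sum1_card (big_ord_narrow qn) sum1_card card_ord.
  rewrite -cardQ -[in RHS](card_ord r) -card_ffun_on; apply: eq_card => l.
  by apply/forallP/ffun_onP => H i; have := H i.
have nearS2 l : S l -> nm ((f l h) '^* '** f l h - h '^* '** h) <= nm h ^+ 2 / 2.
  move=> /nearS hl.
  have -> : (f l h) '^* '** f l h - h '^* '** h =
     (f l h) '^* '** (f l h - h) + (f l h - h) '^* '** h.
    by rewrite cmulBr cstarB cmulBl addrA subrK.
  apply: le_trans (nmD _ _) _.
  have h1 := nmM ((f l h) '^*) (f l h - h); have h2 := nmM ((f l h - h) '^*) h.
  rewrite !nm_star in h1 h2.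
  have fl : nm (f l h) <= nm h + nm h / 8.
    by rewrite -[f l h](subrK h) addrC; apply: le_trans (nmD _ _) _; rewrite lerD2l.
  have h3 := ler_pM (nm_ge0 _) (nm_ge0 _) fl hl.
  have h4 := ler_wpM2r (ltW H0) hl.
  by move: h1 h2 h3 h4; rewrite expr2; have := mulr_gt0 H0 H0; lra.
have low : (q ^ r)%:R * (nm h ^+ 2 / 2) <= nm (\sum_(l | S l) (f l h) '^* '** f l h).
  have -> : \sum_(l | S l) (f l h) '^* '** f l h =
      (q ^ r)%:R%:C *: (h '^* '** h) - \sum_(l | S l) (h '^* '** h - (f l h) '^* '** f l h).
    rewrite big_split /= sumrN opprD opprK sumr_const cardS addrA.
    by rewrite rmorph_nat scaler_nat subrr add0r.
  have tri (x y : B) : nm x - nm y <= nm (x - y).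
    by rewrite lerBlDr -{1}(subrK y x) nmD.
  apply: le_trans (tri _ _); rewrite nmZr nm_starM ger0_norm //.
  have : nm (\sum_(l | S l) (h '^* '** h - (f l h) '^* '** f l h)) <= (q ^ r)%:R * (nm h ^+ 2 / 2).
    apply: le_trans (nm_sum _ _ _) _; rewrite -cardS mulr_natl -sumr_const.
    by apply: ler_sum => l /nearS2; rewrite nmB.
  lra.
have up := nm_sum_star_le (enum S) (fun l => f l h) (enum [predC S]) (fun l => f l h).
rewrite !big_enum /= in up.
have {}up : nm (\sum_(l | S l) (f l h) '^* '** f l h) <= 8 * nm (\sum_l (f l h) '^* '** f l h).
  by rewrite [X in _ <= 8 * nm X](bigID S).
have Lr : 0 < (L ^ r)%:R :> R by rewrite ltr0n expn_gt0 L0.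
rewrite /n expnMn natrM mulrA divfK ?gt_eqF //.
have := le_trans low up; lra.
Qed.

End Averages.

(** * The core *)

Section Core.
Variables (r : nat) (A : finType) (M : 'I_r -> A -> A -> nat).
Hypothesis adm : admissible M.
Variables (D : countType) (delta : D -> A).
Local Notation W := (decorated M delta).
Variables (R : realType) (B : cstarAlgType R) (s : W -> W -> B).
Hypothesis rel : relations s.
Hypothesis s_nz : forall u, s u u <> 0.
Variable m : mshape r.
Implicit Types (u v w : W) (x y : B).
Local Notation p u := (s u u).

(** The span of the matrix units of shape m; [col v] below is its column of v,
    a space of vectors on which the core acts and whose inner products are
    multiples of the projection of v. *)
Inductive core : B -> Prop :=
| core0 : core 0
| coreD x y : core x -> core y -> core (x + y)
| coreZ (a : R[i]) u v : dshape u = m -> dshape v = m -> dterm u = dterm v ->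
    core (a *: s u v).

Inductive col v : B -> Prop :=
| col0 : col v 0
| colD x y : col v x -> col v y -> col v (x + y)
| colZ (a : R[i]) w : dshape w = m -> dterm w = dterm v -> col v (a *: s w v).

Lemma core_sum (I : Type) (e : seq I) (P : pred I) (F : I -> B) :
  (forall i, P i -> core (F i)) -> core (\sum_(i <- e | P i) F i).
Proof. by move=> PF; elim/big_ind: _ => //; [exact: core0|exact: coreD]. Qed.

Lemma col_scale v (a : R[i]) x : col v x -> col v (a *: x).
Proof.
elim=> [|y z _ IHy _ IHz|b w wm wv]; first by rewrite scaler0; apply: col0.
  by rewrite scalerDr; apply: colD.
by rewrite scalerA; apply: colZ.
Qed.

Lemma col_proj v : dshape v = m -> col v (p v).
Proof. by move=> vm; rewrite -[p v]scale1r; apply: colZ. Qed.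

Lemma core_col x v y : core x -> dshape v = m -> col v y -> col v (x '** y).
Proof.
move=> xc vm; elim=> [|y1 y2 _ IH1 _ IH2|b w wm wv]; first by rewrite cmulx0; apply: col0.
  by rewrite cmulDr; apply: colD.
rewrite cmulZr; apply: col_scale; elim: xc => [|x1 x2 _ IH1 _ IH2|a u u' um um' uu'].
- by rewrite cmul0x; apply: col0.
- by rewrite cmulDl; apply: colD.
rewrite cmulZl (s_mul_same adm rel) ?um' ?wm //; case: eqP => [E|_].
  by apply: colZ; rewrite // uu' E.
by rewrite scaler0; apply: col0.
Qed.

Lemma col_inner v x y : dshape v = m -> col v x -> col v y ->
  exists a : R[i], x '^* '** y = a *: p v.
Proof.
move=> vm xc yc; elim: xc => [|x1 x2 _ [a1 IH1] _ [a2 IH2]|a w wm wv].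
- by exists 0; rewrite cstar0 cmul0x scale0r.
- by exists (a1 + a2); rewrite cstarD cmulDl IH1 IH2 scalerDl.
elim: yc => [|y1 y2 _ [a1 IH1] _ [a2 IH2]|b w' wm' wv'].
- by exists 0; rewrite cmulx0 scale0r.
- by exists (a1 + a2); rewrite cmulDr IH1 IH2 scalerDl.
rewrite cstarZ cmulZl cmulZr (s_star rel) // (s_mul_same adm rel) ?wm ?wm' //.
case: ifP => _; first by exists (conjc a * b); rewrite scalerA.
by exists 0; rewrite !scaler0 scale0r.
Qed.

(** Only finitely many columns are nonzero; allowing any larger V' makes the
    property stable under sums. *)
Lemma core_support x : core x -> exists V : seq W, (forall v, v \in V -> dshape v = m) /\
  forall V', uniq V' -> {subset V <= V'} -> (forall v, v \in V' -> dshape v = m) ->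
  x = \sum_(v <- V') x '** p v.
Proof.
elim=> [|y z _ [V [Vm Vy]] _ [U [Um Uz]]|a u u' um um' uu'].
- by exists [::]; split=> // V' _ _ _; rewrite big1 // => v _; rewrite cmul0x.
- exists (V ++ U); split=> [v|V' V'u VV' V'm]; first by rewrite mem_cat => /orP[/Vm|/Um].
  under eq_bigr do rewrite cmulDl.
  rewrite big_split /= -Vy -?Uz // => v vV; apply: VV'; rewrite mem_cat vV ?orbT //.
exists [:: u']; split=> [v|V' V'u VV' V'm]; first by rewrite inE => /eqP ->.
have u'V : u' \in V' by apply: VV'; rewrite mem_head.
rewrite (bigD1_seq u') //= cmulZl (s_mul rel) // big1_seq ?addr0 //.
move=> v /andP[vu' vV]; rewrite cmulZl (s_mul_same adm rel) ?um' ?V'm //.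
by rewrite eq_sym (negPf vu') scaler0.
Qed.

(** The bound on columns bounds the powers of x by a fixed multiple of those of l,
    the multiple being given by the finitely many nonzero columns of x. *)
Lemma core_norm_le x (l : R) : core x -> x '^* = x -> 0 < l ->
  (forall v y, dshape v = m -> col v y -> nm (x '** y) <= l * nm y) -> nm x <= l.
Proof.
move=> xc xs l0 xl.
have [V [Vm VE]] := core_support xc.
have xE : x = \sum_(v <- undup V) x '** p v.
  by apply: VE (undup_uniq V) _ _ => v; rewrite mem_undup //; apply: Vm.
pose C := \sum_(v <- undup V) nm (x '** p v).
have C0 : 0 <= C by apply: sumr_ge0 => v _; apply: nm_ge0.
have pow n : nm (iter n (fun y => x '** y) x) <= C * l ^+ n.
  have -> : iter n (fun y => x '** y) x =
      \sum_(v <- undup V) iter n (fun y => x '** y) (x '** p v).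
    by elim: n => [|n IH] //=; rewrite IH cmul_sumr.
  apply: le_trans (nm_sum _ _ _) _; rewrite /C mulr_suml big_seq [leRHS]big_seq.
  apply: ler_sum => v; rewrite mem_undup => /Vm vm.
  have : col v (iter n (fun y => x '** y) (x '** p v)) /\
      nm (iter n (fun y => x '** y) (x '** p v)) <= nm (x '** p v) * l ^+ n.
    elim: n => [|n [IH1 IH2]] /=.
      by rewrite mulr1; split => //; apply: core_col => //; apply: col_proj.
    split; first exact: core_col.
    apply: le_trans (xl _ _ vm IH1) _.
    by rewrite exprS mulrCA ler_pM2l.
  by case.
have b : opbd (inU x) l.
  apply: (@opbd_growth _ _ _ _ (1 + C / l)) => //; first by rewrite inU_star xs.
  case=> [|n].
    by apply: opbd_le (@opbd1 R B); rewrite !mulr1 lerDl divr_ge0 // ltW.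
  have -> : inU x ^+ n.+1 = inU (iter n (fun y => x '** y) x).
    by elim: n => [|n IH]; rewrite ?expr1 // exprS IH /= inUM.
  apply: opbd_le (opbd_inU _); apply: le_trans (pow n) _.
  have ln0 : 0 <= l ^+ n by rewrite exprn_ge0 // ltW.
  have -> : (1 + C / l) * n.+2%:R * l ^+ n.+1 = (l + C) * n.+2%:R * l ^+ n.
    by rewrite exprS; field; rewrite gt_eqF.
  rewrite ler_wpM2r // -[C in leLHS]mulr1 ler_pM //; first by rewrite lerDr ltW.
  by rewrite ler1n.
exact: nm_opbd (ltW l0) b.
Qed.

Lemma coef_ge0 v (a : R[i]) (I : Type) (e : seq I) (F : I -> B) :
  a *: p v = \sum_(i <- e) (F i) '^* '** F i -> exists2 t : R, a = t%:C & 0 <= t.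
Proof.
move=> aE.
have as_ : (conjc a - a) *: p v = 0.
  rewrite scalerBl aE -{1}(s_star rel (erefl (dterm v))) -cstarZ aE cstar_sum.
  by apply/eqP; rewrite subr_eq0; apply/eqP/eq_bigr => i _; rewrite cstarM cstarK.
have {}as_ : conjc a = a.
  have := congr1 (@nm R B) as_; rewrite nmZ nm0 => /eqP; rewrite mulf_eq0 => /orP[/eqP|/eqP /nm_eq0 /s_nz //].
  by move=> /Normc.eq0_normc /subr0_eq.
have [t at_] : exists t : R, a = t%:C.
  exists (complex.Re a); apply/eqP; rewrite eq_complex /= eqxx /=.
  by case: (a) as_ => x y /= [/eqP]; rewrite eq_sym -subr_eq0 opprK -mulr2n mulrn_eq0.
exists t => //; rewrite leNgt; apply/negP => t0.
have := @nm_star_le R B ((Num.sqrt (- t))%:C *: p v) _ e F.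
have [ps pp] := s_proj rel v.
rewrite -aE at_ cstarZr ps cmulZl cmulZr scalerA -rmorphM -expr2 pp.
rewrite sqr_sqrtr ?oppr_ge0 ?(ltW t0) // rmorphN scaleNr addNr nm0 mulr0 nmN nmZr.
have n0 : 0 < nm (p v).
  by rewrite lt_def nm_ge0 andbT; apply/eqP => /nm_eq0/s_nz.
by rewrite leNgt mulr_gt0 // normr_gt0 lt_eqF.
Qed.

Lemma nm_coef v x (t : R) : 0 <= t -> x '^* '** x = t%:C *: p v ->
  nm x ^+ 2 = t * nm (p v).
Proof. by move=> t0 xE; rewrite -nm_starM xE nmZr ger0_norm. Qed.

(** Suppose (y, x y) <= l (y, y) for all column vectors y.  The form (y, x y)
    is nonnegative at y - l^(-1) x y, and with the assumption at x y this gives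
    (x y, x y) <= l (y, x y) <= l^2 (y, y).  Hence | x | <= l by
    [core_norm_le], which contradicts l < | x |. *)
Lemma core_vector x (I : Type) (e : seq I) (F : I -> B) (l : R) : core x ->
  x = \sum_(i <- e) (F i) '^* '** F i -> 0 < l < nm x ->
  exists v y (a b : R), [/\ dshape v = m, col v y,
    y '^* '** y = a%:C *: p v, y '^* '** x '** y = b%:C *: p v & 0 < a /\ l * a < b].
Proof.
move=> xc xE /andP[l0 lx].
have xs : x '^* = x.
  by rewrite xE cstar_sum; apply: eq_bigr => i _; rewrite cstarM cstarK.
have sq v y : dshape v = m -> col v y -> exists2 t : R, y '^* '** y = t%:C *: p v & 0 <= t.
  move=> vm yc; have [a aE] := col_inner vm yc yc.
  have [|t tE t0] := @coef_ge0 v a unit [:: tt] (fun=> y); first by rewrite big_seq1 aE.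
  by exists t => //; rewrite aE tE.
have form v y : dshape v = m -> col v y -> exists2 t : R, y '^* '** x '** y = t%:C *: p v & 0 <= t.
  move=> vm yc; have [a aE] := col_inner vm yc (core_col xc vm yc).
  have [|t tE t0] := @coef_ge0 v a I e (fun i => F i '** y).
    rewrite -aE {1}xE cmulA cmul_sumr cmul_suml; apply: eq_bigr => i _.
    by rewrite cstarM !cmulA.
  by exists t => //; rewrite -cmulA aE tE.
apply: contrapT => none; suff : nm x <= l by rewrite leNgt lx.
have le v y a b : dshape v = m -> col v y -> y '^* '** y = a%:C *: p v ->
    0 <= a -> 0 <= b -> y '^* '** x '** y = b%:C *: p v -> b <= l * a.
  move=> vm yc aE a0 b0 bE; rewrite leNgt; apply/negP => ab; apply: none.
  exists v, y, a, b; split => //; split => //; rewrite lt_def a0 andbT.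
  apply/eqP => a00; move: ab; rewrite a00 mulr0 => b1.
  have y0 : y = 0.
    apply/nm_eq0/eqP; rewrite -sqrf_eq0 (nm_coef _ aE) // a00 mul0r //.
  move: bE; rewrite y0 cmulx0 => /(congr1 (@nm R B)); rewrite nm0 nmZr => /esym/eqP.
  by rewrite mulf_eq0 normr_eq0 gt_eqF //= => /eqP/nm_eq0/s_nz.
apply: core_norm_le => // v y vm yc.
have xyc := core_col xc vm yc.
have [a aE a0] := sq v y vm yc; have [b bE b0] := form v y vm yc.
have [c cE c0] := sq v _ vm xyc; have [d dE d0] := form v _ vm xyc.
have ba := le v y a b vm yc aE a0 b0 bE.
have dc := le v _ c d vm xyc cE c0 d0 dE.
have zc : col v (y + (- l^-1)%:C *: (x '** y)) by apply: colD => //; apply: col_scale.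
have [t tE t0] := form v _ vm zc.
have {tE}tE : t = b - 2 * l^-1 * c + l^-1 ^+ 2 * d.
  have cE' : y '^* '** x '** x '** y = c%:C *: p v by rewrite -cE cstarM xs !cmulA.
  have dE' : y '^* '** x '** x '** x '** y = d%:C *: p v by rewrite -dE cstarM xs !cmulA.
  have E : t%:C *: p v = (b - 2 * l^-1 * c + l^-1 ^+ 2 * d)%:C *: p v.
    rewrite -tE cstarD cstarZr cstarM xs !(cmulDl, cmulDr) !(cmulZl, cmulZr) !cmulA.
    rewrite bE cE' dE' !scalerA -!scalerDl -!rmorphM -!rmorphD; congr ((_%:C) *: _).
    by ring.
  have : (t - (b - 2 * l^-1 * c + l^-1 ^+ 2 * d))%:C *: p v = 0.
    by rewrite rmorphB scalerBl E subrr.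
  move=> /(congr1 (@nm R B)); rewrite nm0 nmZr => /eqP; rewrite mulf_eq0 normr_eq0.
  by move=> /orP[/eqP/subr0_eq //|/eqP/nm_eq0/s_nz].
have il0 : 0 < l^-1 by rewrite invr_gt0.
have ll : l^-1 * l = 1 by rewrite mulVf // gt_eqF.
have cl : l^-1 * c <= b.
  have : l^-1 ^+ 2 * d <= l^-1 * c.
    rewrite expr2 -mulrA ler_pM2l //; have := ler_wpM2l (ltW il0) dc.
    by rewrite mulrA ll mul1r.
  by move: t0; rewrite tE; lra.
have cla : c <= l ^+ 2 * a.
  have : l * (l^-1 * c) <= l * (l * a) by rewrite ler_pM2l //; apply: le_trans cl ba.
  by rewrite (mulrA l l^-1) mulfV ?gt_eqF // mul1r mulrA -expr2.
rewrite -(@ler_pXn2r _ 2) ?nnegrE ?mulr_ge0 ?nm_ge0 ?(ltW l0) //.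
by rewrite exprMn (nm_coef c0 cE) (nm_coef a0 aE) mulrA ler_wpM2r ?nm_ge0.
Qed.

(** A term of the expansion of s u v surviving on the left has w g = u h.  Then
    v h takes the values of g, translated by the difference of the shapes of u
    and v; if it also agreed with w' g, then g would be periodic. *)
Lemma nonper_compress u v w w' g : dterm u = dterm v ->
  in_box m (dshape u) -> in_box m (dshape v) ->
  dshape w = m -> dshape w' = m -> dterm w = worigin g -> dterm w' = worigin g ->
  nonper [ffun i => (dshape u i)%:Z - (dshape v i)%:Z] g ->
  p (dprod w g) '** s u v '** p (dprod w' g) = 0.
Proof.
move=> uv um vm wm wm' wg wg' [l [l' [lg lg' ll' ne]]].
pose k := subS m (dshape u) + wshape g.
have uk : dshape u + k = m + wshape g by rewrite addrA subSK.
rewrite (s_expand adm rel k uv) cmul_sumr cmul_suml big1 // => h /eqP ho.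
have hk : wshape (mkword h) = k by [].
move: (mkword h) ho hk => {}h ho hk.
have uh : dterm u = worigin h by [].
have vh : dterm v = worigin h by rewrite -uv.
rewrite (s_mul_same adm rel) ?dtermM //; last by rewrite !dshapeM // hk uk wm.
case: eqP => [E|_]; last by rewrite cmul0x.
have tt : dterm (dprod w g) = dterm (dprod v h) by rewrite E !dtermM.
rewrite -(s_mul rel tt erefl) -cmulA.
have i0 i : ((dshape u i <= m i) /\ (dshape v i <= m i))%N.
  by split; [move/in_boxP: um|move/in_boxP: vm].
pose j := subS m (dshape u) + l.
have ujl : dshape u + j = m + l by rewrite addrA subSK.
have vjl : dshape v + j = m + l'.
  apply/ffunP => i; have := ll' i; rewrite !ffunE => lli; have [ui vi] := i0 i.
  move: lli ui vi; move: (dshape u i) (dshape v i) (m i) (l i) (l' i) => x1 x2 x3 x4 x5.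
  by move=> *; lia.
have jh : in_box (wshape h) j by rewrite hk; apply: in_boxD2.
rewrite (s_orth_dval adm rel (l := dshape v + j)) ?cmulx0 //.
- by rewrite dshapeM //; apply: in_boxD2.
- by rewrite dshapeM // vjl wm'; apply: in_boxD2.
rewrite dvalr // vjl -{1}wm' dvalr // -(dvalr adm uh jh) ujl -E -wm dvalr //.
Qed.

End Core.


(** * Pure infiniteness *)

Section Main.
Variables (r : nat) (A : finType) (M : 'I_r -> A -> A -> nat).
Hypothesis adm : admissible M.
Hypothesis r1 : (1 <= r)%N.
Variables (D : countType) (delta : D -> A).
Local Notation W := (decorated M delta).
Variables (R : realType) (B : cstarAlgType R) (s : W -> W -> B).
Hypothesis univ : is_universal_algebra s.

Let rel : relations s := univ.1.

(** Otherwise the span, which is dense, would be 0. *)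
Lemma generators_neq0 (h : B) : h <> 0 -> exists u v, dterm u = dterm v /\ s u v <> 0.
Proof.
move=> h0; apply: contrapT => none; apply: h0; apply/nm_eq0/eqP.
rewrite eq_le nm_ge0 andbT; apply/ler_addgt0Pr => e e0; rewrite add0r.
have [y ys] := span_dense adm univ h e0.
suff -> : y = 0 by rewrite subr0.
elim/span_ind: y / ys => [//|y z -> ->|a u v uv]; first by rewrite addr0.
have [->|suv] := EM (s u v = 0); first by rewrite scaler0.
by case: none; exists u, v.
Qed.

Lemma shape_bound (L : seq (R[i] * (W * W))) : exists m : mshape r,
  forall q, q \in L -> in_box m (dshape q.2.1) /\ in_box m (dshape q.2.2).
Proof.
elim: L => [|q L [m IH]]; first by exists 0.
exists (joinS (joinS (dshape q.2.1) (dshape q.2.2)) m) => p; rewrite inE => /orP[/eqP ->|/IH[p1 p2]].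
  split; apply: in_box_trans (in_box_joinl _ _) _; [exact: in_box_joinl|exact: in_box_joinr].
by split; apply: in_box_trans (in_box_joinr _ _) _.
Qed.

Lemma core_lsum m (L : seq (R[i] * (W * W))) : good L ->
  (forall q, q \in L -> in_box m (dshape q.2.1) /\ in_box m (dshape q.2.2)) ->
  core s m (lsum s [seq q <- L | dshape q.2.1 == dshape q.2.2]).
Proof.
move=> Lg Lm; rewrite /lsum big_filter big_seq_cond; apply: core_sum => q /andP[qL /eqP E].
have /eqP uv := allP Lg q qL; have [um vm] := Lm q qL.
rewrite (s_expand adm rel (subS m (dshape q.2.1)) uv) /wsum scaler_sumr.
apply: core_sum => g /eqP go; have ug : dterm q.2.1 = worigin (mkword g) by [].
apply: coreZ; first by rewrite dshapeM // subSK.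
  by rewrite dshapeM -?uv // -E subSK.
by rewrite !dtermM -?uv.
Qed.

Lemma col_kill m v y g t : dterm v = worigin g -> col s m v y ->
  (forall w, dshape w = m -> dterm w = worigin g ->
     t '** s (dprod w g) (dprod w g) = 0) ->
  t '** y '** s (dprod v g) (dprod v g) = 0.
Proof.
move=> vg yc tK; elim: yc => [|y1 y2 _ IH1 _ IH2|a w wm wv].
- by rewrite cmulx0 cmul0x.
- by rewrite cmulDr cmulDl IH1 IH2 addr0.
have wg : dterm w = worigin g by rewrite wv.
rewrite cmulZr cmulZl -cmulA (s_absorb adm rel) //.
rewrite -(s_mul rel (u := dprod w g) (v := dprod w g)) ?dtermM //.
by rewrite cmulA tK // cmul0x scaler0.
Qed.

Lemma col_compress m v y g x : dterm v = worigin g -> col s m v y ->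
  (forall w w', dshape w = m -> dshape w' = m ->
     dterm w = worigin g -> dterm w' = worigin g ->
     s (dprod w g) (dprod w g) '** x '** s (dprod w' g) (dprod w' g) = 0) ->
  s (dprod v g) (dprod v g) '** y '^* '** x '** y '** s (dprod v g) (dprod v g) = 0.
Proof.
move=> vg yc xK; apply: (@col_kill m) => // w' wm' wg'.
have pstar u : (s u u) '^* = s u u by case: (s_proj rel u).
have E : s (dprod w' g) (dprod w' g) '** x '^* '** y '** s (dprod v g) (dprod v g) = 0.
  apply: (@col_kill m) => // w wm wg.
  by rewrite -[RHS]cstar0 -(xK w w') // !cstarM !pstar !cmulA.
by rewrite -[RHS]cstar0 -E !cstarM !pstar cstarK !cmulA.
Qed.

Theorem universal_purely_infinite : purely_infinite B.
Proof.
move=> h0 [x0 h0E] h0_neq0.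
have hs : h0 '^* = h0 by rewrite h0E cstarM cstarK.
move: h0 hs h0_neq0 {h0E x0} => h hs h_neq0.
have nz := generators_neq0 h_neq0; have s_nz := s_neq0 adm rel nz.
have [c [L [c0 L0 low]]] := average_lower adm univ h_neq0.
pose H := h '** h.
have H0 := nm_ge0 h.
(* The error e is small compared with the lower bound c of the averages; d is
   such that | h - y | <= d makes | h^2 - y^* y | <= e. *)
pose e := c / 16; have e0 : 0 < e by rewrite divr_gt0.
pose d := Num.min 1 (e / (2 * nm h + 2)).
have d0 : 0 < d by rewrite lt_min ltr01 divr_gt0 //; lra.
have [y ys hy] := span_dense adm univ h d0.
have nmy : nm y <= nm h + 1.
  rewrite -[y](subKr h) -opprB nmN; apply: le_trans (nmD _ _) _.
  by rewrite nmN addrC lerD2l; apply: le_trans hy _; rewrite ge_min lexx.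
pose k := y '^* '** y.
have Hk : nm (H - k) <= e.
  have -> : H - k = h '** (h - y) + (h - y) '^* '** y.
    by rewrite cmulBr cstarB hs cmulBl addrA subrK.
  apply: le_trans (nmD _ _) _; have h1 := nmM h (h - y); have h2 := nmM ((h - y) '^*) y.
  rewrite nm_star in h2.
  have h3 := ler_wpM2l H0 hy.
  have h4 := ler_pM (nm_ge0 _) (nm_ge0 _) hy nmy.
  have : d * (2 * nm h + 2) <= e.
    by rewrite -ler_pdivlMr ?ge_min ?lexx ?orbT //; lra.
  by have := ltW d0; lra.
have [K Kg kE] : span s k by apply: spanM => //; apply: spanS.
have [m Km] := shape_bound K.
pose X := lsum s [seq q <- K | dshape q.2.1 == dshape q.2.2].
have Xcore : core s m X := core_lsum Kg Km.
(* The order n = L q0 of the roots exceeds every coordinate of a shape in K. *)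
pose q0 := (\sum_i m i).+1; pose n := (L * q0)%N.
have n0 : (0 < n)%N by rewrite muln_gt0 L0.
have /choice[f fg] : forall l : {ffun 'I_r -> 'I_n}, exists f : B -> B, is_gauge s (rootz R l) f.
  by move=> l; apply: (gauge_ex adm univ) => i; apply: rootz1.
have mn i : (m i < n)%N.
  apply: (@leq_trans q0); last by rewrite leq_pmull.
  by rewrite ltnS (bigD1 i) //= leq_addr.
have avg : \sum_l f l k = (n ^ r)%:R *: X.
  rewrite kE; apply: (average_lsum n0 fg Kg) => q /Km[/in_boxP um /in_boxP vm] i.
  by split; [apply: leq_ltn_trans (um i) _|apply: leq_ltn_trans (vm i) _].
have nC : (n ^ r)%:R = ((n ^ r)%:R : R)%:C :> R[i] by rewrite rmorph_nat.
rewrite nC in avg.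
have nr0 : 0 < (n ^ r)%:R :> R by rewrite ltr0n expn_gt0 n0.
have XE : X = \sum_l ((Num.sqrt (n ^ r)%:R^-1)%:C *: f l y) '^* '** ((Num.sqrt (n ^ r)%:R^-1)%:C *: f l y).
  have -> : X = (n ^ r)%:R^-1%:C *: \sum_l f l k.
    by rewrite avg scalerA -rmorphM mulVf ?gt_eqF // scale1r.
  rewrite scaler_sumr; apply: eq_bigr => l _.
  rewrite cstarZr cmulZl cmulZr scalerA -rmorphM -expr2 sqr_sqrtr ?invr_ge0 //.
  by rewrite /k (morM (fg l).1) (morS (fg l).1).
have nmX : c - 4 * e <= nm X.
  have := low q0 isT f fg; rewrite -/n.
  have -> : \sum_l (f l h) '^* '** f l h = \sum_l f l (H - k) + (n ^ r)%:R%:C *: X.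
    rewrite -avg -big_split; apply: eq_bigr => l _ /=.
    by rewrite -(morS (fg l).1) hs -(morM (fg l).1) -(morD (fg l).1) subrK.
  move=> /le_trans/(_ (nmD _ _)).
  rewrite nmZr ger0_norm //.
  have : nm (\sum_l f l (H - k)) <= (n ^ r)%:R * (4 * e).
    apply: le_trans (nm_sum _ _ _) _.
    have -> : (n ^ r)%:R * (4 * e) = \sum_(l : {ffun 'I_r -> 'I_n}) (4 * e).
      by rewrite sumr_const card_ffun !card_ord mulr_natl.
    apply: ler_sum => l _; apply: le_trans (mor_bounded (fg l).1 _) _.
    by rewrite ler_pM2l.
  move=> h1 h2; rewrite -(ler_pM2r nr0) mulrBl; lra.
have lam : 0 < c / 2 < nm X.
  by rewrite divr_gt0 //=; move: nmX; rewrite /e; lra.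
(* The norm of X is at least c - 4 e, which exceeds c / 2. *)
have [v [z [a [b [vm zc zz zXz [a0 ab]]]]]] := core_vector adm rel s_nz Xcore XE lam.
have b0 : 0 < b by apply: le_lt_trans ab; rewrite mulr_ge0 ?divr_ge0 ?(ltW a0) ?(ltW c0).
have [g go gnp] := nonper_seq adm
  [seq [ffun i => (dshape q.2.1 i)%:Z - (dshape q.2.2 i)%:Z] | q <- K] (dterm v).
pose Q := s (dprod v g) (dprod v g).
have [Qs QQ] : projection Q := s_proj rel _.
have vQ : s v v '** Q = Q by apply: (s_absorb adm rel).
(* Normalized so that w^* X w = Q. *)
pose w := (Num.sqrt b^-1)%:C *: (z '** Q).
have bi : 0 <= b^-1 by rewrite invr_ge0 ltW.
have wxw t : w '^* '** t '** w = b^-1%:C *: (Q '** z '^* '** t '** z '** Q).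
  rewrite /w cstarZr cstarM Qs !(cmulZl, cmulZr) scalerA -rmorphM -expr2 sqr_sqrtr //.
  by rewrite !cmulA.
have QvQ (t : R) : Q '** (t%:C *: s v v) '** Q = t%:C *: Q.
  by rewrite cmulZr cmulZl -cmulA vQ QQ.
have wkw : w '^* '** k '** w = Q.
  have -> : k = X + lsum s [seq q <- K | dshape q.2.1 != dshape q.2.2].
    by rewrite kE /X /lsum !big_filter [LHS](bigID (fun q => dshape q.2.1 == dshape q.2.2)).
  rewrite cmulDr cmulDl wxw -[Q '** z '^* '** X]cmulA -[Q '** (_ '** _) '** z]cmulA zXz QvQ.
  rewrite scalerA -rmorphM mulVf ?gt_eqF // scale1r.
  rewrite wxw /lsum cmul_sumr !cmul_suml big_seq big1 ?scaler0 ?addr0 // => q.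
  rewrite mem_filter => /andP[qne qK]; have /eqP uv := allP Kg q qK.
  have [um vm'] := Km q qK.
  rewrite cmulZr !cmulZl (col_compress (esym go) zc) ?scaler0 // => w1 w2 w1m w2m w1g w2g.
  apply: (nonper_compress adm rel (m := m)) => //.
  apply: gnp; first by apply/mapP; exists q.
  apply: contra qne => /eqP/ffunP E; apply/eqP/ffunP => i.
  by have := E i; rewrite !ffunE => /subr0_eq [].
have ww : nm w ^+ 2 <= a / b.
  rewrite -nm_starM.
  have -> : w '^* '** w = (b^-1 * a)%:C *: Q.
    rewrite /w cstarZr cstarM Qs !(cmulZl, cmulZr) scalerA -rmorphM -expr2 sqr_sqrtr //.
    by rewrite cmulA -[Q '** _ '** z]cmulA zz QvQ scalerA -rmorphM.
  rewrite nmZr ger0_norm ?mulr_ge0 ?(ltW a0) // mulrC [b^-1 * a]mulrC ler_piMl ?mulr_ge0 ?(ltW a0) //.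
  exact: nm_proj.
apply: (@cutdown _ _ h Q w hs (s_infinite adm rel r1 nz _)).
  by rewrite /w cmulZl -cmulA QQ.
rewrite -wkw -cmulBl -cmulBr -/H.
apply: le_trans (nmM _ _) _.
have h1 := ler_wpM2r (nm_ge0 w) (nmM (w '^*) (k - H)).
apply: le_trans h1 _; rewrite nm_star mulrAC -expr2.
rewrite nmB in Hk.
apply: le_trans (ler_pM (sqr_ge0 _) (nm_ge0 _) ww Hk) _.
rewrite mulrAC ler_pdivrMr //; move: ab; rewrite /e; have := mulr_gt0 a0 c0; lra.
Qed.

End Main.

Theorem proposition5p11 (R : realType) (r : nat) (r_ge1 : (1 <= r)%N)
  (A : finType) (A_nonempty : (0 < #|A|)%N) (M : 'I_r -> A -> A -> nat)
  (M_adm : admissible M)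
  (D : countType) (D_nonempty : inhabited D) (delta : D -> A)
  (AD : cstarAlgType R)
  (s : decorated M delta -> decorated M delta -> AD)
  (AD_univ : is_universal_algebra s) :
  purely_infinite AD.
Proof. exact: (universal_purely_infinite M_adm r_ge1 AD_univ). Qed.
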